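(* Let $\mathcal{G}$ be a compact connected metric graph, fix $k\ge 1$ and $p\in(0,\infty]$, and let $A\subset \mathfrak{P}_k(\mathcal{G})$ be any nonempty set of exhaustive (loose) $k$-partitions of $\mathcal{G}$. Then there exist $k$-partitions $\mathcal{P}^N,\mathcal{P}^D\in\overline{A}\cap\mathfrak{P}_k(\mathcal{G})$ such that $$\Lambda^N_p(\mathcal{P}^N)=\inf_{\mathcal{P}\in A}\Lambda^N_p(\mathcal{P})\qquad\text{and}\qquad \Lambda^D_p(\mathcal{P}^D)=\inf_{\mathcal{P}\in A}\Lambda^D_p(\mathcal{P}).$$ In particular, if $A\subset\mathfrak{R}_k(\mathcal{G})$ is a set of rigid $k$-partitions, then $\mathcal{P}^N$ and $\mathcal{P}^D$ are also rigid $k$-partitions.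
   Context: Metric graphs: a metric graph $\mathcal{G}$ consists of finitely many edges (compact intervals of positive finite length) whose set of endpoints is divided into nonempty disjoint classes, the vertices, the endpoints in a class being identified. Loops, multiple edges and vertices of degree two (dummy vertices) are allowed; graphs differing only by relabelling or by insertion/removal of dummy vertices are identified, so any point of an edge may be regarded as a vertex. $|\mathcal{G}|$ is the total length. Partitions: a cut of $\mathcal{G}$ is a metric graph with the same edges (for a suitable representative of $\mathcal{G}$) such that each of its vertex classes is contained in a vertex class of $\mathcal{G}$; a vertex of $\mathcal{G}$ is cut nontrivially if its class is split into at least two classes. A $k$-partition $\mathcal{P}=\{\mathcal{G}_1,\dots,\mathcal{G}_k\}$ of $\mathcal{G}$ is a set of $k$ distinct connected components (clusters) of some cut of $\mathcal{G}$; it is exhaustive if these are all the components of the cut. The support $\Omega_i$ of $\mathcal{G}_i$ is the closed subset of $\mathcal{G}$ made of the edges of $\mathcal{G}_i$; $\partial\Omega_i$ is its topological boundary in $\mathcal{G}$. The cut set of $\mathcal{P}$ is the set of vertices of $\mathcal{G}$ in $\bigcup_i\Omega_i$ that are cut nontrivially; $\mathcal{V}_D(\mathcal{G}_i)\subset\mathcal{G}_i$ is the set of vertices of $\mathcal{G}_i$ obtained by nontrivially cutting vertices of $\mathcal{G}$; the separation set is $\bigcup_i\partial\Omega_i$. Every partition is called loose; it is rigid if its cut set and separation set agree. $\mathfrak{P}_k(\mathcal{G})$, $\mathfrak{R}_k(\mathcal{G})$ denote the sets of exhaustive loose, respectively exhaustive rigid, $k$-partitions. Energies: $\mu_2(\mathcal{G}_i)$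 is the smallest nontrivial (second) eigenvalue of the Laplacian $-\frac{d^2}{dx^2}$ on $\mathcal{G}_i$ with natural (continuity plus Kirchhoff) conditions at all vertices; $\lambda_1(\mathcal{G}_i)=\inf\{\int_{\mathcal{G}_i}|f'|^2/\int_{\mathcal{G}_i}|f|^2: 0\ne f\in H^1(\mathcal{G}_i),\ f=0\text{ on }\mathcal{V}_D(\mathcal{G}_i)\}$ is the smallest eigenvalue with Dirichlet conditions at $\mathcal{V}_D(\mathcal{G}_i)$ and natural conditions elsewhere ($H^1$ functions on a graph are continuous across vertices). For $p\in(0,\infty)$, $\Lambda^N_p(\mathcal{P})=\left(\frac1k\sum_{i=1}^k\mu_2(\mathcal{G}_i)^p\right)^{1/p}$, $\Lambda^D_p(\mathcal{P})=\left(\frac1k\sum_{i=1}^k\lambda_1(\mathcal{G}_i)^p\right)^{1/p}$; $\Lambda^N_\infty(\mathcal{P})=\max_i\mu_2(\mathcal{G}_i)$, $\Lambda^D_\infty(\mathcal{P})=\max_i\lambda_1(\mathcal{G}_i)$. Topology: two exhaustive loose $k$-partitions of $\mathcal{G}$ are similar if, for suitable representatives and numbering, corresponding clusters have the same underlying discrete (combinatorial) graph and there is a bijection between the cut sets. Similarity is an equivalence relation on $\mathfrak{P}_k(\mathcal{G})$ with finitely many classes, called primitive partitions. Within a primitive partition $\mathfrak{T}$ (with fixed order of clusters and edges) each cluster is identified with the vector of its edge lengths, and $d(\mathcal{P},\widetilde{\mathcal{P}})$ is the sum over $i=1,\dots,k$ of the Euclidean distances between the edge length vectors of the $i$-th clusters.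 $\overline{\mathfrak{T}}$ is the completion: the limit of a Cauchy sequence is identified with the partition whose clusters have the limiting edge lengths, edges of limit length zero being contracted to points and clusters of total length tending to zero being discarded (so limits of $k$-partitions are $m$-partitions with $m\le k$). For $A\subset\mathfrak{P}_k(\mathcal{G})$, $\overline{A}$ is the union over all primitive partitions $\mathfrak{T}$ of the closures of $A\cap\mathfrak{T}$ in $\overline{\mathfrak{T}}$. *)

(* Defs.v *)
From HB Require Import structures.
From mathcomp Require Import all_boot all_order all_algebra.
From mathcomp Require Import all_classical all_reals all_analysis.
Import numFieldNormedType.Exports.

Set Implicit Arguments.
Unset Strict Implicit.
Unset Printing Implicit Defensive.

Import Order.TTheory GRing.Theory Num.Theory.

Local Open Scope classical_set_scope.
Local Open Scope ring_scope.

(** * Metric graphs *)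

(* The endpoints of an edge [e] are [(e, false)] and [(e, true)]; in a metric
   graph they are the points [0] and [len e] of the interval [[0, len e]].
   The vertices are the classes of the equivalence relation [glued] on the
   endpoints.  Loops and multiple edges are allowed. *)
Record discrete_graph := DiscreteGraph {
  nedges : nat;
  glued : rel ('I_nedges * bool);
  glued_equiv : equivalence_rel glued }.

Notation edge D := 'I_(nedges D).
Notation endpoint D := (edge D * bool)%type.

Record metric_graph (R : realType) := MetricGraph {
  mg_discrete :> discrete_graph;
  len : edge mg_discrete -> R;
  len_gt0 : forall e, 0 < len e }.

Definition linked (D : discrete_graph) : rel (endpoint D) :=
  fun x y => glued x y || (x.1 == y.1).

Definition edge_component (D : discrete_graph) (e : edge D) : {set edge D} :=
  [set e' | connect (@linked D) (e, false) (e', false)]%SET.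

Definition components (D : discrete_graph) : {set {set edge D}} :=
  [set edge_component e | e : edge D]%SET.

Definition graph_connected (D : discrete_graph) : Prop := #|components D| = 1%N.

Section Subgraph.
Variables (R : realType) (G : metric_graph R) (C : {set edge G}).

(* The edges of the subgraph are numbered in the order of [enum C]. *)
Definition subgraph_end (x : 'I_#|C| * bool) : endpoint G :=
  (enum_val x.1, x.2).

Definition subgraph_glued : rel ('I_#|C| * bool) :=
  fun x y => glued (subgraph_end x) (subgraph_end y).

Lemma subgraph_glued_equiv : equivalence_rel subgraph_glued.
Proof. by move=> x y z; exact: glued_equiv. Qed.

Lemma subgraph_len_gt0 (e : 'I_#|C|) : 0 < len (enum_val e).
Proof. exact: len_gt0. Qed.

Definition subgraph : metric_graph R :=
  @MetricGraph R (DiscreteGraph subgraph_glued_equiv) _ subgraph_len_gt0.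
End Subgraph.

(** * Relabelling and dummy vertices *)

(* [flip e] tells whether the orientation of the edge [e] is reversed. *)
Definition relabel_end (m n : nat) (phi : 'I_m -> 'I_n) (flip : 'I_m -> bool)
    (x : 'I_m * bool) : 'I_n * bool := (phi x.1, x.2 (+) flip x.1).

(* Inserting a dummy vertex at the distance [t] from the endpoint [(e, false)]
   of [e] replaces [e] by an edge of length [t], which keeps the number [e] and
   the endpoint [(e, false)], and a new edge [ord_max] of length [len e - t],
   which takes over the endpoint [(e, true)] and starts at the dummy vertex.
   [old_end] maps an endpoint of the new graph to the endpoint of the old graph
   it comes from, and to [None] if it lies at the dummy vertex. *)
Section Dummy.
Variables (m : nat) (e : 'I_m).

Definition old_end (x : 'I_m.+1 * bool) : option ('I_m * bool) :=
  match unlift ord_max x.1 with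
  | Some e' => if (e' == e) && x.2 then None else Some (e', x.2)
  | None => if x.2 then Some (e, true) else None
  end.

Definition dummy_rel (r : rel ('I_m * bool)) : rel ('I_m.+1 * bool) :=
  fun x y => match old_end x, old_end y with
             | Some a, Some b => r a b
             | None, None => true
             | _, _ => false
             end.

Lemma dummy_rel_equiv (r : rel ('I_m * bool)) :
  equivalence_rel r -> equivalence_rel (dummy_rel r).
Proof.
move=> rE x y z; rewrite /dummy_rel.
by case: (old_end x) (old_end y) (old_end z) => [a|] [b|] [c|];
  split=> //; by [case: (rE a b c)|case: (rE a b a)|case: (rE a a c)|
                  case: (rE c c c)].
Qed.

Lemma dummy_rel_sub (r s : rel ('I_m * bool)) :
  subrel r s -> subrel (dummy_rel r) (dummy_rel s).
Proof.
move=> rs x y; rewrite /dummy_rel.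
by case: (old_end x) (old_end y) => [a|] [b|] //; exact: rs.
Qed.

Variables (R : realType) (l : 'I_m -> R) (t : R).

Definition dummy_len (x : 'I_m.+1) : R :=
  match unlift ord_max x with
  | Some e' => if e' == e then t else l e'
  | None => l e - t
  end.

Lemma dummy_len_gt0 : (forall e', 0 < l e') -> 0 < t < l e ->
  forall x, 0 < dummy_len x.
Proof.
move=> l0 /andP[t0 tl] x; rewrite /dummy_len.
by case: (unlift _ _) => [e'|]; [case: ifP|rewrite subr_gt0].
Qed.
End Dummy.

Definition add_dummy (R : realType) (G : metric_graph R) (e : edge G) (t : R)
    (ht : 0 < t < len e) : metric_graph R :=
  @MetricGraph R (DiscreteGraph (dummy_rel_equiv e (@glued_equiv G))) _
    (dummy_len_gt0 (@len_gt0 R G) ht).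

Definition graph_relabelling (R : realType) (G H : metric_graph R) : Prop :=
  exists (phi : edge G -> edge H) (flip : edge G -> bool),
    [/\ bijective phi,
        forall e, len (phi e) = len e &
        forall x y, glued (relabel_end phi flip x) (relabel_end phi flip y)
                    = glued x y].

(* [same_graph G H]: [G] and [H] represent the same metric graph. *)
Inductive same_graph (R : realType) : metric_graph R -> metric_graph R -> Prop :=
| same_graph_relabel G H : graph_relabelling G H -> same_graph G H
| same_graph_dummy (G : metric_graph R) (e : edge G) (t : R) (ht : 0 < t < len e) :
    same_graph G (@add_dummy R G e t ht)
| same_graph_sym G H : same_graph G H -> same_graph H G
| same_graph_trans G H K : same_graph G H -> same_graph H K -> same_graph G K.

(** * Cuts and exhaustive partitions *)

(* A graph with a cut: a second, finer equivalence relation on the endpoints.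
   The clusters of an exhaustive partition are all the components of the cut,
   so that an exhaustive partition amounts to a cut; [gpartition] is the type of
   the exhaustive loose partitions of arbitrary metric graphs. *)
Record discrete_cut := DiscreteCut {
  uncut :> discrete_graph;
  cut : rel (endpoint uncut);
  cut_equiv : equivalence_rel cut;
  cut_sub : subrel cut (@glued uncut) }.

Definition cut_discrete (D : discrete_cut) : discrete_graph :=
  DiscreteGraph (@cut_equiv D).

Definition clusters (D : discrete_cut) : {set {set edge D}} :=
  components (cut_discrete D).

(* The vertex of the endpoint [x] is cut nontrivially. *)
Definition nontriv_cut (D : discrete_cut) (x : endpoint D) : bool :=
  [exists y, glued x y && ~~ cut x y].

Record gpartition (R : realType) := GPartition {
  pt_cut :> discrete_cut;
  pt_len : edge pt_cut -> R;
  pt_len_gt0 : forall e, 0 < pt_len e }.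

(* The metric graph which is partitioned, and its cut. *)
Definition total_graph (R : realType) (P : gpartition R) : metric_graph R :=
  @MetricGraph R P _ (@pt_len_gt0 R P).

Definition cut_graph (R : realType) (P : gpartition R) : metric_graph R :=
  @MetricGraph R (cut_discrete P) _ (@pt_len_gt0 R P).

Definition cluster (R : realType) (P : gpartition R) (C : {set edge P}) :
  metric_graph R := @subgraph R (cut_graph P) C.

Definition dirichlet_vertices (R : realType) (P : gpartition R)
    (C : {set edge P}) : pred (endpoint (cluster C)) :=
  fun x => nontriv_cut (D := P) (subgraph_end (G := cut_graph P) x).

Definition exhaustive_partitions (R : realType) (G : metric_graph R) (k : nat) :
    set (gpartition R) :=
  [set P | same_graph G (total_graph P) /\ #|clusters P| = k].

(* Identification of partitions: relabelling, and insertion of dummy vertices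
   of the partitioned graph which are not cut. *)
Definition cut_dummy (D : discrete_cut) (e : edge D) : discrete_cut :=
  @DiscreteCut (DiscreteGraph (dummy_rel_equiv e (@glued_equiv D))) _
    (dummy_rel_equiv e (@cut_equiv D)) (dummy_rel_sub (@cut_sub D)).

Definition partition_dummy (R : realType) (P : gpartition R) (e : edge P)
    (t : R) (ht : 0 < t < pt_len e) : gpartition R :=
  @GPartition R (cut_dummy e) _ (dummy_len_gt0 (@pt_len_gt0 R P) ht).

Definition partition_relabelling (R : realType) (P Q : gpartition R) : Prop :=
  exists (phi : edge P -> edge Q) (flip : edge P -> bool),
    [/\ bijective phi,
        forall e, pt_len (phi e) = pt_len e,
        forall x y, glued (relabel_end phi flip x) (relabel_end phi flip y)
                    = glued x y &
        forall x y, cut (relabel_end phi flip x) (relabel_end phi flip y)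
                    = cut x y].

Inductive same_partition (R : realType) : gpartition R -> gpartition R -> Prop :=
| same_partition_relabel P Q : partition_relabelling P Q -> same_partition P Q
| same_partition_dummy (P : gpartition R) (e : edge P) (t : R) (ht : 0 < t < pt_len e) :
    same_partition P (@partition_dummy R P e t ht)
| same_partition_sym P Q : same_partition P Q -> same_partition Q P
| same_partition_trans P Q S :
    same_partition P Q -> same_partition Q S -> same_partition P S.

(** * Rigid partitions *)

(* A metric graph as a topological space.  The pair [(e, s)] with
   [0 <= s <= len e] is the point of the edge [e] at the distance [s] from its
   endpoint [(e, false)].  The graph is the quotient of the disjoint union of
   the intervals by [same_point]; a subset of the quotient is represented by
   its preimage, and [graph_open] is the quotient topology. *)
Section Topology.
Variables (R : realType) (G : metric_graph R).

Definition end_coord (x : endpoint G) : R := if x.2 then len x.1 else 0.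

Definition end_point (x : endpoint G) : edge G * R := (x.1, end_coord x).

Definition on_graph : set (edge G * R) := [set a | 0 <= a.2 <= len a.1].

Definition same_point (a b : edge G * R) : Prop :=
  a = b \/ exists x y, [/\ glued x y, a = end_point x & b = end_point y].

Definition graph_open (U : set (edge G * R)) : Prop :=
  (forall a b, same_point a b -> U a -> U b) /\
  (forall e, exists2 O : set R, open O &
     forall s, 0 <= s <= len e -> (U (e, s) <-> O s)).

Definition graph_boundary (S : set (edge G * R)) : set (edge G * R) :=
  [set a | on_graph a /\
     forall U, graph_open U -> U a ->
       (exists b, [/\ on_graph b, U b & S b]) /\
       (exists b, [/\ on_graph b, U b & ~ S b])].
End Topology.

Definition cluster_support (R : realType) (P : gpartition R)
    (C : {set edge P}) : set (edge P * R) :=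
  [set a | on_graph (G := total_graph P) a /\
     exists b, [/\ on_graph (G := total_graph P) b, b.1 \in C &
                   same_point (G := total_graph P) a b]].

Definition separation_set (R : realType) (P : gpartition R) :
    set (edge P * R) :=
  [set a | exists2 C, C \in clusters P &
     graph_boundary (G := total_graph P) (cluster_support C) a].

Definition cut_set (R : realType) (P : gpartition R) : set (edge P * R) :=
  [set a | exists2 x, nontriv_cut x & a = end_point (G := total_graph P) x].

Arguments separation_set {R} P _.
Arguments cut_set {R} P _.

Definition rigid (R : realType) : set (gpartition R) :=
  [set P | cut_set P = separation_set P].

(** * Energies *)

(* [g] is a weak derivative of [f] on [[0, l]] and belongs to [L^2(0, l)]; thus
   [f] is the continuous representative of a function of [H^1(0, l)]. *)
Definition H1_deriv (R : realType) (l : R) (f g : R -> R) : Prop :=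
  [/\ measurable_fun `[0, l] g,
      lebesgue_measure.-integrable `[0, l] (EFin \o (fun s => g s ^+ 2)) &
      forall s, 0 <= s <= l ->
        f s = f 0 + \int[lebesgue_measure]_(u in `[0, s]) g u].

Section Functions.
Variables (R : realType) (G : metric_graph R).

Definition end_value (f : edge G -> R -> R) (x : endpoint G) : R :=
  f x.1 (end_coord x).

Definition vertex_continuous (f : edge G -> R -> R) : Prop :=
  forall x y : endpoint G, glued x y -> end_value f x = end_value f y.

Definition graph_H1_deriv (f g : edge G -> R -> R) : Prop :=
  (forall e, H1_deriv (len e) (f e) (g e)) /\ vertex_continuous f.

Definition nonzero_fun (f : edge G -> R -> R) : Prop :=
  exists e s, 0 <= s <= len e /\ f e s != 0.

Definition graph_sqnorm (f : edge G -> R -> R) : R :=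
  \sum_(e : edge G) \int[lebesgue_measure]_(s in `[0, len e]) (f e s ^+ 2).

(* The derivative at [x], directed into the edge, when [g] is the derivative. *)
Definition inward_deriv (g : edge G -> R -> R) (x : endpoint G) : R :=
  if x.2 then - end_value g x else end_value g x.

Definition kirchhoff (g : edge G -> R -> R) : Prop :=
  forall x : endpoint G, \sum_(y | glued x y) inward_deriv g y = 0.

(* [f] is edgewise in [H^2] with second derivative [- m f]. *)
Definition natural_eigenvalue (m : R) : Prop :=
  exists f g : edge G -> R -> R,
    [/\ graph_H1_deriv f g,
        forall e, H1_deriv (len e) (g e) (fun s => - (m * f e s)),
        kirchhoff g &
        nonzero_fun f].

(* On a connected graph the eigenvalue 0 is simple, with constant
   eigenfunctions. *)
Definition mu2 : R := inf [set m | natural_eigenvalue m /\ m != 0].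

Definition lambda1 (VD : pred (endpoint G)) : R :=
  inf [set q | exists f g : edge G -> R -> R,
    [/\ graph_H1_deriv f g,
        forall x, VD x -> end_value f x = 0,
        nonzero_fun f &
        q = graph_sqnorm g / graph_sqnorm f]].
End Functions.

(* The energies are nonnegative, so that the maximum may be taken from 0.  The
   value for [p = -oo] is irrelevant. *)
Definition power_mean (R : realType) (p : \bar R) (I : finType) (S : {set I})
    (a : I -> R) : R :=
  match p with
  | q%:E => ((#|S|%:R)^-1 * \sum_(i in S) a i `^ q) `^ q^-1
  | +oo%E => \big[Num.max/0]_(i in S) a i
  | -oo%E => 0
  end.

Definition LambdaN (R : realType) (p : \bar R) (P : gpartition R) : R :=
  power_mean p (clusters P) (fun C => mu2 (cluster C)).

Definition LambdaD (R : realType) (p : \bar R) (P : gpartition R) : R :=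
  power_mean p (clusters P)
    (fun C => lambda1 (@dirichlet_vertices R P C)).

(** * Primitive partitions and the closure *)

(* Two partitions are similar if, for suitable representatives, they have the
   same underlying [discrete_cut]: equal [cut]s mean that the clusters have the
   same discrete graphs, equal [glued]s that the pieces of cut points correspond
   under a bijection of the cut sets.  Accordingly [D : discrete_cut] stands for
   a primitive partition, and [of_type D l P] says that [P] belongs to it and
   has the edge lengths [l]. *)
Definition of_type (R : realType) (D : discrete_cut) (l : edge D -> R)
    (P : gpartition R) : Prop :=
  exists l_gt0 : (forall e, 0 < l e), same_partition (GPartition l_gt0) P.

Definition length_dist (R : realType) (D : discrete_cut) (l l' : edge D -> R) :
    R :=
  \sum_(C in clusters D) Num.sqrt (\sum_(e in C) (l e - l' e) ^+ 2).

(* Contraction of the edges of length zero.  The clusters of total length zero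
   have no edges left, hence they disappear. *)
Section Contraction.
Variables (R : realType) (D : discrete_cut) (l : edge D -> R).

Definition kept_edges : {set edge D} := [set e | 0 < l e]%SET.

Definition contract_step (r : rel (endpoint D)) : rel (endpoint D) :=
  fun x y => r x y || ((x.1 == y.1) && ~~ (0 < l x.1)).

Definition contract_rel (r : rel (endpoint D)) : rel ('I_#|kept_edges| * bool) :=
  fun x y => connect (contract_step r) (enum_val x.1, x.2) (enum_val y.1, y.2).

Lemma contract_rel_equiv (r : rel (endpoint D)) :
  equivalence_rel r -> equivalence_rel (contract_rel r).
Proof.
move=> /equivalence_relP[rR rT]; have rS : symmetric (contract_step r).
  have rC : symmetric r by move=> x y; apply/idP/idP => /rT <-; exact: rR.
  move=> x y; rewrite /contract_step rC; congr orb.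
  by rewrite eq_sym; case: eqP => //= ->.
move=> x y z; split; first exact: connect0.
by move=> xy; rewrite /contract_rel (same_connect (sym_connect_sym rS) xy).
Qed.

Lemma contract_rel_sub (r s : rel (endpoint D)) :
  subrel r s -> subrel (contract_rel r) (contract_rel s).
Proof.
move=> rs x y; apply: connect_sub => a b /orP[/rs sab|ab].
- by apply: connect1; rewrite /contract_step sab.
- by apply: connect1; rewrite /contract_step ab orbT.
Qed.

Lemma kept_len_gt0 (e : 'I_#|kept_edges|) : 0 < l (enum_val e).
Proof. by have := enum_valP e; rewrite inE. Qed.

Definition contract : gpartition R :=
  @GPartition R
    (@DiscreteCut (DiscreteGraph (contract_rel_equiv (@glued_equiv D))) _
       (contract_rel_equiv (@cut_equiv D)) (contract_rel_sub (@cut_sub D)))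
    _ kept_len_gt0.
End Contraction.

(* The points of the completion of a primitive partition are the limits [l] of
   its Cauchy sequences of length vectors, identified with [contract l]. *)
Definition partition_closure (R : realType) (A : set (gpartition R)) :
    set (gpartition R) :=
  [set P | exists (D : discrete_cut) (u : nat -> edge D -> R) (l : edge D -> R),
    [/\ forall n, exists2 Q, A Q & of_type (u n) Q,
        length_dist (u n) l @[n --> \oo] --> (0 : R) &
        same_partition (contract l) P]].

(* Main.v *)
From Pilot Require Import Defs.
From HB Require Import structures.
From mathcomp Require Import all_boot all_order all_algebra.
From mathcomp Require Import all_classical all_reals all_analysis.
From mathcomp Require Import measurable_realfun.
From mathcomp Require Import perm lra.
Import numFieldNormedType.Exports.
Import Pilot.Defs.

Set Implicit Arguments.
Unset Strict Implicit.
Unset Printing Implicit Defensive.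

Import Order.TTheory GRing.Theory Num.Theory.

Local Open Scope classical_set_scope.
Local Open Scope ring_scope.

(** The proof is the direct method of the calculus of variations.

    Compactness.  Remove from a partition all uncut vertices of degree two that
    can be removed.  Each remaining edge either ends at a point where the degree
    in [G] is not two, or is a whole cluster; hence the number of edges is bounded
    ([nedges_reduced]), only finitely many primitive partitions occur, and a
    subsequence of a minimizing sequence belongs to one of them, [D], with lengths
    [u n] which converge to some [l >= 0] ([partition_subsequence]).  The minimizer
    is [contract l].

    No cluster collapses.  By a Poincare inequality ([rayleigh_lower_bound]) the
    energy of a cluster of length [L] is at least a constant times [L^-2]; for
    [lambda1] this needs a Dirichlet vertex, and a cluster without one is the whole
    of the connected graph [G], the length of which is fixed.

    The limit is a partition of [G].  As long as two different edges of [D] meet at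
    a vertex of degree two, they can be merged.  When no such vertex is left, the
    length of each edge is one of the finitely many lengths of chains in [G], so
    that the sequence [u n] is eventually constant.  This shows that the contraction
    represents [G], and also that the vanishing edges form a forest
    ([limit_presents]).  Therefore the contraction never glues the pieces of a cut
    vertex together again ([zero_connect_glued]): its cut vertices are those that
    come from cut vertices of [D], which preserves both the Dirichlet conditions and
    rigidity ([contract_nontriv], [contract_rigid]).

    Continuity of the energies.  Both energies are written as infima of Rayleigh
    quotients on graphs some of whose edges may have length zero ([rayleigh]).  Such
    an infimum depends continuously on the lengths ([rayleigh_inf_cvg]): trial
    functions of the limit are rescaled, and conversely nearly optimal functions
    are transplanted to the limit after a small correction of their vertex values
    ([transplant]).

    Since [mu2] is defined through eigenvalues, one has to know that the infimum
    [nu] of its Rayleigh quotients is an eigenvalue ([mu2E]).  Dummy vertices make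
    all edges short compared with [nu^(-1/2)].  Then a function splits on each edge
    into the solution of [w'' = - nu w] with the same boundary values and a
    remainder, orthogonal to it, on which [int f'^2 - nu int f^2] is positive.  So
    the minimization reduces to the finitely many vertex values, where a minimizer
    exists by compactness, and criticality of the minimizer is the Kirchhoff
    condition ([short_eigenvalue]). *)

(** * Affine substitutions and integrals over intervals *)

Section AffineSubstitution.
Variable R : realType.
Notation mu := (@lebesgue_measure R).
Variables (al be : R).
Hypothesis al0 : al != 0.
Let aff : measurableTypeR R -> measurableTypeR R := fun x => al * x + be.

Lemma measurable_affine : measurable_fun [set: measurableTypeR R] aff.
Proof. by apply: measurable_funD => //; apply: measurable_funM. Qed.

Lemma affine_preimage (a b : R) : aff @^-1` `]a, b] =
  [set` if 0 < al then `](a - be) / al, (b - be) / al]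
  else `[(b - be) / al, (a - be) / al[].
Proof.
apply/seteqP; case: ltgtP al0 => // al_gt0 _; split => x /=; rewrite !in_itv /= /aff.
all: rewrite ?ltr_pdivrMr ?ler_pdivlMr ?ltr_ndivlMr ?ler_ndivrMr //; lra.
Qed.

Lemma lebesgue_measure_affine (A : set (measurableTypeR R)) : measurable A ->
  mu A = (`|al|%:E * mu (aff @^-1` A))%E.
Proof.
move=> mA.
pose nu := mscale (NngNum (normr_ge0 al)) (measure_function_pushforward__canonical__measure_function_Measure mu measurable_affine).
have -> : (`|al|%:E * mu (aff @^-1` A))%E = nu A by [].
apply: lebesgue_measure_unique => // _ [[a b]] _ <-; rewrite [fst _]/= [snd _]/=.
transitivity (`|al|%:E * mu (aff @^-1` `]a, b]))%E => //.
rewrite affine_preimage.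
have dE c d : (c - be) / al - (d - be) / al = (c - d) / al.
  by rewrite -mulrBl opprB addrA subrK.
have [ab|ba] := ltP a b; last first.
  rewrite set_itv_ge ?bnd_simp -?leNgt// measure0; case: ifPn => al_gt0.
    rewrite set_itv_ge ?measure0 ?mule0// bnd_simp -leNgt.
    by rewrite ler_pM2r ?invr_gt0 // lerD2r.
  rewrite set_itv_ge ?measure0 ?mule0// bnd_simp -leNgt.
  by rewrite ler_wnM2r ?invr_le0 ?lerD2r// leNgt.
rewrite lebesgue_measure_itv /= lte_fin ab; case: ifPn => al_gt0.
  rewrite lebesgue_measure_itv /= lte_fin ltr_pM2r ?invr_gt0 // ltrD2r ab.
  by rewrite -!EFinD -EFinM gtr0_norm // dE mulrC divfK.
have al_lt0 : al < 0 by rewrite lt_neqAle al0 leNgt.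
rewrite lebesgue_measure_itv /= lte_fin ltr_nM2r ?invr_lt0 // ltrD2r ab.
by rewrite -!EFinD -EFinM ltr0_norm // dE mulNr mulrC divfK // opprB.
Qed.

Lemma ge0_integral_affine (D : set (measurableTypeR R)) (f : R -> \bar R) :
  measurable D -> measurable_fun D f -> (forall x, D x -> (0 <= f x)%E) ->
  (\int[mu]_(x in D) f x =
   `|al|%:E * \int[mu]_(x in aff @^-1` D) f (al * x + be)%R)%E.
Proof.
move=> mD mf f0.
have f0' : {in D, forall y, (0 <= f y)%E} by move=> y; rewrite inE; exact: f0.
rewrite -(ge0_integral_pushforward measurable_affine mu mD mf f0').
pose nu := measure_function_pushforward__canonical__measure_function_Measure
  mu measurable_affine.
have := @ge0_integral_mscale _ _ _ nu _ mD (NngNum (normr_ge0 al)) f mf f0.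
rewrite /= => <-.
apply: eq_measure_integral => A mA AD.
move=> /=; rewrite /mscale /= /pushforward. exact: (lebesgue_measure_affine mA).
Qed.

Lemma measurable_affine_preimage (D : set (measurableTypeR R)) : measurable D ->
  measurable (aff @^-1` D).
Proof. by move=> mD; rewrite -[_ @^-1` _]setTI; exact: measurable_affine. Qed.

Lemma integrable_affine (D : set (measurableTypeR R)) (f : R -> R) : measurable D ->
  mu.-integrable D (EFin \o f) ->
  mu.-integrable (aff @^-1` D)
    (EFin \o (fun x => f (al * x + be))).
Proof.
move=> mD /integrableP[mf fi]; apply/integrableP; split.
  apply: (@measurable_comp _ _ _ _ _ _ D (EFin \o f) _ aff) => //.
    by move=> _ [x Dx <-].
  exact: measurable_funS measurable_affine.
have : (\int[mu]_(x in D) `|(EFin \o f) x| < +oo)%E by [].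
rewrite ge0_integral_affine //; last exact: measurableT_comp.
rewrite !lt_neqAle !leey !andbT; apply: contra => /eqP ->.
by rewrite gt0_muley // lte_fin normr_gt0.
Qed.

Lemma Rintegral_affine (D : set (measurableTypeR R)) (f : R -> R) : measurable D ->
  mu.-integrable D (EFin \o f) ->
  \int[mu]_(x in D) f x =
  `|al| * \int[mu]_(x in aff @^-1` D) f (al * x + be).
Proof.
move=> mD fi; have fi' := integrable_affine mD fi.
have mf := measurable_int mu fi.
have mD' := measurable_affine_preimage mD.
have fpi' : mu.-integrable (aff @^-1` D) ((EFin \o f)^\+ \o aff)%E by rewrite -[X in integrable _ _ X](funepos_comp (EFin \o f) aff); exact: (integrable_funepos mD' fi').
have fni' : mu.-integrable (aff @^-1` D) ((EFin \o f)^\- \o aff)%E by rewrite -[X in integrable _ _ X](funeneg_comp (EFin \o f) aff); exact: (integrable_funeneg mD' fi').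
have EP := ge0_integral_affine mD (measurable_funepos mf)
  (fun x _ => funepos_ge0 (EFin \o f) x).
have EN := ge0_integral_affine mD (measurable_funeneg mf)
  (fun x _ => funeneg_ge0 (EFin \o f) x).
have E : (\int[mu]_(x in aff @^-1` D) (f (al * x + be))%:E =
    \int[mu]_(x in aff @^-1` D) ((EFin \o f)^\+ (al * x + be)%R) -
    \int[mu]_(x in aff @^-1` D) ((EFin \o f)^\- (al * x + be)%R))%E.
  rewrite integralE; congr (_ - _)%E; apply: eq_integral => x _.
    by rewrite !funeposE.
  by rewrite !funenegE.
rewrite /Rintegral E integralE EP EN.
have /fineK <- := integrable_fin_num mD' fpi'.
have /fineK <- := integrable_fin_num mD' fni'.
by rewrite -!EFinM -!EFinB /= mulrBr.
Qed.

End AffineSubstitution.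

Section IntervalCalculus.
Variable R : realType.
Notation mu := (@lebesgue_measure R).
Notation itg a b f := (\int[mu]_(u in `[a, b]) f u).
Notation intb a b f := (mu.-integrable `[a, b] (EFin \o f)).
Implicit Types (a b c M : R) (f g h k : R -> R).

Lemma itg_affine_pos al be a b f : 0 < al ->
  intb (al * a + be) (al * b + be) f ->
  intb a b (fun x => f (al * x + be)) /\
  itg (al * a + be) (al * b + be) f = al * itg a b (fun x => f (al * x + be)).
Proof.
move=> al0 fi; have al_neq0 : al != 0 by rewrite gt_eqF.
have pre : (fun x => al * x + be) @^-1` `[al * a + be, al * b + be] = `[a, b]%classic.
  by apply/seteqP; split=> x; rewrite /= !in_itv /= !lerD2r !ler_pM2l.
split; first by rewrite -pre; apply: (@integrable_affine R al be al_neq0 _ f _ fi); exact: measurable_itv.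
by rewrite (Rintegral_affine be al_neq0) // pre gtr0_norm.
Qed.

Lemma itg_affine_neg al be a b f : al < 0 ->
  intb (al * b + be) (al * a + be) f ->
  intb a b (fun x => f (al * x + be)) /\
  itg (al * b + be) (al * a + be) f = - al * itg a b (fun x => f (al * x + be)).
Proof.
move=> al0 fi; have al_neq0 : al != 0 by rewrite lt_eqF.
have pre : (fun x => al * x + be) @^-1` `[al * b + be, al * a + be] = `[a, b]%classic.
  by apply/seteqP; split=> x; rewrite /= !in_itv /= !lerD2r !ler_nM2l // andbC.
split; first by rewrite -pre; apply: (@integrable_affine R al be al_neq0 _ f _ fi); exact: measurable_itv.
by rewrite (Rintegral_affine be al_neq0) // pre ltr0_norm.
Qed.

Let mitv a b : measurable (`[a, b]%classic : set (measurableTypeR R)).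
Proof. exact: measurable_itv. Qed.

Lemma intb_sub a b c d f : a <= c -> d <= b -> intb a b f -> intb c d f.
Proof.
move=> ac db; apply: integrableS => //; apply: subset_itv; rewrite bnd_simp //.
Qed.

Lemma itg_chasles a c b f : a <= c -> c <= b -> intb a b f ->
  itg a b f = itg a c f + itg c b f.
Proof.
move=> ac cb fi; apply/eqP; rewrite addrC -subr_eq; apply/eqP.
rewrite Rintegral_itvB ?bnd_simp // Rintegral_itv_obnd_cbnd //.
apply: integrableS fi => //; apply: subset_itvr; rewrite bnd_simp //.
Qed.

Lemma itg_cst a b c : a <= b -> itg a b (fun=> c) = c * (b - a).
Proof.
move=> ab; rewrite Rintegral_cst //= lebesgue_measure_itv /= lte_fin.
by case: ltgtP ab => //= -> _; rewrite subrr.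
Qed.

Lemma itg1 a f : itg a a f = 0.
Proof. by rewrite set_itv1 Rintegral_set1. Qed.

Lemma intbZ a b c f : intb a b f -> intb a b (fun x => c * f x).
Proof. by move=> fi; have := integrableZl (mitv a b) c fi. Qed.

Lemma intbD a b f g : intb a b f -> intb a b g -> intb a b (fun x => f x + g x).
Proof. by move=> fi gi; have := integrableD (mitv a b) fi gi. Qed.

Definition L2 a b h := measurable_fun `[a, b] h /\ intb a b (fun x => h x ^+ 2).

Lemma L2_sub a b c d h : a <= c -> d <= b -> L2 a b h -> L2 c d h.
Proof.
move=> ac db [mh hi]; split; last exact: intb_sub hi.
apply: measurable_funS mh => //; apply: subset_itv; rewrite bnd_simp //.
Qed.

Lemma L2_intM a b h k : L2 a b h -> L2 a b k -> intb a b (fun x => h x * k x).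
Proof.
move=> [mh hi] [mk ki].
apply: (@le_integrable _ _ _ mu _ _ _
  (EFin \o (fun x => h x ^+ 2 + k x ^+ 2))) => //.
- by apply/measurable_EFinP; exact: measurable_funM.
- move=> x _; rewrite /= lee_fin [leRHS]ger0_norm ?addr_ge0 ?sqr_ge0 //.
  rewrite ler_norml; have := sqr_ge0 (h x + k x); have := sqr_ge0 (h x - k x).
  have := sqr_ge0 (h x); have := sqr_ge0 (k x); nra.
- exact: intbD.
Qed.

Lemma bounded_L2 a b h M : measurable_fun `[a, b] h ->
  (forall x, a <= x <= b -> `|h x| <= M) -> L2 a b h.
Proof.
move=> mh hM; split => //; apply: measurable_bounded_integrable => //.
- by rewrite /= lebesgue_measure_itv /=; case: ifP => // _; rewrite -EFinB ltry.
- exact: measurable_funX.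
- exists (M ^+ 2); split; first exact: num_real.
  move=> y My x; rewrite /= in_itv /= => xab; rewrite (le_trans _ (ltW My)) //.
  by rewrite normrX lerXn2r ?nnegrE ?hM // (le_trans (normr_ge0 _) (hM _ xab)).
Qed.

Lemma cst_L2 a b c : L2 a b (fun=> c).
Proof. by apply: (@bounded_L2 _ _ _ `|c|). Qed.
Hint Resolve cst_L2 : core.

Lemma L2_int a b h : L2 a b h -> intb a b h.
Proof.
move=> hL; have := L2_intM hL (cst_L2 a b 1).
by apply: eq_integrable => // x _ /=; rewrite mulr1.
Qed.

Lemma L2D a b h k : L2 a b h -> L2 a b k -> L2 a b (fun x => h x + k x).
Proof.
move=> hL kL; have [mh hi] := hL; have [mk ki] := kL.
split; first exact: measurable_funD.
have hki := L2_intM hL kL.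
have := intbD (intbD hi ki) (intbD hki hki).
apply: eq_integrable => // x _ /=.
by congr (_%:E); lra.
Qed.

Lemma L2_mulb a b h k M : L2 a b h -> measurable_fun `[a, b] k ->
  (forall x, a <= x <= b -> `|k x| <= M) -> L2 a b (fun x => h x * k x).
Proof.
move=> [mh hi] mk kM; split; first exact: measurable_funM.
apply: (@le_integrable _ _ _ mu _ _ _ (EFin \o (fun x => M ^+ 2 * h x ^+ 2))) => //.
- by apply/measurable_EFinP; apply: measurable_funX; exact: measurable_funM.
- move=> x; rewrite /= in_itv /= => /kM xM; rewrite lee_fin ger0_norm ?sqr_ge0 //.
  rewrite ger0_norm; last by apply: mulr_ge0; exact: sqr_ge0.
  rewrite exprMn mulrC; apply: ler_wpM2r; first exact: sqr_ge0.
  by move: xM; rewrite ler_norml => /andP[]; nra.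
-  exact: intbZ.
Qed.

Lemma L2Z a b c h : L2 a b h -> L2 a b (fun x => c * h x).
Proof.
move=> hL; rewrite (_ : (fun x => c * h x) = (fun x => h x * c)).
  by apply: (@L2_mulb _ _ _ (fun=> c) `|c|).
by apply/funext => x; rewrite mulrC.
Qed.

Lemma itgD a b f g : intb a b f -> intb a b g ->
  itg a b (fun x => f x + g x) = itg a b f + itg a b g.
Proof. by move=> fi gi; rewrite RintegralD. Qed.

Lemma itgZ a b c f : intb a b f -> itg a b (fun x => c * f x) = c * itg a b f.
Proof. by move=> fi; rewrite RintegralZl. Qed.

Lemma eq_itg a b f g : (forall x, a <= x <= b -> f x = g x) -> itg a b f = itg a b g.
Proof.
by move=> fg; apply: eq_Rintegral => x; rewrite inE /= in_itv /=; exact: fg.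
Qed.

Lemma itg_ge0 a b f : (forall x, a <= x <= b -> 0 <= f x) -> 0 <= itg a b f.
Proof. by move=> f0; apply: Rintegral_ge0 => x /=; rewrite in_itv; exact: f0. Qed.

Lemma le_itg a b f g : intb a b f -> intb a b g ->
  (forall x, a <= x <= b -> f x <= g x) -> itg a b f <= itg a b g.
Proof.
by move=> fi gi fg; apply: le_Rintegral => // x /=; rewrite in_itv; exact: fg.
Qed.

Lemma itg_sqrD a b f g c : L2 a b f -> L2 a b g ->
  itg a b (fun x => (f x + c * g x) ^+ 2) =
  itg a b (fun x => f x ^+ 2) + c * (2 * itg a b (fun x => f x * g x)) +
  c ^+ 2 * itg a b (fun x => g x ^+ 2).
Proof.
move=> fL gL; have [_ fi] := fL; have [_ gi] := gL; have fgi := L2_intM fL gL.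
rewrite -!itgZ -?itgD; first by apply: eq_itg => x _; lra.
all: by repeat first [exact: fi | exact: gi | exact: fgi | apply: intbD | apply: intbZ].
Qed.

(** Cauchy-Schwarz against constants: the integral of [(h - c)^2] is
    nonnegative for [c] the mean value of [h]. *)
Lemma itg_sqr_le a b h : a <= b -> L2 a b h ->
  itg a b h ^+ 2 <= (b - a) * itg a b (fun x => h x ^+ 2).
Proof.
rewrite le_eqVlt => /predU1P[<- _|ab hL]; first by rewrite !itg1 mulr0 expr0n.
have := itg_sqrD (- (itg a b h / (b - a))) hL (cst_L2 a b 1).
have -> : itg a b (fun x => h x * 1) = itg a b h.
  by apply: eq_itg => x _; rewrite mulr1.
have -> : itg a b (fun=> 1 ^+ 2) = b - a.
  by rewrite expr1n itg_cst ?mul1r // ltW.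
move=> E; have : 0 <= itg a b (fun x => (h x + - (itg a b h / (b - a)) * 1) ^+ 2).
  by apply: itg_ge0 => x _; exact: sqr_ge0.
rewrite {}E; set H := itg a b h; set d := b - a.
have d0 : 0 < d by rewrite subr_gt0.
rewrite -(ler_pM2l d0) mulr0; have dV : d * d^-1 = 1 by rewrite divff // gt_eqF.
set i := d^-1 in dV *; set Q := itg a b (fun x => h x ^+ 2) => le0.
have : d * (Q + - (H * i) * (2 * H) + (- (H * i)) ^+ 2 * d) =
       d * Q - H ^+ 2.
  transitivity (d * Q - 2 * H ^+ 2 * (d * i) + H ^+ 2 * (d * i) ^+ 2); first lra.
  by rewrite dV; lra.
by move=> E; rewrite E subr_ge0 in le0.
Qed.

End IntervalCalculus.

(** * Functions of class H1 *)
Section H1Functions.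
Variable R : realType.
Notation mu := (@lebesgue_measure R).
Notation itg a b f := (\int[mu]_(u in `[a, b]) f u).
Notation intb a b f := (mu.-integrable `[a, b] (EFin \o f)).
Implicit Types (a b c l s t : R) (f g h k : R -> R).

Lemma L2_eq_oc a b h k : a <= b -> (forall x, a < x <= b -> h x = k x) ->
  L2 a b h -> L2 a b k.
Proof.
move=> ab hk [mh hi].
have E x : x \in (`]a, b]%classic : set R) -> h x = k x.
  by rewrite inE /= in_itv /= => /hk.
have mk : measurable_fun `[a, b] k.
  apply/measurable_fun_itv_obnd_cbndP; apply: (@eq_measurable_fun _ _ _ _ _ h) => //.
  exact/measurable_fun_itv_obnd_cbndP.
split => //; apply/integrableP; split.
  by apply/measurable_EFinP; exact: measurable_funX.
have m1 (q : R -> R) : measurable_fun `[a, b] q ->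
    measurable_fun `]a, b] (fun x => abse (q x ^+ 2)%:E).
  move=> mq; apply: measurableT_comp => //; apply/measurable_EFinP.
  by apply: measurable_funX; apply/measurable_fun_itv_obnd_cbndP.
move/integrableP : hi => [_]; rewrite -integral_itv_obnd_cbnd; last exact: m1.
rewrite -integral_itv_obnd_cbnd; last exact: m1.
by congr (_ < _)%E; apply: eq_integral => x /E /= ->.
Qed.

Lemma itg_eq_oc a b h k : a <= b -> (forall x, a < x <= b -> h x = k x) ->
  intb a b h -> intb a b k -> itg a b h = itg a b k.
Proof.
move=> ab hk hi ki; rewrite -!Rintegral_itv_obnd_cbnd.
- by apply: eq_Rintegral => x; rewrite inE /= in_itv /= => /hk.
- by apply: integrableS ki => //; apply: subset_itvr; rewrite bnd_simp.
- by apply: integrableS hi => //; apply: subset_itvr; rewrite bnd_simp.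
Qed.

Lemma L2_glue a c b h : a <= c -> c <= b -> L2 a c h -> L2 c b h -> L2 a b h.
Proof.
move=> ac cb hL kL.
have U : `[a, b]%classic = `[a, c]%classic `|` `[c, b]%classic :> set R.
  apply/seteqP; split=> x /=; rewrite !in_itv /=.
    by move=> /andP[ax xb]; case: (leP x c) => [|/ltW]; [left|right]; apply/andP.
  by case=> /andP[ax xb]; apply/andP; split => //;
    [exact: le_trans xb cb|exact: le_trans ac ax].
have mh : measurable_fun `[a, b] h.
  by rewrite U; apply/measurable_funU => //; split; [exact: hL.1|exact: kL.1].
split => //; apply/integrableP; split.
  by apply/measurable_EFinP; exact: measurable_funX.
have mh2 : measurable_fun `[a, b] (fun x => abse (h x ^+ 2)%:E).
  by apply: measurableT_comp => //; apply/measurable_EFinP; exact: measurable_funX.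
have V : `[a, b]%classic = `[a, c]%classic `|` `]c, b]%classic :> set R.
  apply/seteqP; split=> x /=; rewrite !in_itv /=.
    by move=> /andP[ax xb]; case: (leP x c) => [|]; [left|right]; apply/andP.
  by case=> /andP[ax xb]; apply/andP; split => //;
    [exact: le_trans xb cb|exact: le_trans ac (ltW ax)].
rewrite V ge0_integral_setU //=; last 2 first.
- by rewrite -V.
- apply/disj_setPS => y [/=]; rewrite 2!in_itv/= => /andP[_ yx] /andP[].
  by rewrite ltNge yx.
have /integrableP[_ h1] := hL.2; have /integrableP[_ h2] := kL.2.
apply: lte_add_pinfty; first exact: h1.
apply: (le_lt_trans _ h2).
apply: ge0_subset_integral => //; last by apply: subset_itvr; rewrite bnd_simp.
by apply: measurable_funS mh2 => //; apply: subset_itv; rewrite bnd_simp.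
Qed.

Lemma L2_affine al be a b c d h : al != 0 ->
  (forall x, a <= x <= b -> c <= al * x + be <= d) ->
  intb a b (fun x => h (al * x + be) ^+ 2) ->
  L2 c d h -> L2 a b (fun x => h (al * x + be)).
Proof.
move=> al0 abcd hi [mh _]; split => //.
apply: (@measurable_comp _ _ _ _ _ _ `[c, d]%classic h _ (fun x => al * x + be)) => //.
  by move=> y [x] /=; rewrite !in_itv /= => /abcd + <-.
by apply: measurable_funTS; exact: measurable_affine.
Qed.

Lemma L2_affine_pos al be a b h : 0 < al ->
  L2 (al * a + be) (al * b + be) h -> L2 a b (fun x => h (al * x + be)).
Proof.
move=> al0 hL; apply: (L2_affine _ _ _ hL); rewrite ?gt_eqF //.
  by move=> x; rewrite !lerD2r !ler_pM2l.
exact: (itg_affine_pos al0 hL.2).1.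
Qed.

Lemma L2_affine_neg al be a b h : al < 0 ->
  L2 (al * b + be) (al * a + be) h -> L2 a b (fun x => h (al * x + be)).
Proof.
move=> al0 hL; apply: (L2_affine _ _ _ hL); rewrite ?lt_eqF //.
  by move=> x; rewrite !lerD2r !ler_nM2l // andbC.
exact: (itg_affine_neg al0 hL.2).1.
Qed.

Lemma H1_L2 l f g : H1_deriv l f g -> L2 0 l g.
Proof. by case. Qed.

Lemma H1_incr l f g s t : H1_deriv l f g -> 0 <= s -> s <= t -> t <= l ->
  f t - f s = itg s t g.
Proof.
move=> fg s0 st tl; have gL := H1_L2 fg; have [_ _ fE] := fg.
rewrite (fE t) ?(fE s) ?s0 ?(le_trans s0 st) ?(le_trans st tl) ?tl //.
rewrite (@itg_chasles _ 0 s t g) //; first lra.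
by apply: L2_int; apply: (L2_sub _ _ gL).
Qed.

Lemma H1_incr_sqr l f g s t : H1_deriv l f g -> 0 <= s -> s <= t -> t <= l ->
  (f t - f s) ^+ 2 <= (t - s) * itg 0 l (fun x => g x ^+ 2).
Proof.
move=> fg s0 st tl; have gL := H1_L2 fg.
rewrite (H1_incr fg) //; apply: le_trans (itg_sqr_le _ _) _ => //.
  exact: L2_sub gL.
apply: ler_wpM2l; first by rewrite subr_ge0.
have sl := le_trans st tl.
rewrite (@itg_chasles _ 0 s l) ?gL.2 //.
rewrite (@itg_chasles _ s t l) //; last exact: (intb_sub _ _ gL.2).
have := @itg_ge0 _ 0 s (fun x => g x ^+ 2) (fun _ _ => sqr_ge0 _).
have := @itg_ge0 _ t l (fun x => g x ^+ 2) (fun _ _ => sqr_ge0 _).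
lra.
Qed.

Lemma H1_measurable l f g : 0 <= l -> H1_deriv l f g -> measurable_fun `[0, l] f.
Proof.
move=> l0 fg; have gL := H1_L2 fg; have [_ _ fE] := fg.
apply: (@eq_measurable_fun _ _ _ _ _ (fun s => f 0 + itg 0 s g)).
  by move=> s; rewrite inE /= in_itv /= => /fE ->.
apply: measurable_funD => //; apply: subspace_continuous_measurable_fun => //.
exact: (parameterized_integral_continuous l0 (L2_int gL)).
Qed.

Lemma H1_bounded l f g : H1_deriv l f g ->
  exists M, forall s, 0 <= s <= l -> `|f s| <= M.
Proof.
move=> fg; set E := itg 0 l (fun x => g x ^+ 2).
exists (`|f 0| + (1 + l * E)) => s /andP[s0 sl].
have := H1_incr_sqr fg (lexx _) s0 sl; rewrite -/E subr0 => h.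
have E0 : 0 <= E by apply: itg_ge0 => x _; exact: sqr_ge0.
have hl : (f s - f 0) ^+ 2 <= l * E by apply: le_trans h _; exact: ler_wpM2r.
rewrite -[f s](subrK (f 0)) addrC; apply: le_trans (ler_normD _ _) _.
rewrite lerD2l ler_norml; have := sqr_ge0 (f s - f 0 - 1).
have := sqr_ge0 (f s - f 0 + 1); nra.
Qed.

Lemma H1_L2f l f g : 0 <= l -> H1_deriv l f g -> L2 0 l f.
Proof.
move=> l0 fg; have [M fM] := H1_bounded fg.
exact: bounded_L2 (H1_measurable l0 fg) fM.
Qed.

Lemma H1_lin l f1 g1 f2 g2 c : H1_deriv l f1 g1 -> H1_deriv l f2 g2 ->
  H1_deriv l (fun s => f1 s + c * f2 s) (fun s => g1 s + c * g2 s).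
Proof.
move=> fg1 fg2; have g1L := H1_L2 fg1; have g2L := H1_L2 fg2.
have [m hi] := L2D g1L (L2Z c g2L); split => // s /andP[s0 sl].
have g1i := L2_int (L2_sub (lexx _) sl g1L).
have g2i := L2_int (L2_sub (lexx _) sl g2L).
rewrite itgD ?itgZ //; last exact: intbZ.
have -> : itg 0 s g1 = f1 s - f1 0 by rewrite (H1_incr fg1).
have -> : itg 0 s g2 = f2 s - f2 0 by rewrite (H1_incr fg2).
lra.
Qed.

Lemma H1_cst l c : H1_deriv l (fun=> c) (fun=> 0).
Proof.
have [m hi] := @cst_L2 R 0 l 0; split => // s /andP[s0 _].
by rewrite itg_cst // mul0r addr0.
Qed.

Lemma H1_affine_pos al be l l' f g : 0 < al -> 0 <= be -> al * l' + be <= l ->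
  H1_deriv l f g ->
  H1_deriv l' (fun s => f (al * s + be)) (fun s => al * g (al * s + be)).
Proof.
move=> al0 be0 bl fg; have gL := H1_L2 fg.
have gL' : L2 (al * 0 + be) (al * l' + be) g.
  by apply: L2_sub gL => //; rewrite mulr0 add0r.
have [m hi] := L2Z al (L2_affine_pos al0 gL').
split => // s /andP[s0 sl].
have sub : intb (al * 0 + be) (al * s + be) g.
  by apply: intb_sub (L2_int gL') => //; rewrite lerD2r ler_pM2l.
have [ia Ea] := itg_affine_pos al0 sub.
rewrite itgZ // -Ea -(H1_incr fg); first by rewrite subrKC.
- by rewrite mulr0 add0r.
- by rewrite lerD2r ler_pM2l.
- by apply: (le_trans _ bl); rewrite lerD2r ler_pM2l.
Qed.

Lemma H1_rev l f g : H1_deriv l f g ->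
  H1_deriv l (fun s => f (-1 * s + l)) (fun s => -1 * g (-1 * s + l)).
Proof.
move=> fg; have gL := H1_L2 fg; have N1 : (-1 : R) < 0 by lra.
have gL' : L2 (-1 * l + l) (-1 * 0 + l) g.
  by apply: (L2_sub _ _ gL); [lra|lra].
have [m hi] := L2Z (-1) (L2_affine_neg N1 gL').
split => // s /andP[s0 sl].
have sub : intb (-1 * s + l) (-1 * 0 + l) g.
  by apply: intb_sub (L2_int gL') => //; lra.
have [ia Ea] := itg_affine_neg N1 sub.
rewrite itgZ //; move: Ea; rewrite opprK mul1r => <-.
rewrite -(H1_incr fg); lra.
Qed.

Lemma H1_cat t l f1 g1 f2 g2 : 0 <= t -> 0 <= l ->
  H1_deriv t f1 g1 -> H1_deriv l f2 g2 -> f1 t = f2 0 ->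
  H1_deriv (t + l) (fun s => if s <= t then f1 s else f2 (s - t))
    (fun s => if s <= t then g1 s else g2 (s - t)).
Proof.
move=> t0 l0 fg1 fg2 f12; set g := (X in H1_deriv _ _ X).
have shift h : L2 0 l h -> L2 t (t + l) (fun s => h (s - t)).
  move=> hL; have := @L2_affine_pos 1 (- t) t (t + l) h ltr01.
  have -> : 1 * t + - t = 0 by lra.
  have -> : 1 * (t + l) + - t = l by lra.
  by move=> /(_ hL); under eq_fun do rewrite mul1r.
have g1L := H1_L2 fg1; have g2L := H1_L2 fg2.
have ga : L2 0 t g.
  by apply: L2_eq_oc g1L => // x /andP[_ xt]; rewrite /g xt.
have gb : L2 t (t + l) g.
  apply: L2_eq_oc (shift _ g2L); first by rewrite lerDl.
  by move=> x /andP[xt _]; rewrite /g leNgt xt.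
have gL : L2 0 (t + l) g by apply: L2_glue ga gb => //; rewrite lerDl.
have [m hi] := gL; split => // s /andP[s0 sl]; rewrite t0.
have [st|ts] := leP s t.
  rewrite (_ : itg 0 s g = itg 0 s g1); last first.
    by apply: eq_itg => x /andP[_ xs]; rewrite /g (le_trans xs st).
  by rewrite -(H1_incr fg1) // subrKC.
rewrite (@itg_chasles _ 0 t s) ?(ltW ts) //; last first.
  by apply: L2_int; apply: (L2_sub _ _ gL).
rewrite (_ : itg 0 t g = itg 0 t g1); last first.
  by apply: eq_itg => x /andP[_ xs]; rewrite /g xs.
rewrite -(H1_incr fg1) //.
have sub : intb (1 * t + - t) (1 * s + - t) g2.
  apply: L2_int; apply: L2_sub g2L; lra.
have [ia Ea] := itg_affine_pos ltr01 sub.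
have -> : itg t s g = itg t s (fun x => g2 (1 * x + - t)).
  apply: itg_eq_oc => //; first exact: ltW.
  - by move=> x /andP[tx _]; rewrite /g leNgt tx mul1r.
  - by apply: L2_int; apply: L2_sub gb.
rewrite [RHS]mul1r in Ea; rewrite -Ea.
rewrite -(H1_incr fg2); try lra.
rewrite (_ : 1 * t - t = 0); last lra.
by rewrite -f12 mul1r; lra.
Qed.

End H1Functions.

(** * Integration by parts *)
Section IntegrationByParts.
Variable R : realType.
Notation mu := (@lebesgue_measure R).
Notation itg a b f := (\int[mu]_(u in `[a, b]) f u).
Notation intb a b f := (mu.-integrable `[a, b] (EFin \o f)).
Implicit Types (a b c l s t K M : R) (f g h k F W : R -> R).

(** In [N] equal steps [F] changes by at most [N * sqrt (K * (l / N) ^ 3)], which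
    tends to zero. *)
Lemma const_of_flat l K F : 0 <= l ->
  (forall s t, 0 <= s -> s <= t -> t <= l -> (F t - F s) ^+ 2 <= K * (t - s) ^+ 3) ->
  F l = F 0.
Proof.
move=> l0 flat; apply/eqP; rewrite -subr_eq0; apply/negP => /negP D0.
have /= := archi_boundP (_ : 0 <= K * l ^+ 3 / (F l - F 0) ^+ 2).
rewrite divr_ge0 ?sqr_ge0 //; last first.
  by have := flat _ _ (lexx _) l0 (lexx l); rewrite subr0; apply: le_trans; exact: sqr_ge0.
move=> /(_ isT); set N := Num.bound _ => KN.
have N0 : 0 < N%:R :> R.
  apply: le_lt_trans KN; apply: divr_ge0; last exact: sqr_ge0.
  by have := flat _ _ (lexx _) l0 (lexx l); rewrite subr0; apply: le_trans; exact: sqr_ge0.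
pose h := l / N%:R; have h0 : 0 <= h by rewrite divr_ge0 // ltW.
have hN : h * N%:R = l by rewrite divfK // gt_eqF.
have step i : (i < N)%N -> `|F (i.+1%:R * h) - F (i%:R * h)| <= Num.sqrt (K * h ^+ 3).
  move=> iN; rewrite -sqrtr_sqr ler_wsqrtr //.
  have dE : i.+1%:R * h - i%:R * h = h by rewrite -mulrBl -natrB // subSnn mul1r.
  have := flat (i%:R * h) (i.+1%:R * h); rewrite dE; apply.
  - by rewrite mulr_ge0.
  - by rewrite ler_wpM2r // ler_nat.
  - by rewrite -hN mulrC ler_wpM2l // ler_nat.
have sum i : (i <= N)%N -> `|F (i%:R * h) - F 0| <= i%:R * Num.sqrt (K * h ^+ 3).
  elim: i => [_|i IH iN]; first by rewrite mul0r subrr normr0 mul0r.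
  have := step _ iN; have := IH (ltnW iN).
  have := ler_normD (F (i.+1%:R * h) - F (i%:R * h)) (F (i%:R * h) - F 0).
  have -> : i.+1%:R * Num.sqrt (K * h ^+ 3) =
    i%:R * Num.sqrt (K * h ^+ 3) + Num.sqrt (K * h ^+ 3) by rewrite -natr1 mulrDl mul1r.
  by rewrite addrA subrK; lra.
have := sum N (leqnn _); rewrite mulrC hN => le.
have le2 : (F l - F 0) ^+ 2 <= N%:R ^+ 2 * (K * h ^+ 3).
  have K0 : 0 <= K * h ^+ 3.
    have hl : h <= l.
      rewrite -hN ler_peMr // -[1]/(1%:R) ler_nat.
      by rewrite -(ltr_nat R).
    have := flat _ _ (lexx _) h0 hl; rewrite subr0; apply: le_trans; exact: sqr_ge0.
  rewrite -[X in _ * X]sqr_sqrtr // -exprMn -real_normK ?num_real //.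
  by rewrite lerXn2r // nnegrE ?mulr_ge0 ?sqrtr_ge0 ?ler0n.
have D2 : 0 < (F l - F 0) ^+ 2 by rewrite exprn_even_gt0.
move: KN; rewrite ltr_pdivrMr // mulrC; apply/negP; rewrite -leNgt.
rewrite -(ler_pM2l N0) in le2; apply: le_trans le2 _.
have -> : l ^+ 3 * K = K * (h * N%:R) ^+ 3 by rewrite hN mulrC.
by move: (N%:R) (h) => n d; lra.
Qed.

Lemma lipschitz_of_deriv l W W' M s t : H1_deriv l W W' ->
  (forall x, 0 <= x <= l -> `|W' x| <= M) -> 0 <= s -> s <= t -> t <= l ->
  (W t - W s) ^+ 2 <= M ^+ 2 * (t - s) ^+ 2.
Proof.
move=> WW W'M s0 st tl; rewrite (H1_incr WW) //.
have W'L : L2 s t W' by apply: (L2_sub _ _ (H1_L2 WW)).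
apply: le_trans (itg_sqr_le st W'L) _.
rewrite [leRHS](_ : _ = (t - s) * (M ^+ 2 * (t - s))); last lra.
rewrite ler_wpM2l ?subr_ge0 // -itg_cst //; apply: le_itg; first exact: W'L.2.
  exact: L2_int (cst_L2 _ _ _).
move=> x /andP[sx xt]; have : `|W' x| <= M.
  by apply: W'M; rewrite (le_trans s0 sx) (le_trans xt tl).
by rewrite ler_norml => /andP[]; nra.
Qed.

(** Both sides, as functions of the right end point, have the same increments
    up to an error of order [3/2] in the length of the interval: hence their
    difference is constant. *)
Lemma H1_by_parts l f g W W' M : 0 <= l -> H1_deriv l f g -> H1_deriv l W W' ->
  (forall x, 0 <= x <= l -> `|W' x| <= M) ->
  f l * W l - f 0 * W 0 =
  itg 0 l (fun x => g x * W x) + itg 0 l (fun x => f x * W' x).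
Proof.
move=> l0 fg WW W'M; have gL := H1_L2 fg; have W'L := H1_L2 WW.
have fL := H1_L2f l0 fg; have WL := H1_L2f l0 WW.
have mf := H1_measurable l0 fg; have mW := H1_measurable l0 WW.
have [Mf fM] := H1_bounded fg; have [MW WM] := H1_bounded WW.
set E := itg 0 l (fun x => g x ^+ 2).
have E0 : 0 <= E by apply: itg_ge0 => x _; exact: sqr_ge0.
have gWi := L2_intM gL WL; have fWi := L2_intM fL W'L.
pose F s := f s * W s - (itg 0 s (fun x => g x * W x) + itg 0 s (fun x => f x * W' x)).
suff : F l = F 0 by rewrite /F !itg1; lra.
apply: (@const_of_flat _ (4 * M ^+ 2 * E)) => // s t s0 st tl.
have sl := le_trans st tl; have t0 := le_trans s0 st.
have sub u : intb 0 l u -> intb 0 t u by exact: intb_sub.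
have sub2 u : L2 0 l u -> L2 s t u by exact: L2_sub.
(* the increment of [F] is [A + B], and each of the two squares is at most
   [M ^ 2 * E * (t - s) ^ 3] *)
pose A := itg s t (fun x => g x * (W t - W x)).
pose B := itg s t (fun x => W' x * (f s - f x)).
have ms k : measurable_fun `[0, l] k -> measurable_fun `[s, t] k.
  move=> mk; apply: measurable_funS mk => //.
  by apply: subset_itv; rewrite bnd_simp.
have AL : L2 s t (fun x => g x * (W t - W x)).
  apply: (@L2_mulb _ _ _ _ _ (MW + MW) (sub2 _ gL)).
    by apply: measurable_funB => //; exact: ms.
  move=> x /andP[sx xt]; apply: le_trans (ler_normB _ _) _.
  by apply: lerD; apply: WM; rewrite ?t0 // (le_trans s0 sx) (le_trans xt tl).
have BL : L2 s t (fun x => W' x * (f s - f x)).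
  apply: (@L2_mulb _ _ _ _ _ (Mf + Mf) (sub2 _ W'L)).
    by apply: measurable_funB => //; exact: ms.
  move=> x /andP[sx xt]; apply: le_trans (ler_normB _ _) _.
  by apply: lerD; apply: fM; rewrite ?s0 // (le_trans s0 sx) (le_trans xt tl).
have FE : F t - F s = A + B.
  rewrite /F (@itg_chasles _ 0 s t (fun x => g x * W x)) //; last exact: sub.
  rewrite (@itg_chasles _ 0 s t (fun x => f x * W' x)) //; last exact: sub.
  have -> : A = (f t - f s) * W t - itg s t (fun x => g x * W x).
    rewrite (H1_incr fg) // mulrC -itgZ; last exact: L2_int (sub2 _ gL).
    rewrite -[X in _ - X]mul1r -mulNr -itgZ; last by apply: intb_sub gWi.
    rewrite -itgD.
    - by apply: eq_itg => x _; lra.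
    - by apply: intbZ; exact: L2_int (sub2 _ gL).
    - by apply: intbZ; exact: intb_sub gWi.
  have -> : B = f s * (W t - W s) - itg s t (fun x => f x * W' x).
    rewrite (H1_incr WW) // -itgZ; last exact: L2_int (sub2 _ W'L).
    rewrite -[X in _ - X]mul1r -mulNr -itgZ; last by apply: intb_sub fWi.
    rewrite -itgD.
    - by apply: eq_itg => x _; lra.
    - by apply: intbZ; exact: L2_int (sub2 _ W'L).
    - by apply: intbZ; exact: intb_sub fWi.
  lra.
have ts0 : 0 <= t - s by rewrite subr_ge0.
have A2 : A ^+ 2 <= M ^+ 2 * E * (t - s) ^+ 3.
  apply: le_trans (itg_sqr_le st AL) _.
  rewrite [leRHS](_ : _ = (t - s) * (M ^+ 2 * (t - s) ^+ 2 * E)); last lra.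
  apply: ler_wpM2l => //.
  have le1 : itg s t (fun x => g x ^+ 2) <= E.
    rewrite /E (@itg_chasles _ 0 s l) ?gL.2 //.
    rewrite (@itg_chasles _ s t l) //; last exact: (intb_sub _ _ gL.2).
    have := @itg_ge0 _ 0 s (fun x => g x ^+ 2) (fun _ _ => sqr_ge0 _).
    have := @itg_ge0 _ t l (fun x => g x ^+ 2) (fun _ _ => sqr_ge0 _).
    lra.
  have c0 : 0 <= M ^+ 2 * (t - s) ^+ 2 by rewrite mulr_ge0 ?sqr_ge0.
  apply: le_trans (ler_wpM2l c0 le1).
  rewrite -itgZ; last exact: (sub2 _ gL).2.
  apply: le_itg; first exact: AL.2.
    by apply: intbZ; exact: (sub2 _ gL).2.
  move=> x /andP[sx xt]; rewrite exprMn mulrC ler_wpM2r ?sqr_ge0 //.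
  apply: le_trans (lipschitz_of_deriv WW W'M _ xt tl) _; first exact: le_trans sx.
  rewrite ler_wpM2l ?sqr_ge0 // lerXn2r ?nnegrE ?subr_ge0 //.
  by rewrite lerD2l lerN2.
have B2 : B ^+ 2 <= M ^+ 2 * E * (t - s) ^+ 3.
  apply: le_trans (itg_sqr_le st BL) _.
  rewrite [leRHS](_ : _ = (t - s) * (M ^+ 2 * E * (t - s) * (t - s))); last lra.
  apply: ler_wpM2l => //; rewrite -itg_cst //.
  apply: le_itg; first exact: BL.2.
    exact: L2_int (cst_L2 _ _ _).
  move=> x /andP[sx xt]; have xl := le_trans xt tl; have x0 := le_trans s0 sx.
  have := H1_incr_sqr fg s0 sx xl; rewrite -/E => le1.
  have : `|W' x| <= M by apply: W'M; rewrite x0.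
  rewrite ler_norml => /andP[le2 le3].
  have le4 : W' x ^+ 2 <= M ^+ 2 by nra.
  rewrite exprMn [leRHS](_ : _ = M ^+ 2 * (E * (t - s))); last lra.
  apply: ler_pM; [exact: sqr_ge0|exact: sqr_ge0|exact: le4|].
  have -> : (f s - f x) ^+ 2 = (f x - f s) ^+ 2 by lra.
  apply: (le_trans le1); rewrite mulrC; apply: ler_wpM2l => //; lra.
rewrite FE; have := sqr_ge0 (A - B); lra.
Qed.

Lemma C1_H1 l F F' : (forall x : R, is_derive x 1 F (F' x)) -> continuous F' ->
  H1_deriv l F F'.
Proof.
move=> dF cF'.
have ci s : intb 0 s (fun x => F' x ^+ 2).
  apply: continuous_compact_integrable; first exact: segment_compact.
  apply: continuous_subspaceT => x; rewrite /=.
  under eq_fun do rewrite expr2.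
  by apply: continuousM; exact: cF'.
have mF' : measurable_fun setT F' by exact: continuous_measurable_fun.
split => //; first exact: measurable_funTS.
move=> s /andP[]; rewrite le_eqVlt => /predU1P[<- _|s0 sl].
  by rewrite itg1 addr0.
rewrite /Rintegral (@continuous_FTC2 _ F' F) //=; first by rewrite subrKC.
- exact: continuous_subspaceT.
- split => //.
  + apply: cvg_at_right_filter; apply: differentiable_continuous.
    by apply/derivable1_diffP.
  + apply: cvg_at_left_filter; apply: differentiable_continuous.
    by apply/derivable1_diffP.
- by move=> x _; rewrite derive1E; apply: derive_val.
Qed.

End IntegrationByParts.

(** * Profiles of functions on an edge *)
Section Profiles.
Variable R : realType.
Notation mu := (@lebesgue_measure R).
Notation itg a b f := (\int[mu]_(u in `[a, b]) f u).
Notation intb a b f := (mu.-integrable `[a, b] (EFin \o f)).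
Implicit Types (a b c l s t K M E : R) (f g h k F W : R -> R).

(** The boundary values, the energy, the mean and the square norm are all that
    matters about the restriction of an [H^1] function to an edge.  At length zero
    they are related as they should be ([profile0]), so that vanishing edges need
    no separate treatment. *)
Definition profile l a b E m1 m2 : Prop := exists f g,
  [/\ H1_deriv l f g, f 0 = a /\ f l = b, E = itg 0 l (fun s => g s ^+ 2),
      m1 = itg 0 l f & m2 = itg 0 l (fun s => f s ^+ 2)].

(** Cauchy-Schwarz for the derivative, and for the function itself. *)
Lemma profile_bounds l a b E m1 m2 : 0 <= l -> profile l a b E m1 m2 ->
  [/\ 0 <= E, 0 <= m2, (b - a) ^+ 2 <= l * E, m1 ^+ 2 <= l * m2 &
      m2 <= 2 * l * (a ^+ 2 + l * E)].
Proof.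
move=> l0 [f [g [fg [fa fb] -> -> ->]]]; set E' := itg 0 l (fun s => g s ^+ 2).
have fL := H1_L2f l0 fg.
have E0 : 0 <= E' by apply: itg_ge0 => x _; exact: sqr_ge0.
split => //.
- by apply: itg_ge0 => x _; exact: sqr_ge0.
- by have := H1_incr_sqr fg (lexx 0) l0 (lexx l); rewrite fa fb subr0.
- by have := itg_sqr_le l0 fL; rewrite subr0.
have -> : 2 * l * (a ^+ 2 + l * E') = (2 * (a ^+ 2 + l * E')) * (l - 0) by lra.
rewrite -itg_cst //; apply: le_itg; first exact: fL.2.
  exact: L2_int (cst_L2 _ _ _).
move=> x /andP[x0 xl]; have := H1_incr_sqr fg (lexx 0) x0 xl.
rewrite -/E' subr0 fa => le1; have le2 : x * E' <= l * E' by exact: ler_wpM2r.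
have := sqr_ge0 (f x - a - a); lra.
Qed.

Lemma profile0 a b E m1 m2 :
  profile 0 a b E m1 m2 <-> [/\ b = a, E = 0, m1 = 0 & m2 = 0].
Proof.
split.
  by move=> [f [g [fg [<- <-] -> -> ->]]]; rewrite !itg1.
move=> [-> -> -> ->]; exists (fun=> a), (fun=> 0).
by split; rewrite ?itg1 //; exact: H1_cst.
Qed.

Lemma profile_rev l a b E m1 m2 : 0 <= l ->
  profile l a b E m1 m2 -> profile l b a E m1 m2.
Proof.
move=> l0 [f [g [fg [fa fb] -> -> ->]]].
have N1 : (-1 : R) < 0 by lra.
have revE h : intb 0 l h -> itg 0 l (fun x => h (-1 * x + l)) = itg 0 l h.
  move=> hi; have := @itg_affine_neg _ (-1) l 0 l h N1.
  have -> : -1 * l + l = 0 by lra.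
  have -> : -1 * 0 + l = l by lra.
  by move=> /(_ hi)[_ ->]; rewrite opprK mul1r.
have fL := H1_L2f l0 fg; have gL := H1_L2 fg.
exists (fun s => f (-1 * s + l)), (fun s => -1 * g (-1 * s + l)); split.
- exact: H1_rev.
- rewrite mulr0 add0r fb; split => //.
  by rewrite (_ : -1 * l + l = 0) //; lra.
- rewrite -(revE (fun s => g s ^+ 2)); last exact: gL.2.
  by apply: eq_itg => x _; lra.
- by rewrite revE //; exact: L2_int.
- by rewrite (revE (fun s => f s ^+ 2)) //; exact: fL.2.
Qed.

(** Serves both to rescale an edge and to split it. *)
Lemma profile_window al be l' l f g : 0 < al -> 0 <= be -> 0 <= l' ->
  al * l' + be <= l -> H1_deriv l f g ->
  profile l' (f be) (f (al * l' + be))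
    (al * itg be (al * l' + be) (fun s => g s ^+ 2))
    (al^-1 * itg be (al * l' + be) f)
    (al^-1 * itg be (al * l' + be) (fun s => f s ^+ 2)).
Proof.
move=> al0 be0 l'0 le fg; have al'0 : 0 <= al * l' by rewrite mulr_ge0 // ltW.
have l0 : 0 <= l by apply: le_trans le; rewrite addr_ge0.
have fL := H1_L2f l0 fg; have gL := H1_L2 fg.
have winE h : intb 0 l h ->
    itg be (al * l' + be) h = al * itg 0 l' (fun x => h (al * x + be)).
  move=> hi; have := @itg_affine_pos _ al be 0 l' h al0.
  by rewrite mulr0 add0r => /(_ (intb_sub be0 le hi))[].
exists (fun s => f (al * s + be)), (fun s => al * g (al * s + be)); split.
- exact: (H1_affine_pos al0 be0 le fg).
- by rewrite mulr0 add0r.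
- rewrite (winE (fun s => g s ^+ 2)); last exact: gL.2.
  rewrite mulrA -expr2 -itgZ; first by apply: eq_itg => x _; lra.
  have := @itg_affine_pos _ al be 0 l' (fun s => g s ^+ 2) al0.
  by rewrite mulr0 add0r => /(_ (intb_sub be0 le gL.2))[].
- by rewrite winE ?mulKf ?gt_eqF //; exact: L2_int.
- by rewrite (winE (fun s => f s ^+ 2)) ?mulKf ?gt_eqF //; exact: fL.2.
Qed.

Lemma profile_scale u l a b E m1 m2 : 0 < u -> 0 < l ->
  profile u a b E m1 m2 ->
  profile l a b (u / l * E) (l / u * m1) (l / u * m2).
Proof.
move=> u0 l0 [f [g [fg [fa fb] -> -> ->]]].
have ul0 : 0 < u / l by rewrite divr_gt0.
have ulE : u / l * l + 0 = u by rewrite addr0 divfK ?gt_eqF.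
have := profile_window ul0 (lexx 0) (ltW l0) (eq_ind_r (fun x => x <= u) (lexx u) ulE) fg.
by rewrite ulE fa fb -[l / u]invf_div.
Qed.

Lemma profile_split l1 l2 a c E m1 m2 : 0 <= l1 -> 0 <= l2 ->
  profile (l1 + l2) a c E m1 m2 -> exists b E1 m11 m21 E2 m12 m22,
  [/\ profile l1 a b E1 m11 m21, profile l2 b c E2 m12 m22,
      E = E1 + E2, m1 = m11 + m12 & m2 = m21 + m22].
Proof.
move=> l10 l20 [f [g [fg [fa fb] -> -> ->]]].
have l0 : 0 <= l1 + l2 by rewrite addr_ge0.
have fL := H1_L2f l0 fg; have gL := H1_L2 fg.
have l1l : l1 <= l1 + l2 by rewrite lerDl.
have cha h : intb 0 (l1 + l2) h ->
    itg 0 (l1 + l2) h = itg 0 l1 h + itg l1 (l1 + l2) h.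
  by move=> hi; rewrite (@itg_chasles _ 0 l1).
have := @profile_window 1 0 l1 _ f g ltr01 (lexx _) l10 _ fg.
rewrite addr0 !mul1r invr1 !mul1r => /(_ l1l) p1.
have := @profile_window 1 l1 l2 _ f g ltr01 l10 l20 _ fg.
rewrite !mul1r invr1 !mul1r [l2 + l1]addrC => /(_ (lexx _)) p2.
rewrite fa in p1; rewrite fb in p2.
exists (f l1); do 6 eexists; split; [exact: p1|exact: p2| | |]; apply: cha.
- exact: gL.2.
- exact: L2_int.
- exact: fL.2.
Qed.

Lemma profile_cat l1 l2 a b c E1 m11 m21 E2 m12 m22 : 0 <= l1 -> 0 <= l2 ->
  profile l1 a b E1 m11 m21 -> profile l2 b c E2 m12 m22 ->
  profile (l1 + l2) a c (E1 + E2) (m11 + m12) (m21 + m22).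
Proof.
move=> l10 l20 [f1 [g1 [fg1 [fa1 fb1] -> -> ->]]] [f2 [g2 [fg2 [fa2 fb2] -> -> ->]]].
have l0 : 0 <= l1 + l2 by rewrite addr_ge0.
have l1l : l1 <= l1 + l2 by rewrite lerDl.
have fb : f1 l1 = f2 0 by rewrite fb1 fa2.
have := H1_cat l10 l20 fg1 fg2 fb.
set f := (X in H1_deriv _ X); set g := (X in H1_deriv _ _ X) => fg.
have fL := H1_L2f l0 fg; have gL := H1_L2 fg.
have f1L := H1_L2f l10 fg1; have g1L := H1_L2 fg1.
have f2L := H1_L2f l20 fg2; have g2L := H1_L2 fg2.
have cha h h1 h2 : intb 0 (l1 + l2) h -> intb 0 l2 h2 ->
   (forall x, x <= l1 -> h x = h1 x) -> (forall x, l1 < x -> h x = h2 (x - l1)) ->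
    itg 0 l1 h1 + itg 0 l2 h2 = itg 0 (l1 + l2) h.
  move=> hi h2i h1E h2E; rewrite (@itg_chasles _ 0 l1 (l1 + l2)) //; congr (_ + _).
    by apply: eq_itg => x /andP[_ /h1E ->].
  have := @itg_affine_pos _ 1 (- l1) l1 (l1 + l2) h2 ltr01.
  have -> : 1 * l1 - l1 = 0 by lra.
  have -> : 1 * (l1 + l2) - l1 = l2 by lra.
  move=> /(_ h2i)[h2i' ->]; rewrite mul1r; apply/esym/itg_eq_oc => //.
  - by move=> x /andP[/h2E -> _]; rewrite mul1r.
  - exact: intb_sub hi.
have fE x : x <= l1 -> f x = f1 x by move=> xl; rewrite /f xl.
have fE' x : l1 < x -> f x = f2 (x - l1) by move=> xl; rewrite /f leNgt xl.
have gE x : x <= l1 -> g x = g1 x by move=> xl; rewrite /g xl.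
have gE' x : l1 < x -> g x = g2 (x - l1) by move=> xl; rewrite /g leNgt xl.
exists f, g; split => //.
- split; first by rewrite fE.
  move: l20; rewrite le_eqVlt => /predU1P[l20|l20].
    by rewrite -l20 addr0 fE // fb1 -fb2 -fa2 -l20.
  by rewrite fE' ?ltrDl // addrC addKr.
- apply: (cha (fun s => g s ^+ 2) (fun s => g1 s ^+ 2) (fun s => g2 s ^+ 2));
    [exact: gL.2|exact: g2L.2|by move=> x /gE ->|by move=> x /gE' ->].
- by apply: cha; [exact: L2_int|exact: L2_int|exact: fE|exact: fE'].
- apply: (cha (fun s => f s ^+ 2) (fun s => f1 s ^+ 2) (fun s => f2 s ^+ 2));
    [exact: fL.2|exact: f2L.2|by move=> x /fE ->|by move=> x /fE' ->].
Qed.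

Lemma is_derive_affine (p q x : R) : is_derive x 1 (fun s => p * s + q) p.
Proof.
have -> : (fun s => p * s + q) = (p \*: (@id R)) + cst q by apply/funext.
apply: is_derive_eq.
by rewrite addr0 /GRing.scale /= mulr1.
Qed.

Lemma itg_derivative l F F' : 0 <= l ->
  (forall x : R, is_derive x 1 F (F' x)) -> continuous F' ->
  itg 0 l F' = F l - F 0.
Proof.
move=> l0 dF cF; have [_ _ /(_ l)] := C1_H1 l dF cF.
by rewrite l0 lexx => /(_ isT) ->; rewrite addrC addKr.
Qed.

Lemma continuous_affine (p q : R) : continuous (fun s : R => p * s + q).
Proof.
move=> x; apply: cvgD; last exact: cvg_cst.
by apply: cvgM; [exact: cvg_cst|exact: cvg_id].
Qed.

(** Adding an affine function changes the energy and the mean exactly, and the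
    square norm by a controlled amount. *)
Lemma profile_add_affine l a b E m1 m2 d0 d1 d : 0 < l ->
  `|d0| <= d -> `|d1| <= d -> profile l a b E m1 m2 ->
  exists2 m2', `|m2' - m2| <= d * m2 + l * d * (1 + d) &
  profile l (a + d0) (b + d1)
    (E + 2 * (d1 - d0) * (b - a) / l + (d1 - d0) ^+ 2 / l)
    (m1 + l * (d0 + d1) / 2) m2'.
Proof.
move=> l_gt0 d0d d1d [f [g [fg [fa fb] EE mE1 mE2]]]; have l0 := ltW l_gt0.
have fL := H1_L2f l0 fg; have gL := H1_L2 fg.
have llV : l * l^-1 = 1 by rewrite divff ?gt_eqF.
pose c := (d1 - d0) / l; pose lam x := c * x + d0.
have clE : c * l = d1 - d0 by rewrite divfK ?gt_eqF.
have lamH : H1_deriv l lam (fun=> c).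
  by apply: C1_H1 => x; [exact: is_derive_affine|exact: cvg_cst].
have lamL := H1_L2f l0 lamH.
have lamB x : 0 <= x <= l -> - d <= lam x <= d.
  move=> /andP[x0 xl]; move: d0d d1d; rewrite !ler_norml => /andP[? ?] /andP[? ?].
  have -> : lam x = (1 - x / l) * d0 + x / l * d1.
    rewrite /lam /c; move: llV; set i := l^-1 => _; lra.
  have xl0 : 0 <= x / l by rewrite divr_ge0.
  have xl1 : x / l <= 1 by rewrite ler_pdivrMr // mul1r.
  apply/andP; split; nra.
exists (itg 0 l (fun x => (f x + lam x) ^+ 2)); last first.
  exists (fun x => f x + 1 * lam x), (fun x => g x + 1 * c); split.
  - exact: H1_lin.
  - by rewrite !mul1r fa fb /lam mulr0 add0r clE subrK.
  - have := itg_sqrD c gL (cst_L2 0 l 1).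
    under [X in X = _ -> _]eq_itg => x _ do rewrite mulr1.
    rewrite (_ : itg 0 l (fun x => g x * 1) = b - a); last first.
      rewrite -fa -fb (H1_incr fg) //; apply: eq_itg => x _; exact: mulr1.
    rewrite expr1n itg_cst // -EE => E'.
    transitivity (itg 0 l (fun x => (g x + c) ^+ 2)).
      rewrite E' subr0 /c; move: llV; set i := l^-1 => il.
      rewrite (_ : ((d1 - d0) * i) ^+ 2 * (1 * l) = (d1 - d0) ^+ 2 * i * (l * i)).
        by rewrite il; lra.
      lra.
    by apply: eq_itg => x _; rewrite mul1r.
  - rewrite mE1 (_ : itg 0 l (fun x => f x + 1 * lam x) = itg 0 l (fun x => f x + lam x)).
      rewrite itgD; [congr (_ + _)|exact: L2_int|exact: L2_int].
      pose Lam x := (c / 2 * x + d0) * x.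
      have dLam (x : R) : is_derive x 1 Lam (lam x).
        have dA := is_derive_affine (c / 2) d0 x.
        have -> : Lam = (fun s => c / 2 * s + d0) * (@id R) by apply/funext.
        by apply: is_derive_eq; rewrite /lam /GRing.scale /=; lra.
      rewrite (itg_derivative l0 dLam); last exact: continuous_affine.
      rewrite /Lam mulr0 subr0 (_ : c / 2 * l = (c * l) / 2); last lra.
      rewrite clE; lra.
    by apply: eq_itg => x _; rewrite mul1r.
  - by apply: eq_itg => x _; rewrite mul1r.
have d_ge0 : 0 <= d by exact: le_trans d0d.
have fi2 := fL.2; have mL := L2D fL lamL; have si := mL.2.
have ci : intb 0 l (fun=> d * (1 + d)) := L2_int (cst_L2 _ _ _).
have -> : d * m2 + l * d * (1 + d) = itg 0 l (fun x => d * f x ^+ 2 + d * (1 + d)).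
  by rewrite (itgD (intbZ d fi2) ci) (itgZ d fi2) itg_cst // -mE2; lra.
rewrite ler_norml lerBrDr lerBlDr; apply/andP; split.
  rewrite -mulN1r -itgZ; last by apply: intbD => //; exact: intbZ.
  rewrite mE2 -itgD //; last by apply: intbZ; apply: intbD => //; exact: intbZ.
  apply: le_itg => //.
    by apply: intbD => //; apply: intbZ; apply: intbD => //; exact: intbZ.
  move=> x /lamB /andP[le1 le2].
  have := sqr_ge0 (f x - 1); have := sqr_ge0 (f x + 1); nra.
rewrite mE2 -itgD //; last by apply: intbD => //; exact: intbZ.
apply: le_itg => //.
  by apply: intbD => //; apply: intbD => //; exact: intbZ.
move=> x /lamB /andP[le1 le2].
have := sqr_ge0 (f x - 1); have := sqr_ge0 (f x + 1); nra.
Qed.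

Lemma profile_cst l c : 0 <= l -> profile l c c 0 (c * l) (c ^+ 2 * l).
Proof.
move=> l0; exists (fun=> c), (fun=> 0); split => //; first exact: H1_cst.
- by rewrite itg_cst // expr0n mul0r.
- by rewrite itg_cst // subr0.
- by rewrite itg_cst // subr0.
Qed.

Lemma profile_shift l a b E m1 m2 c : 0 <= l -> profile l a b E m1 m2 ->
  profile l (a + c) (b + c) E (m1 + c * l) (m2 + 2 * c * m1 + c ^+ 2 * l).
Proof.
move=> l0 [f [g [fg [fa fb] EE mE1 mE2]]].
have fL := H1_L2f l0 fg.
exists (fun x => f x + 1 * c), (fun x => g x + 1 * 0); split.
- exact: H1_lin fg (H1_cst l c).
- by rewrite fa fb mul1r.
- by rewrite EE; apply: eq_itg => x _; rewrite mulr0 addr0.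
- rewrite itgD; [|exact: L2_int|exact: L2_int (cst_L2 _ _ _)].
  by rewrite itg_cst // mE1; lra.
- have := itg_sqrD c fL (cst_L2 0 l 1).
  rewrite (_ : itg 0 l (fun x => f x * 1) = m1); last first.
    by rewrite mE1; apply: eq_itg => x _; rewrite mulr1.
  rewrite expr1n itg_cst // -mE2 => E'.
  transitivity (itg 0 l (fun x => (f x + c * 1) ^+ 2)); first by rewrite E'; lra.
  by apply: eq_itg => x _; lra.
Qed.

Lemma profile_opp l a b E m1 m2 : 0 <= l ->
  profile l a b E m1 m2 -> profile l (- a) (- b) E (- m1) m2.
Proof.
move=> l0 [f [g [fg [fa fb] EE mE1 mE2]]].
have fL := H1_L2f l0 fg.
exists (fun x => 0 + (-1) * f x), (fun x => 0 + (-1) * g x); split.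
- exact: H1_lin (H1_cst l 0) fg.
- by rewrite fa fb !add0r !mulN1r.
- by rewrite EE; apply: eq_itg => x _; lra.
- transitivity (-1 * itg 0 l f); first by rewrite mE1 mulN1r.
  by rewrite -itgZ; [apply: eq_itg => x _; lra|exact: L2_int].
- by rewrite mE2; apply: eq_itg => x _; lra.
Qed.

(** A tent followed by its opposite has mean value zero; this gives trial functions
    for both energies. *)
Lemma profile_bump l : 0 < l -> exists E m1 m2,
  profile l 0 0 E m1 m2 /\ m1 ^+ 2 < l * m2.
Proof.
move=> l0; pose q := l / 4; have q0 : 0 < q by rewrite divr_gt0.
have qE : l = (q + q) + (q + q) by rewrite /q; lra.
have [q0' qq0] : 0 <= q /\ 0 <= q + q by lra.
have := profile_cst 0 q0'; rewrite mul0r expr0n mul0r => p0.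
have [] := @profile_add_affine q 0 0 0 0 0 0 1 1 q0 _ _ p0; rewrite ?normr0 ?normr1 //.
move=> m2 _; rewrite !add0r => p1; have p2 := profile_rev q0' p1.
have p3 := profile_cat q0' q0' p1 p2; have p4 := profile_opp qq0 p3.
rewrite oppr0 in p4; have p5 := profile_cat qq0 qq0 p3 p4.
have [_ _ _ b1 _] := profile_bounds qq0 p3.
rewrite qE; do 3 eexists; split; first exact: p5.
rewrite subrr expr0n /=; move: b1; set M := m2 + m2 => b1.
have : 0 < (q * 1 / 2 + q * 1 / 2) ^+ 2 by rewrite exprn_gt0 //; lra.
move: (q * 1 / 2 + q * 1 / 2) b1 => z; nra.
Qed.

Section Trigonometric.
Variables (l κ : R).
Hypotheses (l_gt0 : 0 < l) (κ_gt0 : 0 < κ) (κl : 0 < sin (κ * l)).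
Let l0 := ltW l_gt0.

(** [twave a b] is the solution of [w'' = - κ^2 w] on [[0, l]] with boundary
    values [a] and [b]; [tslope a b] is its derivative. *)
Definition twave a b (s : R) : R :=
  (sin (κ * l))^-1 * (a * sin (- κ * s + κ * l) + b * sin (κ * s + 0)).
Definition tslope a b (s : R) : R :=
  (sin (κ * l))^-1 * κ * (- a * cos (- κ * s + κ * l) + b * cos (κ * s + 0)).

Lemma is_derive_sin_affine (p q x : R) :
  is_derive x 1 (fun s => sin (p * s + q)) (p * cos (p * x + q)).
Proof.
have dA := is_derive_affine p q x.
have := @is_derive1_comp _ sin (fun s => p * s + q) x _ _ (is_derive_sin _) dA.
by rewrite /GRing.scale /= mulrC.
Qed.

Lemma is_derive_cos_affine (p q x : R) :
  is_derive x 1 (fun s => cos (p * s + q)) (- p * sin (p * x + q)).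
Proof.
have dA := is_derive_affine p q x.
have := @is_derive1_comp _ cos (fun s => p * s + q) x _ _ (is_derive_cos _) dA.
by rewrite /GRing.scale /= mulrC mulrN mulNr.
Qed.

Lemma is_derive_lin2 (p q F' G' x : R) (F G : R -> R) :
  is_derive x 1 F F' -> is_derive x 1 G G' ->
  is_derive x 1 (fun s => p * F s + q * G s) (p * F' + q * G').
Proof.
move=> dF dG; have -> : (fun s => p * F s + q * G s) = (p \*: F) + (q \*: G).
  by apply/funext.
by apply: is_derive_eq.
Qed.

Lemma is_derive_twave a b (x : R) : is_derive x 1 (twave a b) (tslope a b x).
Proof.
have := @is_derive_lin2 ((sin (κ * l))^-1 * a) ((sin (κ * l))^-1 * b) _ _ x _ _
  (is_derive_sin_affine (- κ) (κ * l) x) (is_derive_sin_affine κ 0 x).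
rewrite /tslope; set F := (X in is_derive _ _ X _ -> _) => dF.
rewrite (_ : twave a b = F); last by apply/funext => s; rewrite /F /twave; lra.
by apply: is_derive_eq; lra.
Qed.

Lemma is_derive_tslope a b (x : R) :
  is_derive x 1 (tslope a b) (- (κ ^+ 2 * twave a b x)).
Proof.
have := @is_derive_lin2 ((sin (κ * l))^-1 * κ * - a) ((sin (κ * l))^-1 * κ * b) _ _ x _ _
  (is_derive_cos_affine (- κ) (κ * l) x) (is_derive_cos_affine κ 0 x).
rewrite /twave; set F := (X in is_derive _ _ X _ -> _) => dF.
rewrite (_ : tslope a b = F); last by apply/funext => s; rewrite /F /tslope; lra.
by apply: is_derive_eq; lra.
Qed.

Lemma twave0 a b : twave a b 0 = a.
Proof.
rewrite /twave mulr0 add0r mulr0 addr0 sin0 mulr0 addr0.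
by rewrite mulrC mulfK // gt_eqF.
Qed.

Lemma twavel a b : twave a b l = b.
Proof.
rewrite /twave mulNr addNr sin0 mulr0 add0r addr0.
by rewrite mulrC mulfK // gt_eqF.
Qed.

Definition dslope := (sin (κ * l))^-1 * κ.

Lemma tslope0 a b : tslope a b 0 = dslope * (b - a * cos (κ * l)).
Proof. by rewrite /tslope /dslope mulr0 add0r mulr0 addr0 cos0; lra. Qed.

Lemma tslopel a b : tslope a b l = dslope * (b * cos (κ * l) - a).
Proof. by rewrite /tslope /dslope [- κ * l]mulNr addNr addr0 cos0; lra. Qed.

Lemma continuous_twave a b : continuous (twave a b).
Proof.
move=> x; apply: differentiable_continuous; apply/derivable1_diffP.
by have := is_derive_twave a b x.
Qed.

Lemma continuous_tslope a b : continuous (tslope a b).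
Proof.
move=> x; apply: differentiable_continuous; apply/derivable1_diffP.
by have := is_derive_tslope a b x.
Qed.

Lemma twave_H1 a b : H1_deriv l (twave a b) (tslope a b).
Proof. by apply: C1_H1; [exact: is_derive_twave|exact: continuous_tslope]. Qed.

Lemma tslope_H1 a b : H1_deriv l (tslope a b) (fun s => - (κ ^+ 2 * twave a b s)).
Proof.
apply: C1_H1; first exact: is_derive_tslope.
by move=> x; apply: cvgN; apply: cvgM; [exact: cvg_cst|exact: continuous_twave].
Qed.

Lemma twave_bound a b s : 0 <= s <= l ->
  twave a b s ^+ 2 <= 2 * (sin (κ * l))^-1 ^+ 2 * (a ^+ 2 + b ^+ 2).
Proof.
move=> _; rewrite /twave exprMn [leRHS](_ : _ = (sin (κ * l))^-1 ^+ 2 * (2 * (a ^+ 2 + b ^+ 2))); last lra.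
apply: ler_wpM2l; first exact: sqr_ge0.
have sin1 x : sin x ^+ 2 <= 1 :> R.
  by have := cos2Dsin2 x; have := sqr_ge0 (cos x); lra.
have := sin1 (- κ * s + κ * l); have := sin1 (κ * s + 0).
move: (sin _) (sin _) => x y x1 y1.
have := sqr_ge0 (a * x - b * y).
have : 0 <= a ^+ 2 * (1 - x ^+ 2) by rewrite mulr_ge0 ?sqr_ge0 // subr_ge0.
have : 0 <= b ^+ 2 * (1 - y ^+ 2) by rewrite mulr_ge0 ?sqr_ge0 // subr_ge0.
lra.
Qed.

(** The value of [int w'^2 - κ^2 int w^2] for [w = twave a b], by integration by
    parts. *)
Definition twave_energy a b := b * tslope a b l - a * tslope a b 0.

(** A function with the same boundary values as a solution [w] of
    [w'' = - κ^2 w] differs from it by a function vanishing at the ends, which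
    is orthogonal to [w] for the form [int f'^2 - κ^2 int f^2]. *)
Lemma twave_split a b E m1 m2 : profile l a b E m1 m2 -> exists Eh n1 n2,
  [/\ profile l 0 0 Eh n1 n2,
      E - κ ^+ 2 * m2 = twave_energy a b + (Eh - κ ^+ 2 * n2),
      κ ^+ 2 * m1 = tslope a b 0 - tslope a b l + κ ^+ 2 * n1 &
      m2 <= 4 * (sin (κ * l))^-1 ^+ 2 * (a ^+ 2 + b ^+ 2) * l + 2 * n2].
Proof.
move=> [f [g [fg [fa fb] EE mE1 mE2]]].
have fL := H1_L2f l0 fg; have gL := H1_L2 fg.
set w := twave a b; set v := tslope a b.
have wH : H1_deriv l w v := twave_H1 a b.
have vH : H1_deriv l v (fun s => - (κ ^+ 2 * w s)) := tslope_H1 a b.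
have wL := H1_L2f l0 wH; have vL := H1_L2f l0 vH.
have [M wM] := H1_bounded wH.
have wM' x : 0 <= x <= l -> `|- (κ ^+ 2 * w x)| <= κ ^+ 2 * M.
  by move=> /wM xM; rewrite normrN normrM ger0_norm ?sqr_ge0 // ler_wpM2l ?sqr_ge0.
pose h x := f x + -1 * w x; pose k x := g x + -1 * v x.
have hH : H1_deriv l h k by exact: H1_lin.
have hL := H1_L2f l0 hH; have kL := H1_L2 hH.
have h0 : h 0 = 0 by rewrite /h fa /w twave0; lra.
have hl : h l = 0 by rewrite /h fb /w twavel; lra.
have c0 u : L2 0 l u -> itg 0 l (fun x => u x * - (κ ^+ 2 * w x)) =
    - κ ^+ 2 * itg 0 l (fun x => u x * w x).
  move=> uL; rewrite -itgZ; last exact: L2_intM.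
  by apply: eq_itg => x _; lra.
have parts_h := H1_by_parts l0 hH vH wM'; rewrite c0 // h0 hl !mul0r subr0 in parts_h.
have parts_w := H1_by_parts l0 wH vH wM'; rewrite c0 // in parts_w.
exists (itg 0 l (fun x => k x ^+ 2)), (itg 0 l h), (itg 0 l (fun x => h x ^+ 2)).
have fE : itg 0 l (fun x => (h x + 1 * w x) ^+ 2) = m2.
  by rewrite mE2; apply: eq_itg => x _; rewrite /h; lra.
have gE : itg 0 l (fun x => (k x + 1 * v x) ^+ 2) = E.
  by rewrite EE; apply: eq_itg => x _; rewrite /k; lra.
have wE : twave_energy a b = w l * v l - w 0 * v 0.
  by rewrite /w twave0 twavel.
have w2 : itg 0 l (fun x => v x ^+ 2) = itg 0 l (fun x => v x * v x).
  by apply: eq_itg => x _; rewrite expr2.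
have w3 : itg 0 l (fun x => w x ^+ 2) = itg 0 l (fun x => w x * w x).
  by apply: eq_itg => x _; rewrite expr2.
split.
- by exists h, k; split.
- rewrite -fE -gE (itg_sqrD 1 hL wL) (itg_sqrD 1 kL vL) wE parts_w w2 w3; lra.
- rewrite mE1 (_ : itg 0 l f = itg 0 l (fun x => h x + w x)); last first.
    by apply: eq_itg => x _; rewrite /h; lra.
  rewrite (itgD (L2_int hL) (L2_int wL)).
  have := H1_incr vH (lexx 0) l0 (lexx l).
  have -> : itg 0 l (fun s => - (κ ^+ 2 * w s)) = - κ ^+ 2 * itg 0 l w.
    by rewrite -itgZ; [apply: eq_itg => x _; lra|exact: L2_int].
  lra.
- have wbound : itg 0 l (fun x => w x ^+ 2) <=
      2 * (sin (κ * l))^-1 ^+ 2 * (a ^+ 2 + b ^+ 2) * (l - 0).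
    rewrite -itg_cst //; apply: le_itg; first exact: wL.2.
      exact: L2_int (cst_L2 _ _ _).
    by move=> x; exact: twave_bound.
  have : m2 <= 2 * itg 0 l (fun x => w x ^+ 2) + 2 * itg 0 l (fun x => h x ^+ 2).
    rewrite mE2 -(itgZ _ wL.2) -(itgZ _ hL.2) -itgD.
    + apply: le_itg; first exact: fL.2.
        by apply: intbD; apply: intbZ; [exact: wL.2|exact: hL.2].
      move=> x _; rewrite /h; have := sqr_ge0 (f x - 2 * w x); lra.
    + by apply: intbZ; exact: wL.2.
    + by apply: intbZ; exact: hL.2.
  lra.
Qed.

Lemma twave_profile a b : exists E m1 m2,
  [/\ profile l a b E m1 m2, E - κ ^+ 2 * m2 = twave_energy a b &
      κ ^+ 2 * m1 = tslope a b 0 - tslope a b l].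
Proof.
have wH := twave_H1 a b; have vH := tslope_H1 a b.
have wL := H1_L2f l0 wH; have vL := H1_L2f l0 vH.
have [M wM] := H1_bounded wH.
have wM' x : 0 <= x <= l -> `|- (κ ^+ 2 * twave a b x)| <= κ ^+ 2 * M.
  by move=> /wM xM; rewrite normrN normrM ger0_norm ?sqr_ge0 // ler_wpM2l ?sqr_ge0.
exists (itg 0 l (fun x => tslope a b x ^+ 2)), (itg 0 l (twave a b)),
  (itg 0 l (fun x => twave a b x ^+ 2)); split.
- by exists (twave a b), (tslope a b); split; rewrite ?twave0 ?twavel.
- have := H1_by_parts l0 wH vH wM'; rewrite twave0 twavel /twave_energy => ->.
  have -> : itg 0 l (fun x => twave a b x * - (κ ^+ 2 * twave a b x)) =
      - κ ^+ 2 * itg 0 l (fun x => twave a b x ^+ 2).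
    by rewrite -(itgZ _ wL.2); apply: eq_itg => x _; lra.
  by rewrite mulNr; congr (_ - _); apply: eq_itg => x _; rewrite expr2.
- have := H1_incr vH (lexx 0) l0 (lexx l).
  have -> : itg 0 l (fun s => - (κ ^+ 2 * twave a b s)) = - κ ^+ 2 * itg 0 l (twave a b).
    by rewrite -itgZ; [apply: eq_itg => x _; lra|exact: L2_int].
  lra.
Qed.

End Trigonometric.

End Profiles.

(** * Endpoints and dummy vertices *)
Section DummyEnds.
Variables (m : nat) (e : 'I_m).

(** The inverse of [old_end] on the old endpoints. *)
Definition new_end (x : 'I_m * bool) : 'I_m.+1 * bool :=
  if (x.1 == e) && x.2 then (ord_max, true) else (lift ord_max x.1, x.2).

Definition old_edge (z : 'I_m.+1) : 'I_m := odflt e (unlift ord_max z).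

Lemma new_endK x : old_end e (new_end x) = Some x.
Proof.
rewrite /new_end /old_end; case: ifP => [/andP[/eqP xe x2]|/negbT xe] /=.
  by rewrite unlift_none; case: x xe x2 => ? [] /= -> .
by rewrite liftK (negbTE xe); case: x xe.
Qed.

Lemma old_endK z x : old_end e z = Some x -> z = new_end x.
Proof.
rewrite /old_end /new_end; case: z => z b /=; case: unliftP => [j ->|->].
  by case: ifP => // /negbT jb [<-] /=; rewrite (negbTE jb).
by case: b => // -[<-] /=; rewrite eqxx.
Qed.

Lemma old_end_None z :
  (old_end e z == None) = (z == (lift ord_max e, true)) || (z == (ord_max, false)).
Proof.
rewrite /old_end; case: z => z b /=; rewrite !xpair_eqE; case: unliftP => [j ->|->].
  rewrite (inj_eq (@lift_inj _ _)) [_ == ord_max]eq_sym (negbTE (neq_lift _ _)) /= orbF.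
  by rewrite [b == true]eqb_id; case: ifP.
by rewrite eqxx (negbTE (neq_lift _ _)) /=; case: b.
Qed.

Lemma old_edge_lift i : old_edge (lift ord_max i) = i.
Proof. by rewrite /old_edge liftK. Qed.

Lemma old_edge_max : old_edge ord_max = e.
Proof. by rewrite /old_edge unlift_none. Qed.

Lemma old_edge_new_end x : old_edge (new_end x).1 = x.1.
Proof.
by rewrite /new_end; case: ifP => [/andP[/eqP-> _]|_] /=;
  rewrite ?old_edge_max ?old_edge_lift.
Qed.

Lemma new_end_inj : injective new_end.
Proof. by move=> x y /(congr1 (old_end e)); rewrite !new_endK => -[]. Qed.

Lemma dummy_rel_new r x y : dummy_rel e r (new_end x) (new_end y) = r x y.
Proof. by rewrite /dummy_rel !new_endK. Qed.

Lemma sum_dummy (V : nmodType) (P : pred 'I_m) (F : 'I_m.+1 -> V) :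
  (\sum_(z | P (old_edge z)) F z =
   \sum_(i | P i) (F (lift ord_max i) + if i == e then F ord_max else 0))%R.
Proof.
have liftE (i : 'I_m) : widen_ord (leqnSn m) i = lift ord_max i.
  by apply: val_inj; rewrite /= /bump leqNgt ltn_ord.
rewrite big_mkcond big_ord_recr /= old_edge_max big_split /=; congr (_ + _)%R.
  rewrite [RHS]big_mkcond; apply: eq_bigr => i _.
  by rewrite liftE old_edge_lift.
rewrite -big_mkcondr; case: ifP => Pe.
  rewrite (big_pred1 e) // => i /=.
  by case: eqP => [->|_]; rewrite ?Pe ?andbF.
by rewrite big_pred0 // => i; case: eqP => [->|_]; rewrite ?Pe ?andbF.
Qed.

Lemma sum_new_end (V : nmodType) (P : pred ('I_m.+1 * bool)) (F : 'I_m.+1 * bool -> V) :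
  (forall z, old_end e z = None -> ~~ P z) ->
  (\sum_(z | P z) F z = \sum_(x | P (new_end x)) F (new_end x))%R.
Proof.
move=> PN; rewrite [RHS](_ : _ = \sum_(x in [set: 'I_m * bool]%SET | P (new_end x)) F (new_end x))%R.
  rewrite -(big_imset_cond _ P F); last by move=> x y _ _; exact: new_end_inj.
  apply: eq_bigl => z; apply/idP/andP => [Pz|[]//]; split => //.
  case zE : (old_end e z) => [x|]; last by have := PN _ zE; rewrite Pz.
  by rewrite (old_endK zE) imset_f.
by apply: eq_bigl => x; rewrite inE.
Qed.

Variables (R : realType) (l : 'I_m -> R) (t : R).

Lemma dummy_len_lift i : dummy_len e l t (lift ord_max i) = if i == e then t else l i.
Proof. by rewrite /dummy_len liftK. Qed.

Lemma dummy_len_max : dummy_len e l t ord_max = l e - t.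
Proof. by rewrite /dummy_len unlift_none. Qed.

End DummyEnds.

(** * Rayleigh quotients *)
Section RayleighQuotients.
Variable R : realType.

(** A semi-graph: edges [I] with lengths [l] which may vanish, endpoints glued
    along [r].  A trial function on the edges of [C] enters the Rayleigh quotient
    only through the profiles of its restrictions to the edges. *)
Definition trial (I : finType) (C : {set I}) (r : rel (I * bool))
    (VD : pred (I * bool)) (l : I -> R) (a : I * bool -> R) (E m1 m2 : I -> R) :=
  [/\ forall i, i \in C -> profile (l i) (a (i, false)) (a (i, true)) (E i) (m1 i) (m2 i),
      forall x y, x.1 \in C -> y.1 \in C -> r x y -> a x = a y &
      forall x, x.1 \in C -> VD x -> a x = 0].

(** If [th], the squared distance to the constants, so that the infimum of the
    quotients will be [mu2]; otherwise the square norm, as in [lambda1]. *)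
Definition mass (th : bool) (I : finType) (C : {set I}) (l m1 m2 : I -> R) : R :=
  \sum_(i in C) m2 i - (if th then (\sum_(i in C) m1 i) ^+ 2 / \sum_(i in C) l i else 0).

Definition rayleigh (th : bool) (I : finType) (C : {set I}) (r : rel (I * bool))
    (VD : pred (I * bool)) (l : I -> R) : set R :=
  [set q | exists a E m1 m2, [/\ trial C r VD l a E m1 m2,
     0 < mass th C l m1 m2 & q = (\sum_(i in C) E i) / mass th C l m1 m2]].

(** [relabel_end] for arbitrary sets of edges. *)
Definition relabel (I J : Type) (phi : I -> J) (flip : I -> bool) (x : I * bool) :
  J * bool := (phi x.1, x.2 (+) flip x.1).

(** Used in both directions, it shows that isomorphic clusters have the same
    energy. *)
Lemma rayleigh_pullback th (I J : finType) (C : {set I}) (C' : {set J})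
    (r : rel (I * bool)) (r' : rel (J * bool)) (VD : pred (I * bool)) (VD' : pred (J * bool))
    (l : I -> R) (l' : J -> R) (phi : I -> J) (flip : I -> bool) :
  {in C &, injective phi} -> phi @: C = C' ->
  (forall j, j \in C' -> 0 <= l' j) ->
  (forall i, i \in C -> l i = l' (phi i)) ->
  (forall x y, x.1 \in C -> y.1 \in C -> r x y ->
     r' (relabel phi flip x) (relabel phi flip y)) ->
  (forall x, x.1 \in C -> VD x -> VD' (relabel phi flip x)) ->
  rayleigh th C' r' VD' l' `<=` rayleigh th C r VD l.
Proof.
move=> inj im l'0 lE rr' VV' q [a [E [m1 [m2 [[prof cont dir] mass0 ->]]]]].
have phiC i : i \in C -> phi i \in C' by move=> iC; rewrite -im imset_f.
have sumE F : \sum_(j in C') F j = \sum_(i in C) F (phi i) :> R.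
  by rewrite -im big_imset.
have lsum : \sum_(j in C') l' j = \sum_(i in C) l i.
  by rewrite sumE; apply: eq_bigr => i /lE.
exists (fun x => a (relabel phi flip x)), (E \o phi), (m1 \o phi), (m2 \o phi).
have -> : mass th C l (m1 \o phi) (m2 \o phi) = mass th C' l' m1 m2.
  by rewrite /mass !sumE; case: (th) => //; congr (_ - _ / _); apply: eq_bigr => i /lE.
split => //; last by rewrite sumE.
split.
- move=> i iC; have := prof _ (phiC _ iC); rewrite lE // /relabel /=.
  by case: (flip i) => //=; apply: profile_rev; rewrite l'0 ?phiC.
- by move=> x y xC yC rxy; apply: cont; rewrite ?phiC //; exact: rr'.
- by move=> x xC Vx; apply: dir; rewrite ?phiC //; exact: VV'.
Qed.

(** Trial functions are split, and concatenated, at the dummy vertex. *)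
Lemma rayleigh_dummy th m (e : 'I_m) (C : {set 'I_m})
    (r : rel ('I_m * bool)) (VD : pred ('I_m * bool)) (VD' : pred ('I_m.+1 * bool)) (l : 'I_m -> R) t :
  0 <= t <= l e ->
  (forall z, VD' z = if old_end e z is Some x then VD x else false) ->
  rayleigh th (old_edge e @^-1: C) (dummy_rel e r) VD' (dummy_len e l t) =
  rayleigh th C r VD l.
Proof.
move=> /andP[t0 tl] V'E.
pose s F := fun i : 'I_m => F (lift ord_max i) + if i == e then F ord_max else 0 : R.
have sumE F : \sum_(z in old_edge e @^-1: C) F z = \sum_(i in C) s F i.
  by rewrite -(sum_dummy e (mem C)); apply: eq_bigl => z; rewrite inE.
have lE : s (dummy_len e l t) =1 l.
  move=> i; rewrite /s dummy_len_lift dummy_len_max.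
  by case: eqP => [->|_]; rewrite ?addr0 // addrC subrK.
have massE m1 m2 : mass th (old_edge e @^-1: C) (dummy_len e l t) m1 m2 =
    mass th C l (s m1) (s m2).
  by rewrite /mass !sumE; case: (th) => //; congr (_ - _ / _); apply: eq_bigr => i _.
have ne i b : i != e \/ b = false -> new_end e (i, b) = (lift ord_max i, b).
  by rewrite /new_end /= => -[/negbTE->|->] //; rewrite andbF.
have nee : new_end e (e, true) = (ord_max, true) by rewrite /new_end /= eqxx.
have neC x : ((new_end e x).1 \in old_edge e @^-1: C) = (x.1 \in C).
  by rewrite inE old_edge_new_end.
apply/seteqP; split => q [a [E [m1 [m2 [[prof cont dir] mass0 ->]]]]].
  exists (a \o new_end e), (s E), (s m1), (s m2).
  rewrite -massE sumE; split => //; split.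
  - move=> i iC; rewrite /s /=; case: eqP => [ie|/eqP ie].
      subst i; rewrite ne; last by right.
      rewrite nee -(lE e) /s eqxx.
      have b : a (lift ord_max e, true) = a (ord_max, false).
        apply: cont; rewrite ?inE /= ?old_edge_lift ?old_edge_max //.
        rewrite /dummy_rel.
        have /eqP -> : old_end e (lift ord_max e, true) == None.
          by rewrite old_end_None eqxx.
        have /eqP -> : old_end e (ord_max, false) == None.
          by rewrite old_end_None eqxx orbT.
        by [].
      apply: (@profile_cat _ _ _ _ (a (ord_max, false))).
      + by rewrite dummy_len_lift eqxx.
      + by rewrite dummy_len_max subr_ge0.
      + by rewrite -b; apply: prof; rewrite inE old_edge_lift.
      + by apply: prof; rewrite inE old_edge_max.
    rewrite !ne; try by left.
    rewrite !addr0 -(lE i) /s (negbTE ie) addr0.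
    by apply: prof; rewrite inE old_edge_lift.
  - move=> x y xC yC rxy; apply: cont; rewrite ?neC //.
    by rewrite dummy_rel_new.
  - by move=> x xC Vx; apply: dir; rewrite ?neC // V'E new_endK.
have spl : exists b E1 m11 m21 E2 m12 m22, e \in C ->
  [/\ profile t (a (e, false)) b E1 m11 m21,
      profile (l e - t) b (a (e, true)) E2 m12 m22,
      E e = E1 + E2, m1 e = m11 + m12 & m2 e = m21 + m22].
  case: (boolP (e \in C)) => eC; last by do 7 exists 0.
  have := prof e eC; rewrite -[l e](subrKC t).
  move=> /(profile_split t0); rewrite subr_ge0 subrKC => /(_ tl).
  move=> [b [E1 [m11 [m21 [E2 [m12 [m22 H]]]]]]].
  by exists b, E1, m11, m21, E2, m12, m22.
have [b [E1 [m11 [m21 [E2 [m12 [m22 split_e]]]]]]] := spl.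
pose u F x1 x2 := fun z : 'I_m.+1 => if unlift ord_max z is Some i then
  (if i == e then x1 else F i) else x2 : R.
have suE F x1 x2 : (e \in C -> F e = x1 + x2) ->
    forall i, i \in C -> s (u F x1 x2) i = F i.
  move=> Fe i iC; rewrite /s /u liftK unlift_none.
  by case: eqP => [ie|_]; rewrite ?addr0 //; subst i; rewrite Fe.
have E_E i : i \in C -> s (u E E1 E2) i = E i.
  by apply: suE => /split_e[].
have m1E i : i \in C -> s (u m1 m11 m12) i = m1 i.
  by apply: suE => /split_e[].
have m2E i : i \in C -> s (u m2 m21 m22) i = m2 i.
  by apply: suE => /split_e[].
exists (fun z => if old_end e z is Some x then a x else b),
  (u E E1 E2), (u m1 m11 m12), (u m2 m21 m22).
have mE : mass th (old_edge e @^-1: C) (dummy_len e l t) (u m1 m11 m12) (u m2 m21 m22)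
    = mass th C l m1 m2.
  rewrite massE /mass (eq_bigr _ m2E); case: (th) => //; congr (_ - _ ^+ 2 / _).
  exact: eq_bigr.
rewrite mE sumE (eq_bigr _ E_E); split => //; split.
- move=> z; rewrite inE /u /dummy_len /old_end /= => zC.
  case: unliftP zC => [i ->|->]; rewrite ?old_edge_lift ?old_edge_max => iC /=.
    rewrite andbF andbT; case: eqP => [ie|_]; last exact: prof.
    by rewrite ie; case: (split_e _); rewrite -?ie.
  by case: (split_e iC).
- move=> x y; rewrite !inE /dummy_rel => xC yC.
  case xE : (old_end e x) => [x'|]; case yE : (old_end e y) => [y'|] //.
  move: xC yC; rewrite (old_endK xE) (old_endK yE) !old_edge_new_end; exact: cont.
- move=> z; rewrite inE V'E => zC; case zE : (old_end e z) => [x|] // Vx.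
  by apply: dir => //; move: zC; rewrite (old_endK zE) old_edge_new_end.
Qed.

Lemma rayleigh_ge0 th (I : finType) (C : {set I}) (r : rel (I * bool))
    (VD : pred (I * bool)) (l : I -> R) q :
  (forall i, i \in C -> 0 <= l i) -> rayleigh th C r VD l q -> 0 <= q.
Proof.
move=> l0 [a [E [m1 [m2 [[prof _ _] mass0 ->]]]]].
apply: divr_ge0; last exact: ltW.
by apply: sumr_ge0 => i iC; have [] := profile_bounds (l0 _ iC) (prof _ iC).
Qed.

(** A bump on a single edge satisfies any vertex conditions. *)
Lemma rayleigh_has_inf th (I : finType) (C : {set I}) (r : rel (I * bool))
    (VD : pred (I * bool)) (l : I -> R) :
  (forall i, i \in C -> 0 <= l i) -> (exists2 i, i \in C & 0 < l i) ->
  has_inf (rayleigh th C r VD l).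
Proof.
move=> l0 [i0 i0C li0]; split; last by exists 0 => q; exact: rayleigh_ge0.
have [E0 [b1 [b2 [bump pos]]]] := profile_bump li0.
pose on x := fun i : I => if i == i0 then x else 0 : R.
have sumE x : \sum_(i in C) on x i = x.
  rewrite (bigD1 i0) //= /on eqxx big1 ?addr0 // => i /andP[_ /negbTE ->] //.
have L0 : 0 < \sum_(i in C) l i.
  rewrite (bigD1 i0) //=; apply: ltr_wpDr => //.
  by apply: sumr_ge0 => i /andP[iC _]; exact: l0.
exists (E0 / mass th C l (on b1) (on b2)).
exists (fun=> 0), (on E0), (on b1), (on b2); split => //; last by rewrite sumE.
  split => // i iC; rewrite /on; case: eqP => [->//|_].
  by have := profile_cst 0 (l0 i iC); rewrite mul0r expr0n mul0r.
have b2_gt0 : 0 < b2 by rewrite -(pmulr_rgt0 _ li0); apply: le_lt_trans pos; exact: sqr_ge0.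
rewrite /mass !sumE; case: th; last by rewrite subr0.
rewrite subr_gt0 ltr_pdivrMr //; apply: (lt_le_trans pos); rewrite mulrC.
rewrite ler_wpM2l ?(ltW b2_gt0) // (bigD1 i0) //= lerDl.
by apply: sumr_ge0 => i /andP[iC _]; exact: l0.
Qed.

(** A path of endpoints without repetition bounds the variation of a trial
    function by the variations along the edges it runs through. *)
Lemma connect_variation (I : finType) (r : rel (I * bool)) (J : pred I)
    (a : I * bool -> R) (d : R) x y : 0 <= d ->
  connect (fun x y => r x y || ((x.1 == y.1) && J x.1)) x y ->
  (forall u v, connect (fun x y => r x y || ((x.1 == y.1) && J x.1)) x u ->
     r u v -> a u = a v) ->
  (forall i, connect (fun x y => r x y || ((x.1 == y.1) && J x.1)) x (i, false) ->
     J i -> `|a (i, true) - a (i, false)| <= d) ->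
  `|a y - a x| <= #|{: I * bool}|%:R * d.
Proof.
move=> d0 /connectP[p pth ->] cont var.
case/shortenP: pth => p' pth' /(card_uniqP) up' _.
have : (size p' <= #|{: I * bool}|)%N.
  apply: leq_trans (max_card (mem (x :: p'))); rewrite up' /=; exact: leqnSn.
move=> szp; apply: (@le_trans _ _ ((size p')%:R * d)); last first.
  by rewrite ler_wpM2r // ler_nat.
set e := (fun x y : I * bool => _) in cont var pth'.
elim/last_ind: p' pth' {up' szp} => [|p' z IH] /=; first by rewrite subrr normr0 mul0r.
rewrite rcons_path last_rcons size_rcons => /andP[pth' ez].
have cz : connect e x (last x p') by apply/connectP; exists p'.
rewrite -natr1 mulrDl mul1r; have := IH pth'; set w := last x p' in ez cz *.
have -> : a z - a x = (a z - a w) + (a w - a x) by lra.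
move=> IHw; apply: le_trans (ler_normD _ _) _; rewrite addrC; apply: lerD => //.
move: ez => /orP[rwz|/andP[/eqP wz Jw]].
  by rewrite (cont w z) // subrr normr0.
have cw : connect e x (w.1, false).
  apply: connect_trans cz (connect1 _); rewrite /e /=.
  by rewrite eqxx Jw orbT.
have := var _ cw Jw; case: w z wz {IHw cz cw} Jw => i b [j b'] /= <- _ le.
case: b b' => -[]; rewrite ?subrr ?normr0 //.
by rewrite distrC.
Qed.

(** A Poincare inequality with a crude constant: paths starting at [x0] bound the
    difference of a trial function and its value at [x0]. *)
Lemma rayleigh_lower_bound th (I : finType) (C : {set I}) (r : rel (I * bool))
    (VD : pred (I * bool)) (l : I -> R) q x0 :
  x0.1 \in C -> (forall i, i \in C -> 0 <= l i) -> 0 < \sum_(i in C) l i ->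
  (forall x y, x.1 \in C -> r x y -> y.1 \in C) ->
  (forall x, x.1 \in C -> connect (fun x y => r x y || (x.1 == y.1)) x0 x) ->
  th || VD x0 -> rayleigh th C r VD l q ->
  1 <= q * (2 * (#|{: I * bool}|%:R ^+ 2 + 1) * (\sum_(i in C) l i) ^+ 2).
Proof.
move=> x0C l0 L0 rC conn thV [a [E [m1 [m2 [[prof cont dir] mass0 ->]]]]].
set L := \sum_(i in C) l i in L0 *; set ET := \sum_(i in C) E i.
set n : R := #|_|%:R.
have n0 : 0 <= n by exact: ler0n.
have E0 i : i \in C -> 0 <= E i.
  by move=> iC; have [] := profile_bounds (l0 _ iC) (prof _ iC).
have lL i : i \in C -> l i <= L.
  move=> iC; rewrite /L (bigD1 i) //= lerDl.
  by apply: sumr_ge0 => j /andP[jC _]; exact: l0.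
have EL i : i \in C -> E i <= ET.
  move=> iC; rewrite /ET (bigD1 i) //= lerDl.
  by apply: sumr_ge0 => j /andP[jC _]; exact: E0.
have ET0 : 0 <= ET by exact: sumr_ge0.
have LE i : i \in C -> l i * E i <= L * ET.
  by move=> iC; apply: ler_pM; rewrite ?l0 ?E0 ?lL ?EL.
set d := Num.sqrt (L * ET).
have d2 : d ^+ 2 = L * ET by rewrite sqr_sqrtr // mulr_ge0 // ltW.
have d0 : 0 <= d by exact: sqrtr_ge0.
pose e (x y : I * bool) := r x y || ((x.1 == y.1) && xpredT x.1).
have eE x y : e x y = r x y || (x.1 == y.1) by rewrite /e /= andbT.
have eC x y : connect e x y -> x.1 \in C -> y.1 \in C.
  move=> /connectP[p pth ->]; elim: p x pth => //= z p IH x /andP[+ pth] xC.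
  rewrite eE => /orP[/rC|/eqP xz]; first by move=> /(_ xC); exact: IH.
  by apply: IH => //; rewrite -xz.
have osc x : x.1 \in C -> (a x - a x0) ^+ 2 <= n ^+ 2 * (L * ET).
  move=> xC; rewrite -d2 -exprMn -real_normK ?num_real // lerXn2r ?nnegrE ?mulr_ge0 //.
  apply: (@connect_variation _ r xpredT) => //.
  - have := conn x xC; congr is_true; apply: eq_connect => u v.
    by rewrite andbT.
  - by move=> u v cu ruv; have uC := eC _ _ cu x0C; apply: cont => //; exact: rC ruv.
  - move=> i ci _; have iC : i \in C := eC _ _ ci x0C.
    rewrite -(@ler_pXn2r _ 2) ?nnegrE // real_normK ?num_real // d2.
    by apply: le_trans (LE i iC); have [] := profile_bounds (l0 _ iC) (prof _ iC).
(* the mass is at most the square norm of [f + c], for any [c] if [th] and for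
   [c = 0] otherwise *)
pose c := if th then - a x0 else 0.
have c0 : a x0 + c = 0.
  by rewrite /c; case: ifP thV => [_ _|_ /= Vx]; rewrite ?subrr // addr0 dir.
have shift i : i \in C -> m2 i + 2 * c * m1 i + c ^+ 2 * l i <=
    2 * l i * ((n ^+ 2 + 1) * (L * ET)).
  move=> iC; have [_ _ _ _] := profile_bounds (l0 _ iC) (profile_shift c (l0 _ iC) (prof _ iC)).
  move=> /le_trans; apply; apply: ler_wpM2l; first by rewrite mulr_ge0 ?l0.
  rewrite mulrDl mul1r; apply: lerD; last exact: LE.
  have -> : a (i, false) + c = a (i, false) - a x0 by have := c0; lra.
  exact: osc.
have sh : \sum_(i in C) m2 i + 2 * c * \sum_(i in C) m1 i + c ^+ 2 * L <=
    2 * L * ((n ^+ 2 + 1) * (L * ET)).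
  have -> : 2 * L * ((n ^+ 2 + 1) * (L * ET)) =
      \sum_(i in C) 2 * l i * ((n ^+ 2 + 1) * (L * ET)).
    by rewrite -mulr_suml -mulr_sumr.
  have -> : \sum_(i in C) m2 i + 2 * c * \sum_(i in C) m1 i + c ^+ 2 * L =
      \sum_(i in C) (m2 i + 2 * c * m1 i + c ^+ 2 * l i).
    by rewrite !big_split /= -!mulr_sumr.
  exact: ler_sum.
have massle : mass th C l m1 m2 <= \sum_(i in C) m2 i + 2 * c * \sum_(i in C) m1 i + c ^+ 2 * L.
  rewrite /mass -/L /c; case: th {mass0 thV c c0 shift sh} => /=; last lra.
  set S1 := \sum_(i in C) m1 i; set x := a x0.
  rewrite -subr_ge0.
  have -> : \sum_(i in C) m2 i + 2 * - x * S1 + (- x) ^+ 2 * L -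
      (\sum_(i in C) m2 i - S1 ^+ 2 / L) = (S1 - x * L) ^+ 2 / L.
    have iL : L * L^-1 = 1 by rewrite divff // gt_eqF.
    rewrite [(S1 - x * L) ^+ 2](_ : _ = S1 ^+ 2 - 2 * x * S1 * L + x ^+ 2 * L * L); last lra.
    set i := L^-1 in iL *.
    transitivity (S1 ^+ 2 * i - 2 * x * S1 * (L * i) + x ^+ 2 * L * (L * i)); last lra.
    by rewrite iL; lra.
  by rewrite divr_ge0 ?sqr_ge0 // ltW.
rewrite mulrAC ler_pdivlMr // mul1r; apply: (le_trans massle); apply: (le_trans sh); lra.
Qed.

End RayleighQuotients.

(** * Eigenvalues and Rayleigh quotients *)
Section Positivity.
Variable R : realType.
Notation mu := (@lebesgue_measure R).
Notation itg a b f := (\int[mu]_(u in `[a, b]) f u).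
Notation intb a b f := (mu.-integrable `[a, b] (EFin \o f)).

(** If the square norm were zero, averaging over an interval of length [h] around
    [s] would give [f s ^ 2 <= 2 * h * E] for all small [h]. *)
Lemma sqr_norm_gt0 (l s : R) (f g : R -> R) : 0 < l -> H1_deriv l f g ->
  0 <= s <= l -> f s != 0 -> 0 < itg 0 l (fun x => f x ^+ 2).
Proof.
move=> l_gt0 fg /andP[s0 sl] fs0; have l0 := ltW l_gt0.
have fL := H1_L2f l0 fg.
set M := itg 0 l (fun x => f x ^+ 2); set E := itg 0 l (fun x => g x ^+ 2).
have E0 : 0 <= E by apply: itg_ge0 => x _; exact: sqr_ge0.
have M0 : 0 <= M by apply: itg_ge0 => x _; exact: sqr_ge0.
have window p q : 0 <= p -> p <= s -> s <= q -> q <= l ->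
    (q - p) * f s ^+ 2 <= 2 * M + 2 * (q - p) ^+ 2 * E.
  move=> p0 ps sq ql; have pq := le_trans ps sq.
  have sub : itg p q (fun x => f x ^+ 2) <= M.
    rewrite /M (@itg_chasles _ 0 p l) ?fL.2 ?(le_trans pq) //.
    rewrite (@itg_chasles _ p q l) //; last exact: (intb_sub _ _ fL.2).
    have := @itg_ge0 _ 0 p (fun x => f x ^+ 2) (fun _ _ => sqr_ge0 _).
    have := @itg_ge0 _ q l (fun x => f x ^+ 2) (fun _ _ => sqr_ge0 _).
    lra.
  have fi : intb p q (fun x => f x ^+ 2) := intb_sub p0 ql fL.2.
  have ci c : intb p q (fun=> c) := L2_int (cst_L2 _ _ _).
  have : itg p q (fun=> f s ^+ 2) <=
      itg p q (fun x => 2 * f x ^+ 2 + 2 * (q - p) * E).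
    apply: le_itg => //; first by apply: intbD => //; exact: intbZ.
    move=> x /andP[px xq].
    suff : (f s - f x) ^+ 2 <= (q - p) * E.
      by have := sqr_ge0 (f s - 2 * f x); lra.
    have [sx|xs] := leP s x.
      rewrite (_ : (f s - f x) ^+ 2 = (f x - f s) ^+ 2); last lra.
      apply: le_trans (H1_incr_sqr fg s0 sx (le_trans xq ql)) _.
      apply: ler_wpM2r => //; lra.
    apply: le_trans (H1_incr_sqr fg (le_trans p0 px) (ltW xs) sl) _.
    apply: ler_wpM2r => //; lra.
  rewrite itgD ?itgZ ?itg_cst //; last exact: intbZ.
  lra.
rewrite lt_neqAle M0 andbT; apply/eqP => M_eq0.
have c0 : 0 < f s ^+ 2 by rewrite exprn_even_gt0.
have small (h : R) : 0 < h -> h <= l / 2 -> f s ^+ 2 <= 2 * h * E.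
  move=> h0 hl; rewrite -(ler_pM2l h0).
  have [sl2|sl2] := leP s (l / 2).
    have := window s (s + h) s0 (lexx _); rewrite -M_eq0 addrAC subrr add0r.
    by move=> w; have := w _ _; lra.
  have := window (s - h) s; rewrite -M_eq0 subKr.
  by move=> w; have := w _ _ (lexx _) sl; lra.
pose h := Num.min (l / 2) (f s ^+ 2 / (4 * E + 1)).
have d0 : 0 < 4 * E + 1 by lra.
have h0 : 0 < h by rewrite lt_min; apply/andP; split; [lra|exact: divr_gt0].
have := small h h0; rewrite /h ge_min lexx => /(_ isT) le1.
have le2 : h <= f s ^+ 2 / (4 * E + 1) by rewrite ge_min lexx orbT.
have le3 : h * (4 * E + 1) <= f s ^+ 2 by rewrite -ler_pdivlMr.
rewrite -/h in le1.
have := mulr_ge0 (ltW h0) E0; nra.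
Qed.

End Positivity.

Section GraphSpectrum.
Variable R : realType.
Notation mu := (@lebesgue_measure R).
Notation itg a b f := (\int[mu]_(u in `[a, b]) f u).
Variable G : metric_graph R.

Lemma end_valueF (f : edge G -> R -> R) e : end_value f (e, false) = f e 0.
Proof. by []. Qed.

Lemma end_valueT (f : edge G -> R -> R) e : end_value f (e, true) = f e (len e).
Proof. by []. Qed.

Lemma nonzero_norm (f g : edge G -> R -> R) : graph_H1_deriv f g -> nonzero_fun f ->
  0 < \sum_(e in [set: edge G]%SET) itg 0 (len e) (fun s => f e s ^+ 2).
Proof.
move=> [fg _] [e [s [sl fs]]]; rewrite (bigD1 e) ?inE //= ltr_pwDl //.
  exact: sqr_norm_gt0 (len_gt0 e) (fg e) sl fs.
by apply: sumr_ge0 => i _; apply: itg_ge0 => x _; exact: sqr_ge0.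
Qed.

Lemma lambda1E (VD : pred (endpoint G)) :
  lambda1 VD = inf (rayleigh false [set: edge G]%SET (@glued G) VD (@len R G)).
Proof.
congr inf; apply/seteqP; split => q.
  move=> [f [g [fg fD f0 ->]]].
  exists (end_value f), (fun e => itg 0 (len e) (fun s => g e s ^+ 2)),
    (fun e => itg 0 (len e) (f e)), (fun e => itg 0 (len e) (fun s => f e s ^+ 2)).
  rewrite /mass subr0; split; last 2 first.
  - exact: nonzero_norm fg f0.
  - by rewrite /graph_sqnorm; congr (_ / _); apply: eq_bigl => e; rewrite inE.
  by split => [e _|x y _ _|x _]; [exists (f e), (g e); split => //; exact: fg.1|
     exact: fg.2|exact: fD].
move=> [a [E [m1 [m2 [[prof cont dir]]]]]]; rewrite /mass subr0 => m0 ->.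
have /choice[f fP] : forall e, exists f, exists g : R -> R,
  [/\ H1_deriv (len e) f g, f 0 = a (e, false) /\ f (len e) = a (e, true),
    E e = itg 0 (len e) (fun s => g s ^+ 2), m1 e = itg 0 (len e) f &
    m2 e = itg 0 (len e) (fun s => f s ^+ 2)].
  by move=> e; exact: prof.
have {fP}/choice[g fgP] := fP.
have aE x : end_value f x = a x.
  by case: x => e b; have [_ [H0 H1] _ _ _] := fgP e; case: b;
    rewrite ?end_valueF ?end_valueT ?H0 ?H1.
have m2E : \sum_(e in [set: edge G]%SET) m2 e = graph_sqnorm f.
  by rewrite /graph_sqnorm; apply: eq_big => [e|e _]; rewrite ?inE //; have [] := fgP e.
exists f, g; split.
- split; first by move=> e; have [] := fgP e.
  by move=> x y xy; rewrite !aE; apply: cont; rewrite ?inE.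
- by move=> x Vx; rewrite aE; apply: dir; rewrite ?inE.
- apply: contrapT => fN.
  suff : \sum_(e in [set: edge G]%SET) m2 e = 0 by move=> m00; rewrite m00 ltxx in m0.
  apply: big1 => e _; have [_ _ _ _ ->] := fgP e.
  transitivity (itg 0 (len e) (fun=> 0)); last by rewrite itg_cst ?mul0r // ltW ?len_gt0.
  apply: eq_itg => s sl; apply/eqP; rewrite sqrf_eq0; apply/negP => /negP fs.
  by apply: fN; exists e, s.
- rewrite m2E; congr (_ / _); rewrite /graph_sqnorm.
  by apply: eq_big => [e|e _]; rewrite ?inE //; have [] := fgP e.
Qed.

Lemma glued_refl (x : endpoint G) : glued x x.
Proof. by have [] := glued_equiv x x x. Qed.

Lemma gluedE (x y : endpoint G) : glued x y -> glued x =1 glued y.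
Proof. by move=> xy z; have [_ ->] := glued_equiv x y z. Qed.

Lemma glued_sym (x y : endpoint G) : glued x y = glued y x.
Proof. by apply/idP/idP => xy; [rewrite -(gluedE xy)|rewrite -(gluedE xy)]; exact: glued_refl. Qed.

(** Summation by parts: distribute the term of [x] evenly over its vertex. *)
Lemma kirchhoff_sum (a : endpoint G -> R) (g : edge G -> R -> R) :
  (forall x y, glued x y -> a x = a y) -> kirchhoff g ->
  \sum_(x : endpoint G) a x * inward_deriv g x = 0.
Proof.
move=> cont K; pose n (x : endpoint G) : R := #|[pred y | glued x y]|%:R.
have nE x y : glued x y -> n x = n y.
  by move=> xy; rewrite /n; congr _%:R; apply: eq_card => z; rewrite !inE (gluedE xy).
have n0 x : n x != 0.
  by rewrite pnatr_eq0 -lt0n; apply/card_gt0P; exists x; rewrite inE glued_refl.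
transitivity (\sum_(y : endpoint G) \sum_(x | glued y x)
    a y * inward_deriv g y / n y).
  apply: eq_bigr => y _; rewrite sumr_const -[RHS]mulr_natr.
  set k := (X in _ = _ * X); have -> : k = n y.
    by rewrite /k /n; congr _%:R; apply: eq_card.
  by rewrite divfK.
rewrite (exchange_big_dep xpredT) //=; apply: big1 => x _.
transitivity (a x / n x * \sum_(y | glued x y) inward_deriv g y); last first.
  by rewrite K mulr0.
rewrite mulr_sumr; apply: eq_big => [y|y yx]; first exact: glued_sym.
by rewrite (cont _ _ yx) (nE _ _ yx); rewrite mulrAC.
Qed.

Lemma sum_endpoints (F : endpoint G -> R) :
  \sum_(x : endpoint G) F x = \sum_(e : edge G) (F (e, false) + F (e, true)).
Proof.
transitivity (\sum_(e : edge G) \sum_(b : bool) F (e, b)).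
  by rewrite pair_big /=; apply: eq_big => [[e b]|[e b] _].
by apply: eq_bigr => e _; rewrite big_bool addrC.
Qed.

Lemma inwardT (g : edge G -> R -> R) e : inward_deriv g (e, true) = - g e (len e).
Proof. by []. Qed.

Lemma inwardF (g : edge G -> R -> R) e : inward_deriv g (e, false) = g e 0.
Proof. by []. Qed.

(** Testing the eigenvalue equation against the eigenfunction shows that [m] is its
    quotient, against the constants that its mean is zero. *)
Lemma eigenvalue_rayleigh m : natural_eigenvalue G m -> m != 0 ->
  rayleigh true [set: edge G]%SET (@glued G) pred0 (@len R G) m.
Proof.
move=> [f [g [[fg cont] gm K f0]]] m0; have pos := nonzero_norm (conj fg cont) f0.
have l0 (e : edge G) : 0 <= len e := ltW (len_gt0 e).
pose a := end_value f.
pose E e := itg 0 (len e) (fun s => g e s ^+ 2).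
pose m1 e := itg 0 (len e) (f e).
pose m2 e := itg 0 (len e) (fun s => f e s ^+ 2).
have mean e : g e (len e) - g e 0 = - m * m1 e.
  have fL := H1_L2f (l0 e) (fg e).
  rewrite (H1_incr (gm e)) // /m1 -itgZ; last exact: L2_int.
  by apply: eq_itg => x _; lra.
have energy e : f e (len e) * g e (len e) - f e 0 * g e 0 = E e - m * m2 e.
  have [M fM] := H1_bounded (fg e); have fL := H1_L2f (l0 e) (fg e).
  have fM' x : 0 <= x <= len e -> `|- (m * f e x)| <= `|m| * M.
    by move=> /fM xM; rewrite normrN normrM ler_wpM2l.
  rewrite (H1_by_parts (l0 e) (fg e) (gm e) fM') /E /m2 -mulNr -itgZ; last exact: fL.2.
  by congr (_ + _); apply: eq_itg => x _; lra.
have mean0 : \sum_e m1 e = 0.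
  have := @kirchhoff_sum (fun=> 1) g (fun _ _ _ => erefl) K.
  rewrite sum_endpoints => H; apply: (mulfI m0); rewrite mulr0 mulr_sumr -[RHS]H.
  by apply: eq_bigr => e _; rewrite inwardT inwardF; have := mean e; lra.
have energy0 : \sum_e E e = m * \sum_e m2 e.
  have := @kirchhoff_sum a g cont K; rewrite sum_endpoints => H.
  apply/eqP; rewrite -subr_eq0 mulr_sumr -sumrB; apply/eqP.
  transitivity (- \sum_(e : edge G) (a (e, false) * inward_deriv g (e, false) +
     a (e, true) * inward_deriv g (e, true))); last by rewrite H oppr0.
  rewrite -sumrN; apply: eq_bigr => e _.
  rewrite inwardT inwardF /a end_valueF end_valueT; have := energy e; lra.
have all_edges F : \sum_(e in [set: edge G]%SET) F e = \sum_e F e :> R.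
  by apply: eq_bigl => e; rewrite inE.
rewrite all_edges in pos.
exists a, E, m1, m2; split.
- split => [e _|x y _ _|x] //; last exact: cont.
  by exists (f e), (g e); split => //; exact: fg.
- by rewrite /mass !all_edges mean0 expr0n mul0r subr0.
- rewrite /mass !all_edges mean0 expr0n mul0r subr0 energy0 mulfK //.
  by rewrite gt_eqF.
Qed.

End GraphSpectrum.

(** * Convergent subsequences *)
Section Subsequences.
Variable R : realType.

Lemma cvg_fsum (I : Type) (s : seq I) (P : pred I) (f : I -> nat -> R) (a : I -> R) :
  (forall i, P i -> f i n @[n --> \oo] --> a i) ->
  \sum_(i <- s | P i) f i n @[n --> \oo] --> \sum_(i <- s | P i) a i.
Proof.
move=> fa; elim: s => [|i s IH].
  by rewrite big_nil; under eq_fun do rewrite big_nil; exact: cvg_cst.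
rewrite big_cons; under eq_fun do rewrite big_cons.
by case: ifP => // Pi; apply: cvgD => //; exact: fa.
Qed.

Lemma seq_lim_unique (u : nat -> R) (a b : R) :
  u n @[n --> \oo] --> a -> u n @[n --> \oo] --> b -> a = b.
Proof. by move=> ua ub; rewrite -(norm_cvg_unique ua ub). Qed.

Lemma subseq_ge (phi : nat -> nat) : {homo phi : m n / (m < n)%N} ->
  forall n, (n <= phi n)%N.
Proof. by move=> h; elim=> // n IH; apply: leq_ltn_trans IH (h _ _ _). Qed.

Lemma cvg_subseq (phi : nat -> nat) (u : nat -> R) (v : R) :
  {homo phi : m n / (m < n)%N} -> u n @[n --> \oo] --> v ->
  u (phi n) @[n --> \oo] --> v.
Proof.
move=> h uv; apply: (@cvg_comp _ _ _ phi u _ \oo) uv.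
apply/cvgnyPge => A; near=> n.
by apply: leq_trans (subseq_ge h n); near: n; exact: nbhs_infty_ge.
Unshelve. all: by end_near. Qed.

Lemma bounded_subseq (I : finType) (u : nat -> I -> R) (B : R) :
  (forall n i, `|u n i| <= B) ->
  exists2 phi : nat -> nat, {homo phi : m n / (m < n)%N} &
  exists v : I -> R, forall i, u (phi n) i @[n --> \oo] --> v i.
Proof.
move=> uB; suff [phi hphi [v vP]] : exists2 phi : nat -> nat,
    {homo phi : m n / (m < n)%N} &
    exists v : I -> R, forall i, i \in enum I -> u (phi n) i @[n --> \oo] --> v i.
  by exists phi => //; exists v => i; apply: vP; rewrite mem_enum.
elim: (enum I) => [|i s [phi hphi [v vP]]]; first by exists id => //; exists (fun=> 0).
have [|psi ipsi /cvg_ex[/= x xP]] := @bolzano_weierstrass R (fun n => u (phi n) i).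
  exists B; split; first exact: num_real.
  by move=> M BM n _; apply: le_trans (uB _ _) (ltW BM).
have hpsi : {homo psi : m n / (m < n)%N} by move=> m n; rewrite !ltnNge (ipsi _ _ : (psi n <= psi m)%N = (n <= m)%N).
exists (phi \o psi); first by move=> m n mn; apply/hphi/hpsi.
exists (fun j => if j == i then x else v j) => j; rewrite inE.
case: eqP => [->//|_ /= js]; exact: (cvg_subseq hpsi (vP j js)).
Qed.

Lemma cvg_inv_succ (K : R) : K / n.+1%:R @[n --> \oo] --> (0 : R).
Proof.
rewrite -[X in _ --> X](mulr0 K); apply: cvgM; first exact: cvg_cst.
exact: cvg_harmonic.
Qed.

End Subsequences.

Lemma connected_linked (D : discrete_graph) : graph_connected D ->
  (exists e : edge D, True) /\ forall x y : endpoint D, connect (@linked D) x y.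
Proof.
rewrite /graph_connected => /eqP/cards1P[S SE]; split.
  have : S \in components D by rewrite SE inE.
  by case/imsetP => e _ _; exists e.
move=> x y.
have inS e : edge_component e = S.
  by have : edge_component e \in components D by [apply: imset_f]; rewrite SE inE => /eqP.
have : y.1 \in edge_component x.1.
  by rewrite inS -(inS y.1) inE connect0.
rewrite inE => xy.
have lk z b : connect (@linked D) z (z.1, b) /\ connect (@linked D) (z.1, b) z.
  by split; apply: connect1; rewrite /linked eqxx orbT.
exact: connect_trans (lk x false).1 (connect_trans xy (lk y false).2).
Qed.

(** * The infimum of the Rayleigh quotients is an eigenvalue *)
Section Eigenvalue.
Variables (R : realType) (G : metric_graph R).
Hypothesis G_connected : graph_connected G.

Notation Ray := (rayleigh true [set: edge G]%SET (@glued G) pred0 (@len R G)).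

Lemma setT_sum (F : edge G -> R) : \sum_(e in [set: edge G]%SET) F e = \sum_e F e.
Proof. by apply: eq_bigl => e; rewrite inE. Qed.

Lemma ray_has_inf : has_inf Ray.
Proof.
have [[e _] _] := connected_linked G_connected.
apply: rayleigh_has_inf => [i _|]; first exact: ltW (len_gt0 i).
by exists e; rewrite ?inE ?len_gt0.
Qed.

Lemma ray_inf_gt0 : 0 < inf Ray.
Proof.
have [[e _] conn] := connected_linked G_connected.
set L := \sum_(e in [set: edge G]%SET) len e.
have L0 : 0 < L.
  rewrite /L (bigD1 e) ?inE //= ltr_pwDl ?len_gt0 //.
  by apply: sumr_ge0 => i _; exact: ltW (len_gt0 i).
pose c := 2 * (#|{: endpoint G}|%:R ^+ 2 + 1) * L ^+ 2.
have c0 : 0 < c.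
  by rewrite mulr_gt0 ?exprn_gt0 // mulr_gt0 // ltr_wpDl ?sqr_ge0.
apply: (@lt_le_trans _ _ c^-1); first by rewrite invr_gt0.
apply: lb_le_inf; first exact: ray_has_inf.1.
move=> q rq; rewrite -[c^-1]mul1r ler_pdivrMr //.
apply: (rayleigh_lower_bound (x0 := (e, false))) rq => //.
all: first [by move=> i _; exact: ltW (len_gt0 i)|by rewrite !inE|by move=> *; rewrite !inE|by move=> x _; exact: conn].
Qed.

(** The edges are at most half as long as [1 / κ].  Hence the solutions of
    [w'' = - κ^2 w] are determined by their boundary values, and the form
    [int f'^2 - κ^2 int f^2] is positive on functions vanishing at both ends. *)
Section ShortEdges.
Let nu := inf Ray.
Let κ := Num.sqrt nu.
Hypothesis short : forall e : edge G, 4 * nu * len e ^+ 2 <= 1.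

Let nu0 : 0 < nu := ray_inf_gt0.
Let κ0 : 0 < κ. Proof. by rewrite sqrtr_gt0. Qed.
Let κ2 : κ ^+ 2 = nu. Proof. by rewrite sqr_sqrtr // ltW. Qed.

Let arg (e : edge G) : 0 < κ * len e < pi.
Proof.
have l0 := len_gt0 e; rewrite mulr_gt0 //=; apply: (@lt_le_trans _ _ 2); last exact: pi_ge2.
have : (κ * len e) ^+ 2 < 2 ^+ 2 by rewrite exprMn κ2; have := short e; lra.
by move: (κ * len e) => y y2; rewrite ltNge; apply/negP => y_ge; nra.
Qed.

Let sin_gt0 (e : edge G) : 0 < sin (κ * len e).
Proof. by apply: sin_gt0_pi; exact: arg. Qed.

Let S (e : edge G) := sin (κ * len e).
Let q (b : endpoint G -> R) (e : edge G) := twave_energy (len e) κ (b (e, false)) (b (e, true)).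
Let D0 (b : endpoint G -> R) (e : edge G) := tslope (len e) κ (b (e, false)) (b (e, true)) 0.
Let D1 (b : endpoint G -> R) (e : edge G) := tslope (len e) κ (b (e, false)) (b (e, true)) (len e).
(** For the trigonometric interpolation [w] of the vertex values [b], [form b] is
    [int w'^2 - nu int w^2] and [flux b] is [nu int w]. *)
Let flux (b : endpoint G -> R) := \sum_e (D0 b e - D1 b e).
Let form (b : endpoint G -> R) := \sum_e q b e.
Let cont (b : endpoint G -> R) := forall x y, glued x y -> b x = b y.

Let D0E b e : D0 b e = dslope (len e) κ * (b (e, true) - b (e, false) * cos (κ * len e)).
Proof. exact: tslope0. Qed.

Let D1E b e : D1 b e = dslope (len e) κ * (b (e, true) * cos (κ * len e) - b (e, false)).
Proof. exact: tslopel. Qed.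

Let qE b e : q b e = b (e, true) * D1 b e - b (e, false) * D0 b e.
Proof. by []. Qed.

Let fluxD b c t : flux (fun x => b x + t * c x) = flux b + t * flux c.
Proof.
rewrite /flux mulr_sumr -big_split /=; apply: eq_bigr => e _.
by rewrite !D0E !D1E; lra.
Qed.

(** The interpolation is a trial function with mean zero. *)
Let form_ge0 b : cont b -> flux b = 0 -> 0 <= form b.
Proof.
move=> cb fb0.
have /choice[E /choice[m1 /choice[m2 P]]] : forall e, exists E, exists m1, exists m2,
  [/\ profile (len e) (b (e, false)) (b (e, true)) E m1 m2, E - κ ^+ 2 * m2 = q b e &
      κ ^+ 2 * m1 = D0 b e - D1 b e].
  by move=> e; have [E [m1 [m2 H]]] := twave_profile (len_gt0 e) (sin_gt0 e)
    (b (e, false)) (b (e, true)); exists E, m1, m2.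
have m1_0 : \sum_e m1 e = 0.
  apply: (mulfI (lt0r_neq0 nu0)); rewrite mulr0 -κ2 mulr_sumr -[RHS]fb0.
  by apply: eq_bigr => e _; have [_ _ ->] := P e.
have -> : form b = \sum_e E e - nu * \sum_e m2 e.
  rewrite mulr_sumr -sumrB; apply: eq_bigr => e _.
  by have [_ <- _] := P e; rewrite κ2.
have E0 : 0 <= \sum_e E e.
  apply: sumr_ge0 => e _; have [pr _ _] := P e.
  by have [] := profile_bounds (ltW (len_gt0 e)) pr.
have [m0|m0] := leP (\sum_e m2 e) 0.
  by rewrite subr_ge0; apply: le_trans E0; rewrite pmulr_rle0.
rewrite subr_ge0 -ler_pdivlMr //; apply: (ge_inf ray_has_inf.2).
exists b, E, m1, m2; rewrite /mass !setT_sum m1_0 expr0n mul0r subr0; split => //.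
by split => [e _|x y _ _|] //; [have [] := P e|exact: cb].
Qed.

(** Hence adding a suitable constant makes the flux of any vertex values vanish. *)
Let one_flux : 0 < flux (fun=> 1).
Proof.
have [[e0 _] _] := connected_linked G_connected.
have pos e : 0 < D0 (fun=> 1) e - D1 (fun=> 1) e.
  rewrite D0E D1E; have d0 : 0 < dslope (len e) κ by rewrite mulr_gt0 ?invr_gt0.
  have c1 : cos (κ * len e) < 1.
    have := cos2Dsin2 (κ * len e); have : 0 < sin (κ * len e) ^+ 2 by rewrite exprn_gt0.
    nra.
  have := d0; set c := cos _ in c1 *; nra.
rewrite /flux (bigD1 e0) //= ltr_pwDl ?pos //.
by apply: sumr_ge0 => i _; exact: ltW.
Qed.

Let sqn (b : endpoint G -> R) := \sum_x b x ^+ 2.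

(** The vertex values of a nearly minimizing trial function, shifted so that
    the trigonometric interpolation has mean zero, nearly annihilate [form]. *)
Let almost_null : exists2 K, 0 <= K & forall n : nat, exists b,
  [/\ cont b, flux b = 0, sqn b = 1 & form b <= K / n.+1%:R].
Proof.
have nuP : 0 < nu := nu0.
pose K1 := \sum_e 4 * (S e)^-1 ^+ 2 * len e.
have K1e e : 0 <= 4 * (S e)^-1 ^+ 2 * len e.
  by rewrite mulr_ge0 ?(ltW (len_gt0 e)) // mulr_ge0 ?sqr_ge0.
have K10 : 0 <= K1 by exact: sumr_ge0.
exists (2 * K1) => [|n]; first by rewrite mulr_ge0.
pose eps := Num.min (nu / 4) n.+1%:R^-1.
have eps0 : 0 < eps by rewrite lt_min invr_gt0 ltr0n andbT; lra.
have epsn : eps <= n.+1%:R^-1 by rewrite ge_min lexx orbT.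
have epsnu : eps <= nu / 4 by rewrite ge_min lexx.
have [q0 [a [E [m1 [m2 [[prof ca _] V0 ->]]]]] EV] := inf_adherent eps0 ray_has_inf.
move: EV; set V := mass _ _ _ _ _ in V0 *; rewrite -/nu !setT_sum ltr_pdivrMr // => EV.
pose c := flux a / flux (fun=> 1).
pose b x := a x + - c * 1.
have cb : cont b by move=> x y xy; rewrite /b (ca x y) ?inE.
have fb : flux b = 0.
  by rewrite /b (fluxD a (fun=> 1)) /c mulNr divfK ?subrr // gt_eqF.
pose m2' e := m2 e + 2 * - c * m1 e + (- c) ^+ 2 * len e.
have l0 e : 0 <= len (e : edge G) := ltW (len_gt0 e).
have /choice[n2 P] : forall e, exists n2, [/\ 0 <= n2,
    q b e + nu * n2 <= E e - nu * m2' e &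
    m2' e <= 4 * (S e)^-1 ^+ 2 * (b (e, false) ^+ 2 + b (e, true) ^+ 2) * len e + 2 * n2].
  move=> e; have pr : profile (len e) (b (e, false)) (b (e, true)) (E e)
      (m1 e + - c * len e) (m2' e).
    by rewrite /b mulr1; exact: profile_shift (l0 e) (prof e (finset.in_setT e)).
  have [Eh [k1 [k2 [ph H1 _ H2]]]] := twave_split (len_gt0 e) (sin_gt0 e) pr.
  have [Eh0 k20 _ _ k2E] := profile_bounds (l0 e) ph.
  exists k2; split => //; rewrite -κ2 H1 lerD2l κ2.
  (* on a short edge at least half of the energy of the remainder is left *)
  have : nu * k2 <= nu * (2 * len e ^+ 2) * Eh.
    by rewrite -mulrA ler_wpM2l ?(ltW nu0) //; move: k2E; lra.
  have : nu * (2 * len e ^+ 2) * Eh <= 2^-1 * Eh by rewrite ler_wpM2r //; have := short e; lra.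
  lra.
have n2_0 : 0 <= \sum_e n2 e by apply: sumr_ge0 => e _; have [] := P e.
(* [V] is the least square norm among the translates of the trial function *)
have VE : V <= \sum_e m2' e.
  rewrite /m2' !big_split /= -!mulr_sumr /V /mass !setT_sum.
  set L := \sum_e len e; set S1 := \sum_e m1 e.
  have L0 : 0 < L.
    have [[e0 _] _] := connected_linked G_connected.
    rewrite /L (bigD1 e0) //= ltr_pwDl ?len_gt0 //.
    by apply: sumr_ge0 => i _.
  have iL : L * L^-1 = 1 by rewrite divff // gt_eqF.
  have : 0 <= (S1 - c * L) ^+ 2 * L^-1 by rewrite mulr_ge0 ?sqr_ge0 // invr_ge0 ltW.
  set i := L^-1 in iL *.
  rewrite (_ : (S1 - c * L) ^+ 2 * i =
    S1 ^+ 2 * i - 2 * c * S1 * (L * i) + c ^+ 2 * L * (L * i)); last lra.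
  rewrite iL; lra.
have J : form b + nu * \sum_e n2 e <= eps * V.
  apply: (@le_trans _ _ (\sum_e E e - nu * \sum_e m2' e)).
    by rewrite /form !mulr_sumr -big_split -sumrB; apply: ler_sum => e _; have [] := P e.
  have : nu * V <= nu * \sum_e m2' e by rewrite ler_wpM2l // ltW.
  rewrite mulrDl in EV; lra.
have fb0 := form_ge0 cb fb.
have V2 : \sum_e m2' e <= K1 * sqn b + 2 * \sum_e n2 e.
  rewrite [X in _ + X]mulr_sumr /K1 mulr_suml -big_split; apply: ler_sum => e _ /=.
  have [_ _ le] := P e; apply: (le_trans le); rewrite lerD2r mulrAC.
  apply: ler_wpM2l => //; rewrite /sqn sum_endpoints (bigD1 e) //= lerDl.
  by apply: sumr_ge0 => i _; rewrite addr_ge0 ?sqr_ge0.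
(* the remainders account for at most half of [V], hence the vertex values for the
   other half *)
have V3 : V <= 2 * K1 * sqn b.
  have : nu * \sum_e n2 e <= eps * V by lra.
  have : eps * V <= nu / 4 * V by rewrite ler_wpM2r // ltW.
  move=> le1 le2; have : nu * \sum_e n2 e <= nu * (V / 4) by lra.
  by rewrite ler_pM2l //; lra.
have sq0 : 0 < sqn b.
  rewrite lt_neqAle; apply/andP; split; last by apply: sumr_ge0 => x _; exact: sqr_ge0.
  by apply/negP => /eqP sb; move: V3; rewrite -sb mulr0 leNgt V0.
pose t := Num.sqrt (sqn b)^-1.
have t2 : t ^+ 2 = (sqn b)^-1 by rewrite sqr_sqrtr // invr_ge0 ltW.
exists (fun x => t * b x); split.
- by move=> x y xy; rewrite (cb x y).
- have := fluxD (fun=> 0) b t; rewrite fb mulr0 addr0.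
  rewrite (_ : flux (fun=> 0) = 0) => [<-|]; last first.
    by rewrite /flux big1 // => e _; rewrite D0E D1E; lra.
  by congr flux; apply/funext => x; rewrite add0r.
- rewrite /sqn; under eq_bigr do rewrite exprMn.
  by rewrite -mulr_sumr t2 mulVf // gt_eqF.
- have -> : form (fun x => t * b x) = form b / sqn b.
    rewrite -t2 mulrC /form mulr_sumr; apply: eq_bigr => e _.
    by rewrite !qE !D0E !D1E; lra.
  rewrite ler_pdivrMr //; apply: (@le_trans _ _ (eps * V)).
    have := mulr_ge0 (ltW nu0) n2_0; lra.
  apply: (@le_trans _ _ (n.+1%:R^-1 * V)); first by rewrite ler_wpM2r // ltW.
  rewrite [leRHS](_ : _ = n.+1%:R^-1 * (2 * K1 * sqn b)).
    by apply: ler_wpM2l V3; rewrite invr_ge0 ler0n.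
  by rewrite mulrAC mulrC.
Qed.

(** Compactness of the unit sphere of the space of vertex values. *)
Let null : exists v, [/\ cont v, flux v = 0, sqn v = 1 & form v <= 0].
Proof.
have [K K0 /choice[b bP]] := almost_null.
have [|phi hphi [v vP]] := @bounded_subseq R _ b 1.
  move=> n x; have [_ _ s1 _] := bP n.
  rewrite -(@ler_pXn2r _ 2) ?nnegrE // real_normK ?num_real // expr1n -s1.
  by rewrite /sqn (bigD1 x) //= lerDl; apply: sumr_ge0 => y _; exact: sqr_ge0.
pose c n := b (phi n).
have D0c e : D0 (c n) e @[n --> \oo] --> D0 v e.
  rewrite D0E; under eq_fun do rewrite D0E.
  apply: cvgM; first exact: cvg_cst.
  by apply: cvgB; [exact: vP|apply: cvgM; [exact: vP|exact: cvg_cst]].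
have D1c e : D1 (c n) e @[n --> \oo] --> D1 v e.
  rewrite D1E; under eq_fun do rewrite D1E.
  apply: cvgM; first exact: cvg_cst.
  by apply: cvgB; [apply: cvgM; [exact: vP|exact: cvg_cst]|exact: vP].
have qc e : q (c n) e @[n --> \oo] --> q v e.
  rewrite qE; under eq_fun do rewrite qE.
  by apply: cvgB; apply: cvgM => //; exact: vP.
exists v; split.
- move=> x y xy; apply: (@seq_lim_unique _ (fun n => c n x)); [exact: vP|].
  rewrite (_ : (fun n => c n x) = (fun n => c n y)); first exact: vP.
  by apply/funext => n; have [cb _ _ _] := bP (phi n); exact: cb.
- apply: (@seq_lim_unique _ (fun n => flux (c n))).
    by apply: cvg_fsum => e _; exact: cvgB.
  rewrite (_ : (fun n => flux (c n)) = (fun=> 0)); first exact: cvg_cst.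
  by apply/funext => n; have [_ -> _ _] := bP (phi n).
- apply: (@seq_lim_unique _ (fun n => sqn (c n))).
    apply: cvg_fsum => x _; rewrite expr2; under eq_fun do rewrite expr2.
    by apply: cvgM; exact: vP.
  rewrite (_ : (fun n => sqn (c n)) = (fun=> 1)); first exact: cvg_cst.
  by apply/funext => n; have [_ _ -> _] := bP (phi n).
- have fc : form (c n) @[n --> \oo] --> form v by apply: cvg_fsum => e _; exact: qc.
  apply: (ler_cvg_to fc (cvg_subseq hphi (cvg_inv_succ K))).
  by apply: nearW => n; have [_ _ _] := bP (phi n).
Qed.

Let bilin (b y : endpoint G -> R) :=
  \sum_e (y (e, true) * D1 b e - y (e, false) * D0 b e).

(** A null vector of the nonnegative form is critical, also in the direction of
    the constants. *)
Let null_critical v y : cont v -> flux v = 0 -> form v <= 0 -> cont y -> bilin v y = 0.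
Proof.
move=> cv fv v0 cy; pose s := flux y / flux (fun=> 1).
pose z x := y x + - s * 1.
have cz : cont z by move=> a b ab; rewrite /z (cy a b).
have fz : flux z = 0.
  by rewrite /z (fluxD y (fun=> 1)) /s mulNr divfK ?subrr // gt_eqF.
have -> : bilin v y = bilin v z.
  have : bilin v z = bilin v y + s * flux v.
    rewrite /bilin /flux mulr_sumr -big_split; apply: eq_bigr => e _ /=.
    by rewrite /z; lra.
  by rewrite fv mulr0 addr0.
have expand t : form (fun x => v x + t * z x) = form v + 2 * t * bilin v z + t ^+ 2 * form z.
  rewrite /form /bilin !mulr_sumr -!big_split; apply: eq_bigr => e _ /=.
  by rewrite !qE !D0E !D1E; lra.
have pos t : 0 <= 2 * t * bilin v z + t ^+ 2 * form z.
  have : 0 <= form (fun x => v x + t * z x).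
    apply: form_ge0; first by move=> a b ab; rewrite (cv a b) // (cz a b).
    by rewrite fluxD fv fz mulr0 addr0.
  rewrite expand; lra.
have f0 : 0 <= form z by exact: form_ge0.
apply/eqP/negPn/negP => B0.
(* otherwise the polynomial [2 * t * bilin v z + t ^ 2 * form z] would be negative
   for this [t] *)
pose t := - bilin v z / (form z + 1).
have := pos t; rewrite /t; set B := bilin v z in B0 *; set F := form z in f0 *.
have F1 : 0 < F + 1 by lra.
have iF : (F + 1) * (F + 1)^-1 = 1 by rewrite divff // gt_eqF.
have i0 : 0 < (F + 1)^-1 by rewrite invr_gt0.
set i := (F + 1)^-1 in iF i0 *.
have B2 : 0 < B ^+ 2 by rewrite exprn_even_gt0.
have -> : 2 * (- B * i) * B + (- B * i) ^+ 2 * F = - (B ^+ 2 * i) * (2 - F * i) by lra.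
have Fi : F * i <= 1 by rewrite -iF ler_wpM2r ?(ltW i0) //; lra.
have := mulr_gt0 B2 i0; nra.
Qed.

(** The Kirchhoff condition at [x] is criticality in the direction of the indicator
    function of the vertex of [x]. *)
Lemma short_eigenvalue : natural_eigenvalue G (inf Ray).
Proof.
have [v [cv fv sv v0]] := null.
pose f e := twave (len e) κ (v (e, false)) (v (e, true)).
pose g e := tslope (len e) κ (v (e, false)) (v (e, true)).
exists f, g; split.
- split; first by move=> e; exact: twave_H1.
  have fE x : end_value f x = v x.
    by case: x => e []; rewrite ?end_valueT ?end_valueF /f ?twavel ?twave0.
  by move=> x y xy; rewrite !fE (cv x y).
- by move=> e; rewrite -/nu -κ2; exact: tslope_H1.
- move=> x; pose y z : R := (glued x z)%:R.
  have cy : cont y by move=> a b ab; rewrite /y !(glued_sym x) (gluedE ab).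
  transitivity (- bilin v y); last by rewrite (null_critical cv fv v0 cy) oppr0.
  rewrite /bilin -sumrN big_mkcond sum_endpoints; apply: eq_bigr => e _.
  rewrite inwardT inwardF (erefl : g e 0 = D0 v e) (erefl : g e (len e) = D1 v e) /y.
  by case: (glued x (e, false)); case: (glued x (e, true)) => /=; lra.
- apply: contrapT => nz; move: sv; rewrite /sqn big1; first by lra.
  move=> [e b] _; apply/eqP; rewrite sqrf_eq0; apply/negP => /negP vx; apply: nz.
  exists e, (end_coord (e, b)); have l0 := len_gt0 e.
  case: b vx => vx; rewrite /end_coord /= /f ?twavel ?twave0 //.
    by rewrite lexx ltW.
  by rewrite lexx ltW.
Qed.

End ShortEdges.
End Eigenvalue.

(** * Connected components *)
Section Connectivity.

Lemma connect_map (T T' : finType) (r : rel T) (r' : rel T') (f : T -> T') :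
  (forall x y, r x y -> connect r' (f x) (f y)) ->
  forall x y, connect r x y -> connect r' (f x) (f y).
Proof.
move=> h x y /connectP[p pth ->]; elim: p x pth => [|z p IH] x /=; first by rewrite connect0.
by move=> /andP[/h xz /IH]; exact: connect_trans.
Qed.

Lemma linked_csym (D : discrete_graph) : connect_sym (@linked D).
Proof.
apply: sym_connect_sym => x y; rewrite /linked eq_sym; congr orb.
have E u v : glued u v -> @glued D v u.
  move=> uv; have [_ H] := glued_equiv u v u.
  by rewrite -(H uv); have [] := glued_equiv u u u.
by apply/idP/idP; exact: E.
Qed.

Definition same_component (D : discrete_graph) (e e' : edge D) : bool :=
  connect (@linked D) (e, false) (e', false).

Lemma same_componentE (D : discrete_graph) (x y : endpoint D) :
  connect (@linked D) x y = same_component x.1 y.1.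
Proof.
have lk (z : endpoint D) b : connect (@linked D) z (z.1, b).
  by apply: connect1; rewrite /linked eqxx orbT.
rewrite /same_component; apply/idP/idP => xy.
  apply: connect_trans (connect_trans xy (lk y false)).
  by rewrite linked_csym lk.
apply: connect_trans (lk x false) (connect_trans xy _).
by rewrite linked_csym lk.
Qed.

Lemma mem_edge_component (D : discrete_graph) (e e' : edge D) :
  (e' \in edge_component e) = same_component e e'.
Proof. by rewrite inE. Qed.

Lemma same_component_refl (D : discrete_graph) (e : edge D) : same_component e e.
Proof. exact: connect0. Qed.

Lemma same_component_sym (D : discrete_graph) (e e' : edge D) :
  same_component e e' = same_component e' e.
Proof. exact: linked_csym. Qed.

Lemma same_component_trans (D : discrete_graph) : transitive (@same_component D).
Proof. by move=> e2 e1 e3; exact: connect_trans. Qed.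

Lemma eq_edge_component (D : discrete_graph) (e e' : edge D) :
  (edge_component e == edge_component e') = same_component e e'.
Proof.
apply/eqP/idP => [E|ee'].
  by rewrite -mem_edge_component E mem_edge_component same_component_refl.
apply/setP => f; rewrite !mem_edge_component; apply/idP/idP.
  by apply: same_component_trans; rewrite same_component_sym.
exact: same_component_trans.
Qed.

Lemma component_mem (D : discrete_graph) (C : {set edge D}) (e : edge D) :
  C \in components D -> e \in C -> C = edge_component e.
Proof.
move=> /imsetP[e0 _ ->]; rewrite mem_edge_component => ee0.
by apply/eqP; rewrite eq_edge_component.
Qed.

Lemma component_closed (D : discrete_graph) (C : {set edge D}) (e e' : edge D) :
  C \in components D -> e \in C -> (e' \in C) = same_component e e'.
Proof. by move=> CC eC; rewrite (component_mem CC eC) mem_edge_component. Qed.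

Lemma component_nonempty (D : discrete_graph) (C : {set edge D}) :
  C \in components D -> exists e, e \in C.
Proof.
by move=> /imsetP[e _ ->]; exists e; rewrite mem_edge_component same_component_refl.
Qed.

Lemma edge_component_mem (D : discrete_graph) (e : edge D) :
  edge_component e \in components D.
Proof. exact: imset_f. Qed.

Lemma connected_of_linked (D : discrete_graph) (e0 : edge D) :
  (forall e, same_component e0 e) -> graph_connected D.
Proof.
move=> conn; rewrite /graph_connected; apply/eqP/cards1P; exists (edge_component e0).
apply/setP => C; rewrite inE; apply/imsetP/eqP => [[e _ ->]|->]; last by exists e0.
by apply/eqP; rewrite eq_edge_component same_component_sym.
Qed.

(** A map of edges which preserves and reflects connectedness and reaches every
    component induces a bijection of the components. *)
Section ComponentBijection.
Variables (D D' : discrete_graph) (phi : edge D -> edge D').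
Hypothesis phi_conn : forall e f, same_component e f = same_component (phi e) (phi f).
Hypothesis phi_hits : forall e', exists e, same_component (phi e) e'.

Lemma preim_component e : phi @^-1: (edge_component (phi e)) = edge_component e.
Proof. by apply/setP => f; rewrite inE !mem_edge_component phi_conn. Qed.

Lemma components_preim : components D = [set phi @^-1: C | C : {set edge D'} in components D']%SET.
Proof.
apply/setP => C; apply/imsetP/imsetP => [[e _ ->]|[_ /imsetP[e' _ ->] ->]].
  by exists (edge_component (phi e)); rewrite ?edge_component_mem ?preim_component.
have [e ee'] := phi_hits e'; exists e => //; rewrite -preim_component.
have -> // : edge_component e' = edge_component (phi e).
by apply/eqP; rewrite eq_edge_component same_component_sym.
Qed.

Lemma preim_component_inj :
  {in components D' &, injective (fun C : {set edge D'} => phi @^-1: C)}.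
Proof.
move=> _ _ /imsetP[e' _ ->] /imsetP[f' _ ->].
have [e ee'] := phi_hits e'; have [f ff'] := phi_hits f'.
have -> : edge_component e' = edge_component (phi e).
  by apply/eqP; rewrite eq_edge_component same_component_sym.
have -> : edge_component f' = edge_component (phi f).
  by apply/eqP; rewrite eq_edge_component same_component_sym.
rewrite !preim_component => /eqP; rewrite eq_edge_component => ef.
by apply/eqP; rewrite eq_edge_component -phi_conn.
Qed.

Lemma card_components : #|components D| = #|components D'|.
Proof. by rewrite components_preim card_in_imset //; exact: preim_component_inj. Qed.

Lemma connected_iff : graph_connected D <-> graph_connected D'.
Proof. by rewrite /graph_connected card_components. Qed.

End ComponentBijection.

Section DummyConnectivity.
Variables (D : discrete_graph) (e : edge D).
Let D1 := DiscreteGraph (dummy_rel_equiv e (@glued_equiv D)).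

Lemma dummy_linked : connect (@linked D1) (lift ord_max e, true) (ord_max, false).
Proof.
apply: connect1; rewrite /linked /= /dummy_rel.
have /eqP -> : old_end e (lift ord_max e, true) == None by rewrite old_end_None eqxx.
by have /eqP -> : old_end e (ord_max, false) == None by rewrite old_end_None eqxx orbT.
Qed.

Lemma dummy_same_component (z w : edge D1) :
  same_component z w = same_component (D := D) (old_edge e z) (old_edge e w).
Proof.
have lk (D' : discrete_graph) (x : endpoint D') b : connect (@linked D') x (x.1, b).
  by apply: connect1; rewrite /linked eqxx orbT.
apply/idP/idP => [|zw].
  apply: (@connect_map _ _ (@linked D1) (@linked D) (fun z => (old_edge e z.1, false))).
  move=> x y /orP[|/eqP ->]; last exact: connect0.
  rewrite /= /dummy_rel; case xE : (old_end e x) => [x'|]; case yE : (old_end e y) => [y'|] //.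
    move=> xy; rewrite (old_endK xE) (old_endK yE) !old_edge_new_end.
    rewrite -/(same_component (D := D) x'.1 y'.1) -same_componentE.
    by apply: connect1; rewrite /linked xy.
  have E u : old_end e u = None -> old_edge e u.1 = e.
    move=> /eqP; rewrite old_end_None => /orP[] /eqP -> /=;
    by rewrite ?old_edge_lift ?old_edge_max.
  by rewrite (E _ xE) (E _ yE) connect0.
have ends : connect (@linked D1) (new_end e (e, false)) (new_end e (e, true)).
  rewrite /new_end /= eqxx /=; apply: connect_trans (lk D1 _ true) _.
  exact: connect_trans dummy_linked (lk D1 _ true).
have emb x y : connect (@linked D) x y -> connect (@linked D1) (new_end e x) (new_end e y).
  apply: connect_map => {}x {}y /orP[xy|/eqP xy].
    by apply: connect1; rewrite /linked /= dummy_rel_new xy.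
  case: (eqVneq x.1 e) => [xe|xe]; last first.
    rewrite /new_end -xy (negbTE xe) /=; exact: lk D1 (_, _) _.
  have sdne : connect (@linked D1) (new_end e (e, true)) (new_end e (e, false)).
    by rewrite linked_csym; exact: ends.
  case: x y xy xe => x [] [y []] /= <- -> //; exact: connect0.
have up u : connect (@linked D1) (new_end e (old_edge e u, false)) (u, false).
  rewrite /new_end andbF /=; case: (unliftP ord_max u) => [i ->|->].
    by rewrite old_edge_lift.
  rewrite old_edge_max; apply: connect_trans (lk D1 _ true) _; exact: dummy_linked.
apply: connect_trans (connect_trans (emb _ _ zw) (up w)).
by rewrite linked_csym; exact: up.
Qed.

Lemma dummy_hits (i : edge D) : exists z : edge D1, same_component (old_edge e z) i.
Proof. by exists (lift ord_max i); rewrite old_edge_lift same_component_refl. Qed.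

End DummyConnectivity.

End Connectivity.

(** * The energies of clusters as infima *)
Section Mu2.
Variable R : realType.

Lemma add_dummy_connected (G : metric_graph R) (e : edge G) t (ht : 0 < t < len e) :
  graph_connected G -> graph_connected (add_dummy ht).
Proof.
exact: (proj2 (connected_iff (@dummy_same_component G e) (@dummy_hits G e))).
Qed.

Lemma H1_eq (l : R) (f f' g g' : R -> R) : (forall s, f s = f' s) ->
  (forall s, g s = g' s) -> H1_deriv l f g -> H1_deriv l f' g'.
Proof. by move=> /funext -> /funext ->. Qed.

Lemma natural_eigenvalue_dummy (G : metric_graph R) (e : edge G) t
    (ht : 0 < t < len e) m :
  natural_eigenvalue (add_dummy ht) m -> natural_eigenvalue G m.
Proof.
case/andP: (ht) => t0 tl.
move=> [f [g [[fg cont] gm K nz]]].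
pose cat h (i : edge G) s : R := if i == e then
  (if s <= t then h (lift ord_max e) s else h ord_max (s - t)) else h (lift ord_max i) s.
have lenL i : len (lift ord_max i : edge (add_dummy ht)) = if i == e then t else len i.
  exact: dummy_len_lift.
have lenM : len (ord_max : edge (add_dummy ht)) = len e - t by exact: dummy_len_max.
have ltE : len e = t + (len e - t) by rewrite addrC subrK.
have d0 : 0 <= len e - t by rewrite subr_ge0 ltW.
have dummy_glued : glued ((lift ord_max e, true) : endpoint (add_dummy ht)) (ord_max, false).
  rewrite /= /dummy_rel.
  have /eqP -> : old_end e (lift ord_max e, true) == None by rewrite old_end_None eqxx.
  by have /eqP -> : old_end e (ord_max, false) == None by rewrite old_end_None eqxx orbT.
have jump_f : f (lift ord_max e) t = f ord_max 0.
  have := cont _ _ dummy_glued; rewrite end_valueT end_valueF.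
  by rewrite lenL eqxx.
have jump_g : g (lift ord_max e) t = g ord_max 0.
  have := K (ord_max, false).
  rewrite (eq_bigl (fun z => (z == (ord_max, false)) || (z == (lift ord_max e, true)))).
    rewrite (bigD1 (ord_max, false)) ?eqxx //= (big_pred1 (lift ord_max e, true)).
      by rewrite inwardT inwardF lenL eqxx; lra.
    move=> z /=; case: (eqVneq z (ord_max, false)) => [->|_] /=.
      by rewrite xpair_eqE andbF.
    by rewrite andbT.
  move=> z /=; rewrite /dummy_rel.
  have /eqP -> : old_end e (ord_max, false) == None by rewrite old_end_None eqxx orbT.
  by rewrite orbC -old_end_None; case: (old_end e z).
have catE h : h (lift ord_max e) t = h ord_max 0 ->
    forall x, end_value (G := G) (cat h) x = end_value (G := add_dummy ht) h (new_end e x).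
  move=> jump [i b]; rewrite /new_end /= /cat; case: b => /=.
    rewrite andbT end_valueT; case: eqP => [->|/eqP ie].
      by rewrite end_valueT lenM leNgt tl.
    by rewrite end_valueT lenL (negbTE ie).
  rewrite andbF end_valueF end_valueF; case: eqP => [->|//].
  by rewrite (ltW t0).
exists (cat f), (cat g); split.
- split=> [i|x y xy]; last first.
    by rewrite !catE //; apply: cont; rewrite /= dummy_rel_new.
  rewrite /cat; case: eqP => [->|/eqP ie].
    rewrite ltE; apply: H1_cat => //; first exact: ltW.
      by have := fg (lift ord_max e); rewrite lenL eqxx.
    by have := fg ord_max; rewrite lenM.
  by have := fg (lift ord_max i); rewrite lenL (negbTE ie).
- move=> i; rewrite /cat; case: eqP => [->|/eqP ie].
    have p1 := gm (lift ord_max e); rewrite lenL eqxx in p1.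
    have p2 := gm ord_max; rewrite lenM in p2.
    rewrite ltE; apply: H1_eq (H1_cat (ltW t0) d0 p1 p2 jump_g) => // s.
    by case: ifP.
  by have := gm (lift ord_max i); rewrite lenL (negbTE ie).
- move=> x; rewrite -[RHS](K (new_end e x)) (@sum_new_end _ e).
    apply: eq_big => [y|y _]; first by rewrite /= dummy_rel_new.
    have := catE g jump_g y; rewrite /inward_deriv => ->.
    by rewrite /new_end; case: y => i [] /=; rewrite ?andbT ?andbF //; case: ifP.
  by move=> z zE; rewrite /= /dummy_rel new_endK zE.
- have [z [s [/andP[s0 sl] fs]]] := nz.
  case: (unliftP ord_max z) sl fs => [i ->|->].
    rewrite lenL => sl fs; exists i, s; rewrite s0 /cat; case: eqP sl fs => [->|_] // st fs.
      by rewrite (le_trans st (ltW tl)) st.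
  rewrite lenM => sl fs; exists e, (s + t); rewrite /cat eqxx.
  rewrite addr_ge0 ?(ltW t0) //= -lerBrDr sl; split => //.
  case: leP => [st|_]; last by rewrite addrK.
  have s_eq0 : s = 0 by apply/eqP; rewrite eq_le s0 -(lerD2r t) add0r st.
  by move: fs; rewrite s_eq0 add0r jump_f.
Qed.

Lemma rayleigh_add_dummy th (G : metric_graph R) (e : edge G) t (ht : 0 < t < len e) :
  rayleigh th [set: edge (add_dummy ht)]%SET (@glued (add_dummy ht)) pred0 (@len R _) =
  rayleigh th [set: edge G]%SET (@glued G) pred0 (@len R G).
Proof.
case/andP: (ht) => t0 tl.
rewrite -(@rayleigh_dummy _ th _ e _ (@glued G) pred0 pred0 (@len R G) t).
- by congr rayleigh; apply/setP => z; rewrite !inE.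
- by rewrite !ltW.
- by move=> z; case: (old_end e z).
Qed.

(** Dummy vertices make the edges short without changing the Rayleigh quotients;
    an eigenfunction of the subdivided graph is one of the graph. *)
Lemma inf_rayleigh_eigenvalue (G : metric_graph R) : graph_connected G ->
  natural_eigenvalue G (inf (rayleigh true [set: edge G]%SET (@glued G) pred0 (@len R G))).
Proof.
move=> cG; set nu := inf _; have nu0 : 0 < nu := ray_inf_gt0 cG.
pose h := (2 * Num.sqrt nu)^-1.
have sq0 : 0 < Num.sqrt nu by rewrite sqrtr_gt0.
have h0 : 0 < h by rewrite invr_gt0 mulr_gt0.
have h2 : 4 * nu * h ^+ 2 = 1.
  rewrite -[nu](sqr_sqrtr (ltW nu0)) /h.
  have : (2 * Num.sqrt nu) * (2 * Num.sqrt nu)^-1 = 1 by rewrite divff // gt_eqF // mulr_gt0.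
  set i := (_)^-1 => E; transitivity (((2 * Num.sqrt nu) * i) ^+ 2); first lra.
  by rewrite E expr1n.
(* [k e] bounds the number of pieces of length [h] that can be cut off [e] *)
pose k (e : edge G) := Num.bound (len e / h).
have kP e : len e <= (k e).+1%:R * h.
  rewrite -ler_pdivrMr //; apply: le_trans (ltW (archi_boundP _)) _.
    by rewrite divr_ge0 ?(ltW (len_gt0 e)) // ltW.
  by rewrite ler_nat.
have : nu = inf (rayleigh true [set: edge G]%SET (@glued G) pred0 (@len R G)) by [].
have [N leN] := ubnP (\sum_e k e).
move: {nu0 sq0 h0} nu h h0 h2 k kP leN => nu h h0 h2.
elim: N G cG => // N IH G cG k kP; rewrite ltnS => leN nuE.
case: (boolP [forall e : edge G, len e <= h]) => [/forallP short|].
  rewrite nuE; apply: short_eigenvalue => // e; rewrite -nuE -[leRHS]h2.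
  have nu0 : 0 < nu by rewrite nuE; exact: ray_inf_gt0.
  rewrite ler_wpM2l ?mulr_ge0 ?(ltW nu0) //.
  by rewrite lerXn2r ?nnegrE ?(ltW h0) ?short // ltW // len_gt0.
rewrite negb_forall => /existsP[e]; rewrite -ltNge => he.
have ht : 0 < h < len e by rewrite h0.
apply: (@natural_eigenvalue_dummy G e h ht).
have ke : (0 < k e)%N.
  rewrite lt0n; apply/eqP => k0; have := kP e.
  by rewrite k0 mul1r leNgt he.
pose k' (z : edge (add_dummy ht)) : nat :=
  if unlift ord_max z is Some i then (if i == e then 0 else k i)%N else (k e).-1.
apply: (IH _ (add_dummy_connected ht cG) k').
- move=> z; rewrite /len /= /k' /dummy_len; case: (unlift _ _) => [i|].
    by case: ifP => _; rewrite ?mul1r.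
  rewrite prednK // lerBlDr.
  by have := kP e; rewrite -natr1 mulrDl mul1r.
- apply: leq_trans leN.
  have -> : (\sum_z k' z =
      \sum_i (k' (lift ord_max i) + if i == e then k' ord_max else 0))%N.
    exact: (sum_dummy e predT k').
  rewrite [ltnRHS](bigD1 e) //= [ltnLHS](bigD1 e) //=.
  rewrite /k' liftK unlift_none !eqxx add0n.
  rewrite (eq_bigr k); first by rewrite ltn_add2r prednK.
  by move=> i /negbTE ie; rewrite ie addn0 liftK ie.
- by rewrite rayleigh_add_dummy.
Qed.

(** Each nonzero eigenvalue is a Rayleigh quotient, and the infimum is an
    eigenvalue. *)
Lemma mu2E (G : metric_graph R) : graph_connected G ->
  mu2 G = inf (rayleigh true [set: edge G]%SET (@glued G) pred0 (@len R G)).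
Proof.
move=> cG; rewrite /mu2; set S := [set m | _]; set T := rayleigh _ _ _ _ _.
have TS : S (inf T).
  split; first exact: inf_rayleigh_eigenvalue.
  by rewrite gt_eqF //; exact: ray_inf_gt0.
have ST : S `<=` T by move=> m [nm m0]; exact: eigenvalue_rayleigh.
have lbT := (ray_has_inf cG).2.
apply/eqP; rewrite eq_le; apply/andP; split.
  by apply: ge_inf => //; have [b bT] := lbT; exists b => m /ST; exact: bT.
by apply: lb_le_inf; [exists (inf T)|move=> m /ST mT; exact: ge_inf].
Qed.

Section ClusterEnergies.
Variables (P : gpartition R) (C : {set edge P}).
Hypothesis CC : C \in clusters P.

Lemma rayleigh_cluster th (VD : pred (endpoint P)) :
  rayleigh th [set: edge (Defs.cluster C)]%SET (@glued (Defs.cluster C))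
    (fun x => VD (subgraph_end (G := cut_graph P) x)) (@len R (Defs.cluster C)) =
  rayleigh th C (@cut P) VD (@pt_len R P).
Proof.
have [e0 e0C] := component_nonempty (D := cut_discrete P) CC.
have relabelE (x : endpoint (Defs.cluster C)) :
    relabel (fun i => enum_val i) (fun=> false) x = subgraph_end (G := cut_graph P) x.
  by case: x => i b; rewrite /relabel /subgraph_end /= addbF.
pose rk (i : edge P) : edge (Defs.cluster C) := enum_rank_in e0C i.
have rkK i : i \in C -> enum_val (rk i) = i by exact: enum_rankK_in.
have rkE (x : endpoint P) : x.1 \in C ->
    subgraph_end (G := cut_graph P) (relabel rk (fun=> false) x : endpoint (Defs.cluster C)) = x.
  by case: x => i b iC; rewrite /relabel /subgraph_end /= addbF rkK.
apply/seteqP; split.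
- apply: (rayleigh_pullback (phi := rk) (flip := fun=> false)).
  + by move=> i j iC jC /(congr1 (@enum_val _ (mem C))); rewrite !rkK.
  + apply/setP => i; rewrite inE; apply/imsetP; exists (enum_val i); first exact: enum_valP.
    by rewrite /rk enum_valK_in.
  + by move=> i _; exact: ltW (len_gt0 _).
  + by move=> i iC; rewrite /len /= rkK.
  + by move=> x y xC yC; rewrite /= /subgraph_glued !rkE.
  + by move=> x xC; rewrite rkE.
- apply: (rayleigh_pullback (phi := fun i : edge (Defs.cluster C) => enum_val i)
    (flip := fun=> false)).
  + by move=> i j _ _; exact: enum_val_inj.
  + apply/setP => i; apply/imsetP/idP => [[j _ ->]|iC]; first exact: enum_valP.
    by exists (rk i); rewrite ?inE ?rkK.
  + by move=> i _; exact: ltW (pt_len_gt0 _).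
  + by [].
  + by move=> x y _ _; rewrite !relabelE.
  + by move=> x _; rewrite relabelE.
Qed.

Lemma cluster_connected : graph_connected (Defs.cluster C).
Proof.
have [e0 e0C] := component_nonempty (D := cut_discrete P) CC.
pose rk (i : edge P) : edge (Defs.cluster C) := enum_rank_in e0C i.
have rkK i : i \in C -> enum_val (rk i) = i by exact: enum_rankK_in.
apply: (@connected_of_linked _ (rk e0)) => i.
have iC := enum_valP i.
have : connect (@linked (cut_discrete P)) (e0, false) (enum_val i, false).
  by have := iC; rewrite (component_closed (D := cut_discrete P) _ CC e0C).
move=> /connectP[p pth E].
suff : forall x, x.1 \in C -> path (@linked (cut_discrete P)) x p ->
    connect (@linked (Defs.cluster C)) (rk x.1, x.2) (rk (last x p).1, (last x p).2).
  move=> /(_ (e0, false) e0C pth); rewrite -E /= /rk enum_valK_in.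
  by [].
elim: p {pth E} => [|y p IH] x xC /=; first by rewrite connect0.
move=> /andP[xy pth].
have yC : y.1 \in C.
  rewrite (component_closed (D := cut_discrete P) _ CC xC) -same_componentE; exact: connect1.
apply: connect_trans (IH y yC pth); apply: connect1; move: xy; rewrite /linked.
move=> /orP[xy|/eqP xy]; apply/orP; [left|right]; last by rewrite /= xy.
by rewrite /= /subgraph_glued /subgraph_end /= !rkK //; case: (x) (y) xy => ? ? [].
Qed.

Lemma cluster_mu2 :
  mu2 (Defs.cluster C) = inf (rayleigh true C (@cut P) pred0 (@pt_len R P)).
Proof. by rewrite mu2E; [rewrite -rayleigh_cluster|exact: cluster_connected]. Qed.

Lemma cluster_lambda1 : lambda1 (@dirichlet_vertices R P C) =
  inf (rayleigh false C (@cut P) (@nontriv_cut P) (@pt_len R P)).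
Proof. by rewrite lambda1E -rayleigh_cluster. Qed.

End ClusterEnergies.
End Mu2.

(** * Continuity in the edge lengths *)
Section LimitOfLengths.
Variable R : realType.
Notation itg a b f := (\int[@lebesgue_measure R]_(u in `[a, b]) f u).

Lemma profile_smul (l a b E m1 m2 t : R) : 0 <= l -> profile l a b E m1 m2 ->
  profile l (t * a) (t * b) (t ^+ 2 * E) (t * m1) (t ^+ 2 * m2).
Proof.
move=> l0 [f [g [fg [fa fb] EE mE1 mE2]]].
have fL := H1_L2f l0 fg; have gL := H1_L2 fg.
exists (fun x => 0 + t * f x), (fun x => 0 + t * g x); split.
- exact: H1_lin (H1_cst l 0) fg.
- by rewrite fa fb !add0r.
- by rewrite EE -(itgZ _ gL.2); apply: eq_itg => x _; lra.
- rewrite mE1 -itgZ; last exact: L2_int.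
  by apply: eq_itg => x _; lra.
- by rewrite mE2 -(itgZ _ fL.2); apply: eq_itg => x _; lra.
Qed.

Lemma profile_end_bound (l a b E m1 m2 : R) : 0 < l -> profile l a b E m1 m2 ->
  a ^+ 2 <= 4 * l * E + 2 * (m2 / l).
Proof.
move=> l0 pr; have l0' := ltW l0.
have [E0 m20 _ m12 _] := profile_bounds l0' pr.
have [_ _ _ _] := profile_bounds l0' (profile_shift (- a) l0' pr).
rewrite subrr expr0n add0r => le.
rewrite -(ler_pM2l l0) [leRHS](_ : _ = 4 * l * (l * E) + 2 * (m2 / l * l)); last lra.
rewrite divfK ?gt_eqF //.
suff : 2 * (a * m1) <= a ^+ 2 * l / 2 + 2 * m2 by lra.
rewrite -(ler_pM2l l0).
have := sqr_ge0 (a * l - 2 * m1); lra.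
Qed.

(** The errors on a surviving edge, the length of which changes from [u] to [l] by at
    most [s ^ 2] and the end values by at most [D * s]. *)
Section Transplant.
Variables (l u s K Lam c0 B D : R).
Hypotheses (s0 : 0 <= s) (s1 : s <= 1) (c00 : 0 <= c0) (B0 : 0 <= B) (D0 : 0 <= D).
Let d := D * s.

Let s2 : s ^+ 2 <= s.
Proof. by rewrite -[leRHS]mulr1 expr2; exact: ler_wpM2l. Qed.

Let d0 : 0 <= d. Proof. exact: mulr_ge0. Qed.

Lemma transplant_energy v il E d_0 d_1 a0 a1 : 0 <= E -> E <= K ->
  v <= 1 + c0 * s ^+ 2 -> 0 <= il -> il <= c0 -> `|d_0| <= d -> `|d_1| <= d ->
  `|a0| <= B -> `|a1| <= B ->
  v * E + 2 * (d_1 - d_0) * (a1 - a0) * il + (d_1 - d_0) ^+ 2 * il <=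
  E + (c0 * K + 8 * D * B * c0 + 4 * D ^+ 2 * c0) * s.
Proof.
move=> E0 EK vle il0 ilc d_0d d_1d a0B a1B.
have dd : `|d_1 - d_0| <= 2 * d.
  apply: le_trans (ler_normB _ _) _.
  have -> : 2 * d = d + d by lra.
  exact: lerD.
have aa : `|a1 - a0| <= 2 * B.
  apply: le_trans (ler_normB _ _) _.
  have -> : 2 * B = B + B by lra.
  exact: lerD.
have t1 : v * E <= E + c0 * K * s.
  apply: le_trans (ler_wpM2r E0 vle) _; rewrite mulrDl mul1r lerD2l.
  by have := ler_wpM2l c00 (ler_pM (sqr_ge0 s) E0 s2 EK); lra.
have t2 : 2 * (d_1 - d_0) * (a1 - a0) * il <= 8 * D * B * c0 * s.
  apply: (@le_trans _ _ (2 * (2 * d) * (2 * B) * il)).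
    rewrite ler_wpM2r //; apply: le_trans (ler_norm _) _; rewrite !normrM ger0_norm //.
    by apply: ler_pM; rewrite ?mulr_ge0 // ler_wpM2l.
  rewrite (_ : 8 * D * B * c0 * s = 2 * (2 * d) * (2 * B) * c0); last by rewrite /d; lra.
  by rewrite ler_wpM2l // !mulr_ge0.
have t3 : (d_1 - d_0) ^+ 2 * il <= 4 * D ^+ 2 * c0 * s.
  apply: (@le_trans _ _ ((2 * d) ^+ 2 * c0)).
    apply: ler_pM; rewrite ?sqr_ge0 //.
    by rewrite -real_normK ?num_real // lerXn2r // nnegrE mulr_ge0.
  rewrite (_ : (2 * d) ^+ 2 * c0 = 4 * D ^+ 2 * c0 * s ^+ 2); last by rewrite /d; lra.
  by rewrite ler_wpM2l // !mulr_ge0 ?sqr_ge0.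
move: t1 t2 t3; lra.
Qed.

Lemma transplant_norm w m2 m2' li : 0 <= m2 -> m2 <= 1 -> 0 <= w -> w <= 2 ->
  `|w - 1| <= 2 * c0 * s ^+ 2 -> 0 <= li -> li <= Lam ->
  `|m2' - w * m2| <= d * (w * m2) + li * d * (1 + d) ->
  m2 - (2 * c0 + 2 * D + Lam * D * (1 + D)) * s <= m2'.
Proof.
move=> m20 m21 w0 w2 w1 li0 liL m2E.
have q2 : w * m2 <= 2 by rewrite -[leRHS]mulr1; exact: ler_pM.
have q1 : m2 - 2 * c0 * s <= w * m2.
  have : `|(w - 1) * m2| <= 2 * c0 * s.
    rewrite normrM -[leRHS]mulr1; apply: ler_pM => //; last by rewrite ger0_norm.
    by apply: le_trans w1 _; rewrite ler_wpM2l // mulr_ge0.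
  by rewrite ler_norml => /andP[+ _]; lra.
have dq : d * (w * m2) <= d * 2 by rewrite ler_wpM2l.
have dD : d <= D by rewrite -[leRHS]mulr1; exact: ler_wpM2l.
have ld : li * d * (1 + d) <= Lam * d * (1 + D).
  apply: ler_pM; rewrite ?mulr_ge0 ?addr_ge0 ?lerD2l //; exact: ler_wpM2r.
move: m2E; rewrite ler_norml => /andP[+ _].
have -> : (2 * c0 + 2 * D + Lam * D * (1 + D)) * s = 2 * c0 * s + d * 2 + Lam * d * (1 + D).
  by rewrite /d; lra.
move: q1 dq ld; lra.
Qed.

Lemma transplant_mean w m1 d_0 d_1 li : `|m1| <= 1 + Lam ->
  `|w - 1| <= 2 * c0 * s ^+ 2 -> 0 <= li -> li <= Lam -> `|d_0| <= d -> `|d_1| <= d ->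
  `|w * m1 + li * (d_0 + d_1) / 2 - m1| <= (2 * c0 * (1 + Lam) + Lam * D) * s.
Proof.
move=> m1L w1 li0 liL d_0d d_1d.
have -> : w * m1 + li * (d_0 + d_1) / 2 - m1 = (w - 1) * m1 + li * ((d_0 + d_1) / 2).
  by lra.
apply: le_trans (ler_normD _ _) _; rewrite [leRHS]mulrDl; apply: lerD.
  rewrite normrM mulrAC; apply: ler_pM => //; apply: le_trans w1 _.
  by rewrite ler_wpM2l // mulr_ge0.
rewrite normrM ger0_norm // -[leRHS]mulrA; apply: ler_pM => //.
rewrite -/d; move: d_0d d_1d; rewrite !ler_norml => /andP[? ?] /andP[? ?]; lra.
Qed.

Lemma edge_transplant a0 a1 E m1 m2 b0 b1 : 0 < u -> 0 < l -> `|u - l| <= s ^+ 2 ->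
  2 * s ^+ 2 <= l -> l <= Lam -> l^-1 <= c0 -> E <= K -> m2 <= 1 -> `|m1| <= 1 + Lam ->
  `|a0| <= B -> `|a1| <= B -> `|b0 - a0| <= d -> `|b1 - a1| <= d ->
  profile u a0 a1 E m1 m2 -> exists E' m1' m2',
  [/\ profile l b0 b1 E' m1' m2',
      E' <= E + (c0 * K + 8 * D * B * c0 + 4 * D ^+ 2 * c0) * s,
      m2 - (2 * c0 + 2 * D + Lam * D * (1 + D)) * s <= m2' &
      `|m1' - m1| <= (2 * c0 * (1 + Lam) + Lam * D) * s].
Proof.
move=> u0 l0 ul sl lL ilc EK m21 m1L a0B a1B ab0 ab1 pr.
have [E0 m20 _ _ _] := profile_bounds (ltW u0) pr.
have [ul1 ul2] : u - l <= s ^+ 2 /\ l - u <= s ^+ 2.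
  by move: ul; rewrite ler_norml=> /andP[? ?]; split; lra.
have half : l / 2 <= u by move: ul2 sl; lra.
have il0 : 0 < l^-1 by rewrite invr_gt0.
have iu0 : 0 < u^-1 by rewrite invr_gt0.
have iuc : u^-1 <= 2 * c0.
  apply: le_trans (_ : (l / 2)^-1 <= _); first by rewrite lef_pV2 ?posrE // divr_gt0.
  by rewrite invf_div ler_wpM2l.
have ulb : u / l <= 1 + c0 * s ^+ 2.
  have -> : u / l = 1 + (u - l) * l^-1 by rewrite mulrBl divff ?gt_eqF // addrC subrK.
  rewrite lerD2l [leRHS]mulrC.
  by apply: le_trans (_ : s ^+ 2 * l^-1 <= _);
    [apply: ler_wpM2r => //; exact: ltW|apply: ler_wpM2l => //; exact: sqr_ge0].
have lub : `|l / u - 1| <= 2 * c0 * s ^+ 2.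
  have -> : l / u - 1 = (l - u) * u^-1 by rewrite mulrBl divff ?gt_eqF.
  rewrite normrM [`|u^-1|]gtr0_norm // mulrC.
  by apply: ler_pM => //; [exact: ltW|rewrite distrC].
have lu2 : l / u <= 2 by rewrite ler_pdivrMr //; move: half; lra.
have lu0 : 0 <= l / u by rewrite divr_ge0 // ltW.
have [m2' m2E] := profile_add_affine l0 ab0 ab1 (profile_scale u0 l0 pr).
rewrite !subrKC => pr'; do 3 eexists; split; first exact: pr'.
- exact: (transplant_energy E0 EK ulb (ltW il0) ilc ab0 ab1 a0B a1B).
- exact: (transplant_norm m20 m21 lu0 lu2 lub (ltW l0) lL m2E).
- exact: (transplant_mean m1L lub (ltW l0) lL ab0 ab1).
Qed.

End Transplant.

Section SemiGraph.
Variables (th : bool) (I : finType) (C : {set I}) (r : rel (I * bool)) (VD : pred (I * bool)).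
Variables (l : I -> R) (x0 : I * bool).
Hypothesis x0C : x0.1 \in C.
Hypothesis rC : forall x y, x.1 \in C -> r x y -> y.1 \in C.
Hypothesis r_sym : symmetric r.
Hypothesis conn : forall x, x.1 \in C -> connect (fun x y => r x y || (x.1 == y.1)) x0 x.
Hypothesis l_ge0 : forall i, i \in C -> 0 <= l i.
Hypothesis l_pos : 0 < l x0.1.

Let rho := inf (rayleigh th C r VD l).

Let L := \sum_(i in C) l i.

Let L0 : 0 < L.
Proof.
rewrite /L (bigD1 x0.1) //= ltr_pwDl //.
by apply: sumr_ge0 => i /andP[iC _]; exact: l_ge0.
Qed.

Let has_inf_l : has_inf (rayleigh th C r VD l).
Proof. by apply: rayleigh_has_inf => //; exists x0.1. Qed.

Let rho0 : 0 <= rho.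
Proof. by apply: lb_le_inf has_inf_l.1 _ => q; exact: rayleigh_ge0. Qed.

Let st x y := r x y || ((x.1 == y.1) && ~~ (0 < l x.1)).

Let st_sym : connect_sym st.
Proof.
apply: sym_connect_sym => x y; rewrite /st r_sym; congr orb.
by rewrite eq_sym; case: eqP => //= ->.
Qed.

Let st_C x y : connect st x y -> x.1 \in C -> y.1 \in C.
Proof.
move=> /connectP[p pth ->]; elim: p x pth => //= z p IH x /andP[+ pth] xC.
move=> /orP[/rC|/andP[/eqP xz _]]; first by move=> /(_ xC); exact: IH.
by apply: IH => //; rewrite -xz.
Qed.

Let N : R := #|{: I * bool}|%:R.

(** The transplantation: rescale each surviving edge and correct its end values,
    so that they agree on the vertices merged by the vanishing edges.  Along an edge
    of length at most [s ^ 2] and energy at most [K] the values change by at most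
    [s * sqrt K], so that all errors are of order [s]. *)
Lemma transplant (K : R) : 0 <= K -> exists2 M, 0 <= M & forall (u : I -> R) (s : R),
  0 <= s <= 1 -> (forall i, i \in C -> 0 < u i) ->
  (forall i, i \in C -> `|u i - l i| <= s ^+ 2) ->
  (forall i, i \in C -> 0 < l i -> 2 * s ^+ 2 <= l i) ->
  forall a E m1 m2, trial C r VD u a E m1 m2 -> \sum_(i in C) E i <= K ->
  \sum_(i in C) m2 i = 1 -> th ==> (\sum_(i in C) m1 i == 0) ->
  rho * (1 - M * s) <= \sum_(i in C) E i + M * s.
Proof.
move=> K0; pose Lam := L + 1.
pose c0 := \sum_(i in C | 0 < l i) (l i)^-1.
have c0_ge i : i \in C -> 0 < l i -> (l i)^-1 <= c0.
  move=> iC li; rewrite /c0 (bigD1 i) /=; last by rewrite iC.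
  by rewrite lerDl; apply: sumr_ge0 => j /andP[/andP[_ lj] _]; rewrite invr_ge0 ltW.
have c00 : 0 <= c0 by apply: sumr_ge0 => i /andP[_ li]; rewrite invr_ge0 ltW.
have N0 : 0 <= N by exact: ler0n.
have Lam0 : 0 <= Lam by have := L0; rewrite /Lam; lra.
(* a bound for the vertex values: the norm controls the value at [x0], and the
   energy controls the differences *)
pose B := Num.sqrt (4 * Lam * K + 4 * c0) + N * Num.sqrt (Lam * K).
have B0 : 0 <= B by rewrite addr_ge0 ?sqrtr_ge0 // mulr_ge0 ?sqrtr_ge0.
pose D := N * Num.sqrt K.
have D0 : 0 <= D by rewrite mulr_ge0 ?sqrtr_ge0.
pose M1 := c0 * K + 8 * D * B * c0 + 4 * D ^+ 2 * c0.
pose M2 := 2 * c0 + 2 * D + Lam * D * (1 + D) + 2 * (B ^+ 2 + Lam * K).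
pose M3 := 2 * c0 * (1 + Lam) + Lam * D + 1.
have M10 : 0 <= M1 by rewrite !addr_ge0 // ?mulr_ge0 ?sqr_ge0.
have M20 : 0 <= M2.
  have D1 : 0 <= 1 + D by lra.
  have BK : 0 <= B ^+ 2 + Lam * K by rewrite addr_ge0 ?sqr_ge0 // mulr_ge0.
  by rewrite !addr_ge0 // ?mulr_ge0.
have M30 : 0 <= M3 by have := mulr_ge0 c00 Lam0; have := mulr_ge0 Lam0 D0; rewrite /M3; lra.
pose n : R := #|C|%:R.
have n0 : 0 <= n by exact: ler0n.
exists (n * M1 + n * M2 + (n * M3) ^+ 2 / L).
  apply: addr_ge0; first by apply: addr_ge0; exact: mulr_ge0.
  by apply: divr_ge0; [exact: sqr_ge0|exact: ltW].
move=> u s /andP[s0 s1] u0 ul us a E m1 m2 [prof cont dir] EK m2_1 m1_0.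
have s2 : s ^+ 2 <= s by rewrite -[leRHS]mulr1 expr2 ler_wpM2l.
have s20 : 0 <= s ^+ 2 by exact: sqr_ge0.
have lL i : i \in C -> l i <= L.
  move=> iC; rewrite /L (bigD1 i) //= lerDl.
  by apply: sumr_ge0 => j /andP[jC _]; exact: l_ge0.
have uLam i : i \in C -> u i <= Lam.
  by move=> iC; have := ul i iC; have := lL i iC; rewrite ler_norml /Lam; lra.
have bnd i : i \in C -> [/\ 0 <= E i, 0 <= m2 i,
   (a (i, true) - a (i, false)) ^+ 2 <= u i * E i, m1 i ^+ 2 <= u i * m2 i &
   m2 i <= 2 * u i * (a (i, false) ^+ 2 + u i * E i)].
  by move=> iC; exact: profile_bounds (ltW (u0 i iC)) (prof i iC).
have E_K i : i \in C -> E i <= K.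
  move=> iC; apply: le_trans EK; rewrite (bigD1 i) //= lerDl.
  by apply: sumr_ge0 => j /andP[/bnd[]].
have lL_Lam i : i \in C -> l i <= Lam by move=> iC; have := lL i iC; rewrite /Lam; lra.
have m2_le1 i : i \in C -> m2 i <= 1.
  move=> iC; rewrite -m2_1 (bigD1 i) //= lerDl.
  by apply: sumr_ge0 => j /andP[/bnd[]].
have uE i : i \in C -> u i * E i <= Lam * K.
  by move=> iC; have [E0 _ _ _ _] := bnd i iC; apply: ler_pM; rewrite ?uLam ?E_K // ltW // u0.
have norm_le (x y : R) : 0 <= y -> x ^+ 2 <= y ^+ 2 -> `|x| <= y.
  move=> y0 xy; rewrite -(@ler_pXn2r _ 2) ?nnegrE //.
  by rewrite real_normK ?num_real.
have aB x : x.1 \in C -> `|a x| <= B.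
  move=> xC.
  have ax0 : `|a x0| <= Num.sqrt (4 * Lam * K + 4 * c0).
    have nn : 0 <= 4 * Lam * K + 4 * c0 by rewrite addr_ge0 // !mulr_ge0.
    apply: norm_le; rewrite ?sqrtr_ge0 // sqr_sqrtr //.
    have ui0 := u0 _ x0C.
    have half : l x0.1 / 2 <= u x0.1.
      by have := ul _ x0C; have := us _ x0C l_pos; rewrite ler_norml; lra.
    have iu : (u x0.1)^-1 <= 2 * c0.
      apply: le_trans (_ : (l x0.1 / 2)^-1 <= _).
        by rewrite lef_pV2 ?posrE // divr_gt0.
      by rewrite invf_div mulrC -mulrC ler_wpM2l // c0_ge.
    have main (b : bool) c e q2 : profile (u x0.1) (a (x0.1, b)) c (E x0.1) e q2 ->
        q2 <= 1 -> a (x0.1, b) ^+ 2 <= 4 * Lam * K + 4 * c0.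
      move=> pr q1; apply: le_trans (profile_end_bound ui0 pr) _.
      have [_ q20 _ _ _] := profile_bounds (ltW ui0) pr.
      apply: lerD; first by have := uE _ x0C; rewrite -!mulrA; lra.
      have : q2 / u x0.1 <= 1 * (2 * c0) by apply: ler_pM; rewrite // invr_ge0 ltW.
      lra.
    move: (x0) x0C ui0 main => [i0 b] /= iC ui main; case: b.
      exact: main (profile_rev (ltW ui) (prof i0 iC)) (m2_le1 _ iC).
    exact: main (prof i0 iC) (m2_le1 _ iC).
  have osc : `|a x - a x0| <= N * Num.sqrt (Lam * K).
    apply: (@connect_variation _ I r xpredT).
    - exact: sqrtr_ge0.
    - have := conn xC; congr is_true; apply: eq_connect => y z.
      by rewrite andbT.
    - have stp y : connect (fun x y => r x y || (x.1 == y.1) && true) x0 y -> y.1 \in C.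
        move=> /connectP[p pth ->]; elim: p (x0) x0C pth => //= z p IH y' y'C /andP[+ pth].
        move=> /orP[/rC|/andP[/eqP yz _]]; first by move=> /(_ y'C) zC; exact: IH.
        by apply: IH => //; rewrite -yz.
      by move=> y z cy ryz; have yC := stp y cy; apply: cont => //; exact: rC ryz.
    - have stp y : connect (fun x y => r x y || (x.1 == y.1) && true) x0 y -> y.1 \in C.
        move=> /connectP[p pth ->]; elim: p (x0) x0C pth => //= z p IH y' y'C /andP[+ pth].
        move=> /orP[/rC|/andP[/eqP yz _]]; first by move=> /(_ y'C) zC; exact: IH.
        by apply: IH => //; rewrite -yz.
      move=> i /stp /= iC _; apply: norm_le; rewrite ?sqrtr_ge0 // sqr_sqrtr ?mulr_ge0 //.
      by have [_ _ le _ _] := bnd i iC; apply: le_trans le _; exact: uE.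
  rewrite -[a x](subrK (a x0)) addrC; apply: le_trans (ler_normD _ _) _.
  exact: lerD.
pose d := D * s.
have d0 : 0 <= d by rewrite mulr_ge0.
have zero_le i : i \in C -> ~~ (0 < l i) -> u i <= s ^+ 2.
  move=> iC li; have l00 : l i = 0 by apply/eqP; rewrite eq_le l_ge0 // andbT leNgt.
  by have := ul i iC; rewrite l00 subr0 ger0_norm // ltW // u0.
have close x y : x.1 \in C -> connect st x y -> `|a y - a x| <= d.
  move=> xC xy; rewrite /d /D -mulrA.
  apply: (@connect_variation _ I r (fun i => ~~ (0 < l i))) => //.
  - by rewrite mulr_ge0 // sqrtr_ge0.
  - by move=> v w cv rvw; have vC := st_C cv xC; apply: cont => //; exact: rC rvw.
  - move=> i /st_C /(_ xC) /= iC li.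
    apply: norm_le; first by rewrite mulr_ge0 // sqrtr_ge0.
    rewrite exprMn sqr_sqrtr //; have [E0 _ le _ _] := bnd i iC; apply: le_trans le _.
    by rewrite [leRHS]mulrC; apply: ler_pM; rewrite ?E_K ?zero_le // ltW // u0.
(* the common value at the merged vertices: that of a representative, but zero if a
   Dirichlet condition holds at one of them *)
pose b x := if [exists z, connect st x z && VD z] then 0 else a (fingraph.root st x).
have ab x : x.1 \in C -> `|b x - a x| <= d.
  move=> xC; rewrite /b; case: ifPn => [/existsP[z /andP[xz Vz]]|_].
    by have := close x z xC xz; rewrite dir //; exact: st_C xz xC.
  by apply: close => //; exact: connect_root.
have bst x y : connect st x y -> b x = b y.
  move=> xy; rewrite /b.
  have -> : [exists z, connect st x z && VD z] = [exists z, connect st y z && VD z].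
    by apply: eq_existsb => z; rewrite (same_connect st_sym xy).
  have -> // : fingraph.root st x = fingraph.root st y.
  by apply/eqP; rewrite root_connect.
have edge_data i : i \in C -> exists E' m1' m2',
    [/\ profile (l i) (b (i, false)) (b (i, true)) E' m1' m2', E' <= E i + M1 * s,
        m2 i - M2 * s <= m2' & `|m1' - m1 i| <= M3 * s].
  move=> iC; have [Ei0 m2i0 _ m1i m2i] := bnd i iC; have ui0 := u0 i iC.
  have uE_i := uE i iC; have EKi := E_K i iC; have m21 := m2_le1 i iC.
  have m1Lam : `|m1 i| <= 1 + Lam.
    apply: norm_le; first by lra.
    apply: le_trans m1i _; apply: (@le_trans _ _ (Lam * 1)).
      by apply: ler_pM => //; rewrite ?uLam // ltW.
    by have := sqr_ge0 Lam; lra.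
  have [li|li] := boolP (0 < l i); last first.
    have l00 : l i = 0 by apply/eqP; rewrite eq_le l_ge0 // andbT leNgt.
    have us2 := zero_le i iC li.
    exists 0, 0, 0; split.
    - rewrite l00; apply/profile0; split => //; apply: bst; apply: connect1.
      by rewrite /st /= eqxx li orbT.
    - by rewrite addr_ge0 // mulr_ge0.
    - have aBi : a (i, false) ^+ 2 <= B ^+ 2.
        by have := aB (i, false) iC; rewrite ler_norml => /andP[]; nra.
      have BK0 : 0 <= B ^+ 2 + Lam * K by rewrite addr_ge0 ?sqr_ge0 // mulr_ge0.
      have le1 : m2 i <= 2 * s * (B ^+ 2 + Lam * K).
        apply: (le_trans m2i); apply: ler_pM.
        + by rewrite mulr_ge0 // ltW.
        + by rewrite addr_ge0 ?sqr_ge0 // mulr_ge0 // ltW.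
        + by rewrite ler_wpM2l //; exact: le_trans us2 s2.
        + exact: lerD.
      have : 0 <= (2 * c0 + 2 * D + Lam * D * (1 + D)) * s.
        rewrite mulr_ge0 // !addr_ge0 ?mulr_ge0 //; lra.
      rewrite /M2; lra.
    - have m1s : `|m1 i| <= s.
        apply: norm_le => //; apply: (le_trans m1i).
        by rewrite -[leRHS]mulr1; apply: ler_pM => //; exact: ltW.
      rewrite sub0r normrN; apply: (le_trans m1s).
      rewrite -[leLHS]mul1r ler_wpM2r // /M3.
      by have := mulr_ge0 c00 Lam0; have := mulr_ge0 Lam0 D0; lra.
  have [E' [m1' [m2' [pr e1 e2 e3]]]] := edge_transplant s0 s1 c00 B0 D0 ui0 li (ul i iC)
    (us i iC li) (lL_Lam i iC) (c0_ge i iC li) EKi m21 m1Lam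
    (aB (i, false) iC) (aB (i, true) iC) (ab (i, false) iC) (ab (i, true) iC) (prof i iC).
  exists E', m1', m2'; split => //.
  - have : 0 <= 2 * (B ^+ 2 + Lam * K) * s.
      by rewrite mulr_ge0 // mulr_ge0 // addr_ge0 ?sqr_ge0 // mulr_ge0.
    by move: e2; rewrite /M2; lra.
  - by apply: (le_trans e3); rewrite /M3 ler_wpM2r // lerDl.
have edge_data' : forall i, exists y : R * R * R, i \in C ->
    [/\ profile (l i) (b (i, false)) (b (i, true)) y.1.1 y.1.2 y.2, y.1.1 <= E i + M1 * s,
        m2 i - M2 * s <= y.2 & `|y.1.2 - m1 i| <= M3 * s].
  move=> i; case: (boolP (i \in C)) => [/edge_data[e [v [w H]]]|_]; last by exists (0, 0, 0).
  by exists (e, v, w).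
have {edge_data edge_data'}/choice[y yP] := edge_data'.
have EE : \sum_(i in C) (y i).1.1 <= \sum_(i in C) E i + n * M1 * s.
  rewrite -mulrA /n mulr_natl -sumr_const -big_split; apply: ler_sum => i iC /=.
  by have [] := yP i iC.
have m2E : 1 - n * M2 * s <= \sum_(i in C) (y i).2.
  rewrite -m2_1 -mulrA /n mulr_natl -sumr_const -sumrB; apply: ler_sum => i iC /=.
  by have [] := yP i iC.
have massE : 1 - (n * M2 + (n * M3) ^+ 2 / L) * s <=
    mass th C l (fun i => (y i).1.2) (fun i => (y i).2).
  rewrite /mass -/L.
  have pos : 0 <= (n * M3) ^+ 2 / L by rewrite divr_ge0 ?sqr_ge0 // ltW.
  case: (th) m1_0 => /=; last first.
    by move=> _; rewrite subr0 mulrDl; have := mulr_ge0 pos s0; lra.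
  move=> /eqP m10.
  have m1E : `|\sum_(i in C) (y i).1.2| <= n * M3 * s.
    have -> : \sum_(i in C) (y i).1.2 = \sum_(i in C) ((y i).1.2 - m1 i).
      by rewrite sumrB m10 subr0.
    apply: le_trans (ler_norm_sum _ _ _) _.
    rewrite -mulrA /n mulr_natl -sumr_const; apply: ler_sum => i iC.
    by have [] := yP i iC.
  have : (\sum_(i in C) (y i).1.2) ^+ 2 / L <= (n * M3) ^+ 2 / L * s.
    apply: (@le_trans _ _ ((n * M3 * s) ^+ 2 / L)).
      rewrite ler_wpM2r ?invr_ge0 ?(ltW L0) //.
      by rewrite -real_normK ?num_real // lerXn2r // nnegrE // !mulr_ge0.
    rewrite (_ : (n * M3 * s) ^+ 2 / L = (n * M3) ^+ 2 / L * s ^+ 2); last lra.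
    exact: ler_wpM2l.
  by rewrite mulrDl; lra.
have E0' : 0 <= \sum_(i in C) (y i).1.1.
  apply: sumr_ge0 => i iC; have [pr _ _ _] := yP i iC.
  by have [] := profile_bounds (l_ge0 iC) pr.
have fin : rho * mass th C l (fun i => (y i).1.2) (fun i => (y i).2) <=
    \sum_(i in C) (y i).1.1.
  set ms := mass _ _ _ _ _; have [ms0|ms0] := leP ms 0.
    by apply: le_trans E0'; rewrite mulr_ge0_le0.
  rewrite -ler_pdivlMr //; apply: (ge_inf has_inf_l.2).
  exists b, (fun i => (y i).1.1), (fun i => (y i).1.2), (fun i => (y i).2).
  split => //; split.
  - by move=> i iC; have [] := yP i iC.
  - by move=> v w vC wC vw; apply: bst; apply: connect1; rewrite /st vw.
  - move=> v vC Vv; rewrite /b; case: ifPn => // /existsPn /(_ v).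
    by rewrite connect0 Vv.
have le1 := ler_wpM2l rho0 massE.
have : rho * (1 - (n * M1 + n * M2 + (n * M3) ^+ 2 / L) * s) <=
    rho * (1 - (n * M2 + (n * M3) ^+ 2 / L) * s).
  by apply: ler_wpM2l => //; have := mulr_ge0 (mulr_ge0 n0 M10) s0; lra.
have : 0 <= (n * M2 + (n * M3) ^+ 2 / L) * s.
  apply: mulr_ge0 => //; apply: addr_ge0; first exact: mulr_ge0.
  by apply: divr_ge0; [exact: sqr_ge0|exact: ltW].
lra.
Qed.

End SemiGraph.
End LimitOfLengths.

Section ContinuityOfInf.
Variable R : realType.
Variables (th : bool) (I : finType) (C : {set I}) (r : rel (I * bool)) (VD : pred (I * bool)).
Variables (l : I -> R) (x0 : I * bool).
Hypothesis x0C : x0.1 \in C.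
Hypothesis rC : forall x y, x.1 \in C -> r x y -> y.1 \in C.
Hypothesis r_sym : symmetric r.
Hypothesis conn : forall x, x.1 \in C -> connect (fun x y => r x y || (x.1 == y.1)) x0 x.
Hypothesis l_ge0 : forall i, i \in C -> 0 <= l i.
Hypothesis l_pos : 0 < l x0.1.
Hypothesis VD_th : forall x, th -> ~~ VD x.
Variable u : nat -> I -> R.
Hypothesis u_gt0 : forall n i, i \in C -> 0 < u n i.
Hypothesis ul : forall i, i \in C -> u n i @[n --> \oo] --> l i.

Let rho := inf (rayleigh th C r VD l).
Let rhon n := inf (rayleigh th C r VD (u n)).

Let has_inf_l : has_inf (rayleigh th C r VD l).
Proof. by apply: rayleigh_has_inf => //; exists x0.1. Qed.

Let has_inf_u n : has_inf (rayleigh th C r VD (u n)).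
Proof.
apply: rayleigh_has_inf => [i iC|]; first by rewrite ltW // u_gt0.
by exists x0.1 => //; exact: u_gt0.
Qed.

Let rho0 : 0 <= rho.
Proof. by apply: lb_le_inf has_inf_l.1 _ => q; exact: rayleigh_ge0. Qed.

(** A trial function of the limit is rescaled on the surviving edges and extended by
    constants to the vanishing ones. *)
Let upper e : 0 < e -> \forall n \near \oo, rhon n <= rho + e.
Proof.
move=> e0; have e20 : 0 < e / 2 by lra.
have [q [a [E [m1 [m2 [[prof cont dir] mass0 qE]]]]] qrho] := inf_adherent e20 has_inf_l.
pose En n i := if 0 < l i then l i / u n i * E i else 0.
pose m1n n i := if 0 < l i then u n i / l i * m1 i else a (i, false) * u n i.
pose m2n n i := if 0 < l i then u n i / l i * m2 i else a (i, false) ^+ 2 * u n i.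
have z i : i \in C -> ~~ (0 < l i) -> l i = 0.
  by move=> iC li; apply/eqP; rewrite eq_le l_ge0 // andbT leNgt.
have z0 i : i \in C -> ~~ (0 < l i) -> [/\ a (i, true) = a (i, false), E i = 0, m1 i = 0 & m2 i = 0].
  by move=> iC li; have := prof i iC; rewrite z // => /profile0.
have profn n i : i \in C ->
    profile (u n i) (a (i, false)) (a (i, true)) (En n i) (m1n n i) (m2n n i).
  move=> iC; rewrite /En /m1n /m2n; case: ifPn => li.
    by apply: profile_scale => //; [exact: u_gt0|exact: prof].
  have [-> _ _ _] := z0 i iC li; apply: profile_cst; exact: ltW (u_gt0 n iC).
have invl i : i \in C -> 0 < l i -> (u n i)^-1 @[n --> \oo] --> (l i)^-1.
  by move=> iC li; apply: cvgV; [rewrite gt_eqF|exact: ul].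
have Ec i : i \in C -> En n i @[n --> \oo] --> E i.
  move=> iC; rewrite /En; have [li|li] := boolP (0 < l i); last first.
    by have [_ -> _ _] := z0 i iC li; exact: cvg_cst.
  rewrite -[X in _ --> X](_ : l i / l i * E i = _); last by rewrite divff ?gt_eqF // mul1r.
  apply: cvgM; last exact: cvg_cst.
  by apply: cvgM; [exact: cvg_cst|exact: invl].
have m1c i : i \in C -> m1n n i @[n --> \oo] --> m1 i.
  move=> iC; rewrite /m1n; have [li|li] := boolP (0 < l i); last first.
    have [_ _ -> _] := z0 i iC li; rewrite -[X in _ --> X](mulr0 (a (i, false))).
    by apply: cvgM; [exact: cvg_cst|rewrite -[X in _ --> X](z i iC li); exact: ul].
  rewrite -[X in _ --> X](_ : l i / l i * m1 i = _); last by rewrite divff ?gt_eqF // mul1r.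
  apply: cvgM; last exact: cvg_cst.
  by apply: cvgM; [exact: ul|exact: cvg_cst].
have m2c i : i \in C -> m2n n i @[n --> \oo] --> m2 i.
  move=> iC; rewrite /m2n; have [li|li] := boolP (0 < l i); last first.
    have [_ _ _ ->] := z0 i iC li; rewrite -[X in _ --> X](mulr0 (a (i, false) ^+ 2)).
    by apply: cvgM; [exact: cvg_cst|rewrite -[X in _ --> X](z i iC li); exact: ul].
  rewrite -[X in _ --> X](_ : l i / l i * m2 i = _); last by rewrite divff ?gt_eqF // mul1r.
  apply: cvgM; last exact: cvg_cst.
  by apply: cvgM; [exact: ul|exact: cvg_cst].
have L0 : 0 < \sum_(i in C) l i.
  rewrite (bigD1 x0.1) //= ltr_pwDl //.
  by apply: sumr_ge0 => i /andP[iC _]; exact: l_ge0.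
have massc : mass th C (u n) (m1n n) (m2n n) @[n --> \oo] --> mass th C l m1 m2.
  rewrite /mass; apply: cvgB; first exact: cvg_fsum.
  case: (th); last exact: cvg_cst.
  have m1s := @cvg_fsum R I (index_enum I) (mem C) _ _ m1c.
  apply: cvgM; first by rewrite expr2; under eq_fun do rewrite expr2; exact: cvgM.
  by apply: cvgV; [rewrite gt_eqF|exact: cvg_fsum].
have qc : (\sum_(i in C) En n i) / mass th C (u n) (m1n n) (m2n n) @[n --> \oo] --> q.
  rewrite qE; apply: cvgM; first exact: cvg_fsum.
  by apply: cvgV => //; rewrite gt_eqF.
have qe : q < rho + e by rewrite /rho; lra.
near=> n.
apply: (@le_trans _ _ ((\sum_(i in C) En n i) / mass th C (u n) (m1n n) (m2n n))).
  apply: (ge_inf (has_inf_u n).2); exists a, (En n), (m1n n), (m2n n); split => //.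
    by split => // i iC; exact: profn.
  by near: n; exact: (cvgr_gt _ massc _ mass0).
by near: n; exact: (cvgr_le _ qc _ qe).
Unshelve. all: by end_near. Qed.

(** A nearly optimal function for the lengths [u n], normalized to have mass one, and
    mean zero if [th], is transplanted to the limit. *)
Let lower e : 0 < e -> \forall n \near \oo, rho - e <= rhon n.
Proof.
move=> e0; have K0 : 0 <= rho + 1 by rewrite addr_ge0.
have [M M0 MP] := transplant th VD x0C rC r_sym conn l_ge0 l_pos K0.
pose s n := Num.sqrt (\sum_(i in C) `|u n i - l i|).
have sum0 n : 0 <= \sum_(i in C) `|u n i - l i| by exact: sumr_ge0.
have s2 n i : i \in C -> `|u n i - l i| <= s n ^+ 2.
  move=> iC; rewrite sqr_sqrtr // (bigD1 i) //= lerDl.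
  exact: sumr_ge0.
have sum_cvg : (\sum_(i in C) `|u n i - l i|) @[n --> \oo] --> (0 : R).
  rewrite -[X in _ --> X](_ : \sum_(i in C) `|l i - l i| = _).
    by apply: cvg_fsum => i iC; apply: cvg_norm; apply: cvgB; [exact: ul|exact: cvg_cst].
  by rewrite big1 // => i _; rewrite subrr normr0.
have s_cvg : s n @[n --> \oo] --> (0 : R).
  rewrite -[X in _ --> X](@sqrtr0 R).
  by apply: continuous_cvg => //; exact: sqrt_continuous.
have s_small d : 0 < d -> \forall n \near \oo, s n <= d.
  by move=> d0; exact: (cvgr_le _ s_cvg _ d0).
have sum_small d : 0 < d -> \forall n \near \oo, \sum_(i in C) `|u n i - l i| <= d.
  by move=> d0; exact: (cvgr_le _ sum_cvg _ d0).
have lpos : \forall n \near \oo, forall i, i \in C -> 0 < l i -> 2 * s n ^+ 2 <= l i.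
  have pos : exists2 d, 0 < d & forall i, i \in C -> 0 < l i -> 2 * d <= l i.
    exists (\big[Num.min/1]_(i in C | 0 < l i) (l i / 2)).
      apply: (big_ind (fun x : R => 0 < x)) => // [x y x0' y0'|i /andP[_ li]]; last by rewrite divr_gt0.
      by rewrite lt_min x0' y0'.
    move=> i iC li; rewrite mulrC -ler_pdivlMr //.
    by apply: bigmin_le_cond; rewrite iC.
  have [d d0 dP] := pos; near=> n => i iC li; apply: le_trans (dP i iC li).
  rewrite ler_wpM2l // sqr_sqrtr //; near: n; exact: sum_small.
have e'0 : 0 < e / 2 / (M * (1 + rho) + 1).
  by rewrite !divr_gt0 // ltr_wpDl // mulr_ge0 // addr_ge0.
near=> n.
have [nrho|rhon_lt] := leP rho (rhon n); first by lra.
have d0 : 0 < Num.min (e / 2) 1 by rewrite lt_min ltr01 andbT; lra.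
have [q [a [E [m1 [m2 [[prof cont dir] mass0 qE]]]]] qn] := inf_adherent d0 (has_inf_u n).
rewrite -/(rhon n) in qn; set V := mass _ _ _ _ _ in mass0 qE.
have q1 : q <= rho + 1.
  have : Num.min (e / 2) 1 <= 1 :> R by rewrite ge_min lexx orbT.
  lra.
have q2 : q <= rhon n + e / 2.
  have : Num.min (e / 2) 1 <= e / 2 by rewrite ge_min lexx.
  lra.
have U0 : 0 < \sum_(i in C) u n i.
  rewrite (bigD1 x0.1) //= ltr_pwDl ?u_gt0 //.
  by apply: sumr_ge0 => i /andP[iC _]; rewrite ltW // u_gt0.
pose c := if th then - (\sum_(i in C) m1 i) / \sum_(i in C) u n i else 0.
pose t := Num.sqrt V^-1.
have t2 : t ^+ 2 = V^-1 by rewrite sqr_sqrtr // invr_ge0 ltW.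
have UV : (\sum_(i in C) u n i) * (\sum_(i in C) u n i)^-1 = 1 by rewrite divff // gt_eqF.
have := MP (u n) (s n) _ (fun i iC => u_gt0 n iC) (s2 n) _ (fun x => t * (a x + c))
  (fun i => t ^+ 2 * E i) (fun i => t * (m1 i + c * u n i))
  (fun i => t ^+ 2 * (m2 i + 2 * c * m1 i + c ^+ 2 * u n i)).
have -> : \sum_(i in C) t ^+ 2 * E i = q by rewrite -mulr_sumr t2 mulrC qE.
have -> : \sum_(i in C) t ^+ 2 * (m2 i + 2 * c * m1 i + c ^+ 2 * u n i) = 1.
  rewrite -mulr_sumr !big_split /= -!mulr_sumr t2.
  rewrite [X in _ * X](_ : _ = V) ?mulVf ?gt_eqF // /V /mass /c.
  case: (th) => /=; last lra.
  move: UV; set S1 := \sum_(i in C) m1 i; set U := \sum_(i in C) u n i; set iU := U^-1 => UV.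
  rewrite (_ : (- S1 * iU) ^+ 2 * U = S1 ^+ 2 * iU * (U * iU)); last lra.
  rewrite UV; lra.
move=> H.
have {}H : rho * (1 - M * s n) <= q + M * s n.
  apply: H => //.
  - rewrite sqrtr_ge0 /=; near: n; exact: s_small.
  - by near: n.
  - split.
    + move=> i iC; apply: profile_smul; first by rewrite ltW // u_gt0.
      by apply: profile_shift; [rewrite ltW // u_gt0|exact: prof].
    + by move=> x y xC yC rxy; rewrite (cont x y).
    + move=> x xC Vx; rewrite /c; case: ifP => [tht|_]; last by rewrite dir // addr0 mulr0.
      by have := VD_th x tht; rewrite Vx.
  - apply/implyP => tht; rewrite /c tht -mulr_sumr big_split /= -mulr_sumr.
    by rewrite divfK; [rewrite subrr mulr0|rewrite gt_eqF].
have : s n <= e / 2 / (M * (1 + rho) + 1) by near: n; exact: s_small.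
have Mr : 0 <= M * (1 + rho) by rewrite mulr_ge0 // addr_ge0.
rewrite ler_pdivlMr; last by lra.
have sn0 : 0 <= s n by exact: sqrtr_ge0.
by move=> le1; lra.
Unshelve. all: by end_near. Qed.

Lemma rayleigh_inf_cvg :
  inf (rayleigh th C r VD (u n)) @[n --> \oo] --> inf (rayleigh th C r VD l).
Proof.
apply/cvgrPdist_le => e e0; near=> n; rewrite -/rho -/(rhon n).
have h1 : rhon n <= rho + e by near: n; exact: upper.
have h2 : rho - e <= rhon n by near: n; exact: lower.
by rewrite ler_norml; lra.
Unshelve. all: by end_near. Qed.

End ContinuityOfInf.

(** * Invariance of the energies and of rigidity *)
Section Relabelling.

Lemma relabel_inverse (m n : nat) (phi : 'I_m -> 'I_n) (flip : 'I_m -> bool) :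
  bijective phi -> exists (psi : 'I_n -> 'I_m) (flip' : 'I_n -> bool),
  [/\ cancel phi psi, cancel psi phi,
      cancel (relabel_end phi flip) (relabel_end psi flip') &
      cancel (relabel_end psi flip') (relabel_end phi flip)].
Proof.
move=> [psi phiK psiK]; exists psi, (fun j => flip (psi j)); split => // -[i b];
by rewrite /relabel_end /= ?phiK ?psiK addbK.
Qed.

Lemma relabel_same_component (D D' : discrete_graph) (phi : edge D -> edge D')
    (flip : edge D -> bool) : bijective phi ->
  (forall x y, glued (relabel_end phi flip x) (relabel_end phi flip y) = glued x y) ->
  forall e f, same_component e f = same_component (phi e) (phi f).
Proof.
move=> bij gl e f; have [psi [flip' [phiK psiK K1 K2]]] := relabel_inverse flip bij.
have gl' x y : glued (relabel_end psi flip' x) (relabel_end psi flip' y) = glued x y.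
  by rewrite -gl !K2.
have up x y : connect (@linked D) x y ->
    connect (@linked D') (relabel_end phi flip x) (relabel_end phi flip y).
  apply: connect_map => {}x {}y /orP[xy|/eqP xy]; apply: connect1; rewrite /linked.
    by rewrite gl xy.
  by rewrite /= xy eqxx orbT.
have dn x y : connect (@linked D') x y ->
    connect (@linked D) (relabel_end psi flip' x) (relabel_end psi flip' y).
  apply: connect_map => {}x {}y /orP[xy|/eqP xy]; apply: connect1; rewrite /linked.
    by rewrite gl' xy.
  by rewrite /= xy eqxx orbT.
have E x y : connect (@linked D) x y =
    connect (@linked D') (relabel_end phi flip x) (relabel_end phi flip y).
  by apply/idP/idP => [/up//|/dn]; rewrite !K1.
by rewrite {1}/same_component E same_componentE.
Qed.

End Relabelling.

Section PowerMean.
Variable R : realType.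

Lemma eq_power_mean (p : \bar R) (I : finType) (S : {set I}) (a b : I -> R) :
  {in S, a =1 b} -> power_mean p S a = power_mean p S b.
Proof.
move=> ab; case: p => [q||]; rewrite /power_mean; last 2 first.
- exact: eq_bigr.
- by [].
by congr ((_ * _) `^ _); apply: eq_bigr => i /ab ->.
Qed.

Lemma power_mean_imset (p : \bar R) (I J : finType) (S : {set I}) (f : I -> J)
    (a : J -> R) : {in S &, injective f} ->
  power_mean p (f @: S) a = power_mean p S (fun i => a (f i)).
Proof.
move=> inj; case: p => [q||]; rewrite /power_mean; last 2 first.
- apply/eqP; rewrite eq_le; apply/andP; split; apply/bigmax_leP; split.
  + exact: bigmax_ge_id.
  + by move=> _ /imsetP[i iS ->]; apply: (le_bigmax_cond _ (fun i => a (f i))).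
  + exact: bigmax_ge_id.
  + by move=> i iS; apply: le_bigmax_cond; exact: imset_f.
- by [].
by rewrite card_in_imset // big_imset.
Qed.

End PowerMean.

Section SamePartition.
Variable R : realType.

Definition dirichlet (th : bool) (D : discrete_cut) : pred (endpoint D) :=
  fun x => ~~ th && nontriv_cut x.

Definition cluster_energy (th : bool) (P : gpartition R) (C : {set edge P}) : R :=
  inf (rayleigh th C (@cut P) (@dirichlet th P) (@pt_len R P)).

(** [LambdaN] for [th = true] and [LambdaD] for [th = false]. *)
Definition Energy (th : bool) (p : \bar R) (P : gpartition R) : R :=
  power_mean p (clusters P) (@cluster_energy th P).

Lemma LambdaNE p (P : gpartition R) : LambdaN p P = Energy true p P.
Proof. by apply: eq_power_mean => C CC; rewrite cluster_mu2. Qed.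

Lemma LambdaDE p (P : gpartition R) : LambdaD p P = Energy false p P.
Proof. by apply: eq_power_mean => C CC; rewrite cluster_lambda1. Qed.

(** Rigidity in combinatorial terms ([rigidP]). *)
Definition rigid_cut (D : discrete_cut) : Prop := forall x : endpoint D, nontriv_cut x ->
  exists2 y, glued x y & ~~ same_component (D := cut_discrete D) x.1 y.1.

Lemma nontriv_cutP (D : discrete_cut) (x : endpoint D) :
  reflect (exists2 y, glued x y & ~~ cut x y) (nontriv_cut x).
Proof.
by apply: (iffP existsP) => [[y /andP[gy cy]]|[y gy cy]]; exists y => //; rewrite gy.
Qed.

Lemma nontriv_relabel (D D' : discrete_cut) (phi : edge D -> edge D')
    (flip : edge D -> bool) : bijective phi ->
  (forall x y, glued (relabel_end phi flip x) (relabel_end phi flip y) = glued x y) ->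
  (forall x y, cut (relabel_end phi flip x) (relabel_end phi flip y) = cut x y) ->
  forall x, nontriv_cut (relabel_end phi flip x) = nontriv_cut x.
Proof.
move=> bij gl ct x; have [psi [flip' [phiK psiK K1 K2]]] := relabel_inverse flip bij.
apply/nontriv_cutP/nontriv_cutP => [[y gy cy]|[y gy cy]].
  by exists (relabel_end psi flip' y); rewrite -?gl -?ct K2.
by exists (relabel_end phi flip y); rewrite ?gl ?ct.
Qed.

Lemma nontriv_dummy (D : discrete_cut) (e : edge D) (z : endpoint (cut_dummy e)) :
  nontriv_cut z = if old_end e z is Some x then nontriv_cut x else false.
Proof.
case zE : (old_end e z) => [x|].
  rewrite (old_endK zE); apply/nontriv_cutP/nontriv_cutP => [[w]|[y gy cy]].
    rewrite /= /dummy_rel new_endK; case: (old_end e w) => [y|] // gy cy.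
    by exists y.
  by exists (new_end e y); rewrite /= dummy_rel_new.
by apply/nontriv_cutP => -[w]; rewrite /= /dummy_rel zE; case: (old_end e w).
Qed.

Lemma relabel_energy th p (P Q : gpartition R) : partition_relabelling P Q ->
  [/\ #|clusters P| = #|clusters Q|, Energy th p P = Energy th p Q &
      rigid_cut P <-> rigid_cut Q].
Proof.
move=> [phi [flip [bij lenE gl ct]]].
have [psi [flip' [phiK psiK K1 K2]]] := relabel_inverse flip bij.
have conn := @relabel_same_component (cut_discrete P) (cut_discrete Q) phi flip bij ct.
have hits (e' : edge (cut_discrete Q)) :
    exists e, same_component (D := cut_discrete Q) (phi e) e'.
  by exists (psi e'); rewrite psiK same_component_refl.
have nt := nontriv_relabel bij gl ct.
split.
- exact: (card_components (D := cut_discrete P) (D' := cut_discrete Q) conn hits).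
- rewrite /Energy /clusters
    (components_preim (D := cut_discrete P) (D' := cut_discrete Q) conn hits).
  rewrite power_mean_imset; last first.
    exact: (preim_component_inj (D := cut_discrete P) (D' := cut_discrete Q) conn hits).
  apply: eq_power_mean => C CC; congr inf; apply/esym/seteqP; split.
  + apply: (rayleigh_pullback (phi := phi) (flip := flip)).
    * by move=> i j _ _; exact: bij_inj.
    * apply/setP => j; apply/imsetP/idP => [[i + ->]|jC]; first by rewrite inE.
      by exists (psi j); rewrite ?inE psiK.
    * by move=> j _; exact: ltW (pt_len_gt0 j).
    * by move=> i _; rewrite lenE.
    * by move=> x y _ _; rewrite -ct.
    * by move=> x _; rewrite /dirichlet -nt.
  + apply: (rayleigh_pullback (phi := psi) (flip := flip')).
    * by move=> i j _ _ /(congr1 phi); rewrite !psiK.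
    * apply/setP => j; apply/imsetP/idP => [[i + ->]|jC]; first by rewrite inE psiK.
      by exists (phi j); rewrite ?phiK //; rewrite inE in jC.
    * by move=> j _; exact: ltW (pt_len_gt0 j).
    * by move=> i _; rewrite -{1}[i]psiK lenE.
    * by move=> x y _ _; rewrite -[cut (relabel _ _ _) _]ct !K2.
    * by move=> x _; rewrite /dirichlet -[nontriv_cut (relabel _ _ _)]nt K2.
- split=> rg x nx.
  + have := rg (relabel_end psi flip' x); rewrite -nt K2 => /(_ nx)[y gy cy].
    exists (relabel_end phi flip y); first by rewrite -[x]K2 gl.
    by move: cy; rewrite conn /= psiK.
  + have := rg (relabel_end phi flip x); rewrite nt => /(_ nx)[y gy cy].
    exists (relabel_end psi flip' y); first by rewrite -gl K2.
    by rewrite conn /= psiK.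
Qed.

Lemma dummy_energy th p (P : gpartition R) (e : edge P) t (ht : 0 < t < pt_len e) :
  let Q := partition_dummy ht in
  [/\ #|clusters P| = #|clusters Q|, Energy th p P = Energy th p Q &
      rigid_cut P <-> rigid_cut Q].
Proof.
move=> Q; case/andP: (ht) => t0 tl.
have conn := @dummy_same_component (cut_discrete P) e.
have hits := @dummy_hits (cut_discrete P) e.
split.
- exact/esym/(card_components conn hits).
- rewrite /Energy /clusters -[components (cut_discrete Q)]/(components (DiscreteGraph
    (dummy_rel_equiv e (@glued_equiv (cut_discrete P))))) (components_preim conn hits).
  rewrite power_mean_imset; last exact: preim_component_inj conn hits.
  apply: eq_power_mean => C CC; rewrite /cluster_energy -(@rayleigh_dummy _ th _ e C
    (@cut P) (@dirichlet th P) (@dirichlet th Q) (@pt_len R P) t) //.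
    by rewrite !ltW.
  move=> z; rewrite /dirichlet nontriv_dummy.
  by case: (old_end e z); rewrite ?andbF.
- split=> rg x nx.
    move: nx; rewrite nontriv_dummy; case xE : (old_end e x) => [x'|] // nx.
    have [y gy cy] := rg x' nx; exists (new_end e y).
      by rewrite (old_endK xE) /= dummy_rel_new.
    by rewrite (old_endK xE) [same_component _ _]conn !old_edge_new_end.
  have := rg (new_end e x); rewrite nontriv_dummy new_endK => /(_ nx)[z].
  rewrite /= /dummy_rel new_endK; case zE : (old_end e z) => [y|] // gy cy.
  exists y => //; move: cy.
  by rewrite (old_endK zE) [same_component _ _]conn !old_edge_new_end.
Qed.

Lemma same_partition_energy th p (P Q : gpartition R) : same_partition P Q ->
  [/\ #|clusters P| = #|clusters Q|, Energy th p P = Energy th p Q &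
      rigid_cut P <-> rigid_cut Q].
Proof.
elim=> {P Q} [P Q PQ|P e t ht|P Q _ [h1 h2 h3]|P Q S _ [h1 h2 h3] _ [k1 k2 k3]].
- exact: relabel_energy.
- exact: dummy_energy.
- by split => //; split; apply h3.
- by split; [rewrite h1|rewrite h2|split=> [/h3/k3|/k3/h3]].
Qed.

Lemma same_partition_graph (P Q : gpartition R) : same_partition P Q ->
  same_graph (total_graph P) (total_graph Q).
Proof.
elim=> {P Q} [P Q [phi [flip [bij lenE gl ct]]]|P e t ht|P Q _|P Q S _ h _].
- by apply: same_graph_relabel; exists phi, flip.
- exact: (@same_graph_dummy R (total_graph P) e t ht).
- exact: same_graph_sym.
- exact: same_graph_trans.
Qed.

End SamePartition.

(** * Invariants of metric graphs *)
Lemma equivalence_sym (T : eqType) (r : rel T) : equivalence_rel r -> symmetric r.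
Proof.
move=> rE x y; apply/idP/idP => xy; first by have [_ <-] := rE x y x; have [] := rE x x x.
by have [_ <-] := rE y x y; have [] := rE y y y.
Qed.

Section Degrees.

Definition star (D : discrete_graph) (x : endpoint D) : {set endpoint D} :=
  [set y | glued x y]%SET.

Definition chained (D : discrete_graph) (e f : edge D) : bool :=
  [exists x : endpoint D, exists y : endpoint D,
    [&& x.1 == e, y.1 == f, glued x y & #|star x| == 2]].

Lemma chainedP (D : discrete_graph) (e f : edge D) :
  reflect (exists x y : endpoint D, [/\ x.1 = e, y.1 = f, glued x y & #|star x| = 2])
    (chained e f).
Proof.
apply: (iffP existsP) => [[x /existsP[y /and4P[/eqP ? /eqP ? ? /eqP ?]]]|[x [y [? ? ? ?]]]].
  by exists x, y.
by exists x; apply/existsP; exists y; apply/and4P; split=> //; apply/eqP.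
Qed.

Lemma star_relabel (D D' : discrete_graph) (phi : edge D -> edge D')
    (flip : edge D -> bool) : bijective phi ->
  (forall x y, glued (relabel_end phi flip x) (relabel_end phi flip y) = glued x y) ->
  forall x, #|star (relabel_end phi flip x)| = #|star x|.
Proof.
move=> bij gl x; have [psi [flip' [_ _ K1 K2]]] := relabel_inverse flip bij.
rewrite -(card_imset (mem (star x)) (can_inj K1)); apply: eq_card => y.
apply/idP/imsetP => [|[z]]; last by rewrite !inE => xz ->; rewrite gl.
by rewrite inE => xy; exists (relabel_end psi flip' y); rewrite ?inE -?gl K2.
Qed.

Lemma chained_relabel (D D' : discrete_graph) (phi : edge D -> edge D')
    (flip : edge D -> bool) : bijective phi ->
  (forall x y, glued (relabel_end phi flip x) (relabel_end phi flip y) = glued x y) ->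
  forall e f, connect (@chained D) e f = connect (@chained D') (phi e) (phi f).
Proof.
move=> bij gl e f; have [psi [flip' [phiK psiK K1 K2]]] := relabel_inverse flip bij.
have st := star_relabel bij gl.
apply/idP/idP.
  apply: connect_map => {}e {}f /chainedP[x [y [<- <- xy x2]]].
  apply/connect1/chainedP; exists (relabel_end phi flip x), (relabel_end phi flip y).
  by rewrite gl st.
rewrite -{2}[e]phiK -{2}[f]phiK.
apply: connect_map => {}e {}f /chainedP[x [y [<- <- xy x2]]].
apply/connect1/chainedP; exists (relabel_end psi flip' x), (relabel_end psi flip' y).
by rewrite -gl -st !K2.
Qed.

Section DummyDegrees.
Variables (D : discrete_graph) (e : edge D).
Let D1 := DiscreteGraph (dummy_rel_equiv e (@glued_equiv D)).

Lemma star_new_end (x : endpoint D) : #|star (new_end e x : endpoint D1)| = #|star x|.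
Proof.
rewrite -(card_imset (mem (star x)) (@new_end_inj _ e)); apply: eq_card => z.
apply/idP/imsetP => [|[y]]; last by rewrite !inE => xy ->; rewrite /= dummy_rel_new.
rewrite inE /= /dummy_rel new_endK; case zE : (old_end e z) => [y|] // xy.
by exists y; rewrite ?inE //; exact: old_endK.
Qed.

Lemma star_dummy (z : endpoint D1) : old_end e z = None -> #|star z| = 2.
Proof.
move=> zE; have -> : star z = [set (lift ord_max e, true); (ord_max, false)]%SET.
  apply/setP => w; rewrite !inE -old_end_None /= /dummy_rel zE.
  by case: (old_end e w).
by rewrite cards2 xpair_eqE andbF.
Qed.

(** The two parts of the subdivided edge meet at a vertex of degree two. *)
Lemma chained_dummy (z w : edge D1) :
  connect (@chained D1) z w = connect (@chained D) (old_edge e z) (old_edge e w).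
Proof.
have oldN u : old_end e u = None -> old_edge e u.1 = e.
  by move=> /eqP; rewrite old_end_None => /orP[] /eqP -> /=;
    rewrite ?old_edge_lift ?old_edge_max.
apply/idP/idP.
  apply: connect_map => {}z {}w /chainedP[x [y [<- <- xy x2]]].
  move: xy; rewrite /= /dummy_rel.
  case xE : (old_end e x) => [x'|]; case yE : (old_end e y) => [y'|] // xy.
    apply/connect1/chainedP; exists x', y'.
    by rewrite -x2 (old_endK xE) (old_endK yE) !old_edge_new_end star_new_end.
  by rewrite (oldN _ xE) (oldN _ yE) connect0.
have none1 : old_end e (lift ord_max e, true) = None by apply/eqP; rewrite old_end_None eqxx.
have none2 : old_end e (ord_max, false) = None by apply/eqP; rewrite old_end_None eqxx orbT.
have link1 : connect (@chained D1) (lift ord_max e) ord_max.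
  apply/connect1/chainedP; exists (lift ord_max e, true), (ord_max, false).
  by split => //; [rewrite /= /dummy_rel none1 none2|exact: star_dummy].
have link2 : connect (@chained D1) ord_max (lift ord_max e).
  apply/connect1/chainedP; exists (ord_max, false), (lift ord_max e, true).
  by split => //; [rewrite /= /dummy_rel none1 none2|exact: star_dummy].
have same u v : old_edge e u = old_edge e v -> connect (@chained D1) u v.
  case: (unliftP ord_max u) => [i ->|->]; case: (unliftP ord_max v) => [j ->|->];
    rewrite ?old_edge_lift ?old_edge_max => uv; rewrite -?uv ?connect0 //; by rewrite uv.
have lifts i j : connect (@chained D) i j ->
    connect (@chained D1) (lift ord_max i) (lift ord_max j).
  apply: connect_map => {}i {}j /chainedP[x [y [<- <- xy x2]]].
  apply: (@connect_trans _ _ (new_end e x).1).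
    by apply: same; rewrite old_edge_lift old_edge_new_end.
  apply: (@connect_trans _ _ (new_end e y).1); last first.
    by apply: same; rewrite old_edge_lift old_edge_new_end.
  apply/connect1/chainedP; exists (new_end e x), (new_end e y).
  by rewrite star_new_end /= dummy_rel_new.
move=> /lifts zw; apply: connect_trans (connect_trans zw _);
  by apply: same; rewrite old_edge_lift.
Qed.

End DummyDegrees.
End Degrees.

Section SameGraphInvariants.
Variable R : realType.

Definition total_length (G : metric_graph R) : R := \sum_(e : edge G) len e.

(** A chain is a maximal set of edges joined at vertices of degree two. *)
Definition chain_length (G : metric_graph R) (e : edge G) : R :=
  \sum_(f | connect (@chained G) e f) len f.

Definition essential_ends (G : metric_graph R) : nat := #|[set x : endpoint G | #|star x| != 2]%SET|.

(** Vertices of degree two do not separate chains, and they are not essential. *)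
Lemma same_graph_invariants (G H : metric_graph R) : same_graph G H ->
  [/\ total_length G = total_length H, essential_ends G = essential_ends H,
      range (@chain_length G) = range (@chain_length H) &
      graph_connected G <-> graph_connected H].
Proof.
elim=> {G H} [G H [phi [flip [bij lenE gl]]]|G e t ht|G H _ [h1 h2 h3 h4]|
    G H K _ [h1 h2 h3 h4] _ [k1 k2 k3 k4]].
- have [psi [flip' [phiK psiK K1 K2]]] := relabel_inverse flip bij.
  have st := star_relabel bij gl; have ch := chained_relabel bij gl.
  have sumE (P : pred (edge H)) : \sum_(j | P j) len j = \sum_(i | P (phi i)) len i.
    rewrite (reindex phi) /=; last by exists psi => i _; rewrite ?phiK ?psiK.
    by apply: eq_bigr => i _; rewrite lenE.
  split.
  + by rewrite /total_length sumE.
  + rewrite /essential_ends -(card_imset _ (can_inj K1)); apply: eq_card => y.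
    apply/imsetP/idP => [[x + ->]|]; first by rewrite !inE st.
    by rewrite inE => y2; exists (relabel_end psi flip' y); rewrite ?inE -?st K2.
  + have cl i : chain_length (phi i) = chain_length i.
      by rewrite /chain_length sumE; apply: eq_bigl => j; rewrite ch.
    apply/seteqP; split => _ [i _ <-]; first by exists (phi i).
    by exists (psi i); rewrite // -cl psiK.
  + apply: connected_iff (relabel_same_component bij gl) _ => j.
    by exists (psi j); rewrite psiK same_component_refl.
- have sumE (P : pred (edge G)) :
      \sum_(z | P (old_edge e z)) dummy_len e (@len R G) t z = \sum_(i | P i) len i.
    rewrite sum_dummy; apply: eq_bigr => i _; rewrite dummy_len_lift dummy_len_max.
    by case: eqP => [->|]; rewrite ?addr0 // addrC subrK.
  split.
  + by rewrite /total_length -(sumE predT).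
  + rewrite /essential_ends -(card_imset _ (@new_end_inj _ e)); apply: eq_card => z.
    apply/imsetP/idP => [[x + ->]|]; first by rewrite !inE star_new_end.
    rewrite inE; case zE : (old_end e z) => [x|]; last by rewrite star_dummy.
    by rewrite (old_endK zE) star_new_end => x2; exists x; rewrite ?inE.
  + have cl (z : edge (add_dummy ht)) : chain_length z = chain_length (old_edge e z).
      by rewrite /chain_length -sumE; apply: eq_bigl => w; exact: chained_dummy.
    apply/seteqP; split => _ [z _ <-]; last by exists (old_edge e z); rewrite ?cl.
    by exists (lift ord_max z : edge (add_dummy ht)); rewrite // cl old_edge_lift.
  + exact: iff_sym (connected_iff (@dummy_same_component G e) (@dummy_hits G e)).
- by split=> //; exact: iff_sym.
- by split; [rewrite h1|rewrite h2|rewrite h3|exact: iff_trans k4].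
Qed.

End SameGraphInvariants.

(** * Removing vertices of degree two *)
Section Merging.

(** So numbered, the merging of two edges at a vertex of degree two is the inverse
    of the insertion of a dummy vertex. *)
Lemma dummy_numbering n (x y : 'I_n * bool) : x.1 != y.1 ->
  exists m, n = m.+1 /\ exists (e : 'I_m) (phi : 'I_m.+1 -> 'I_n) (flip : 'I_m.+1 -> bool),
  [/\ bijective phi, relabel_end phi flip (lift ord_max e, true) = x &
      relabel_end phi flip (ord_max, false) = y].
Proof.
case: n x y => [[[]]//|m] [x bx] [y by_] /= xy; exists m; split => //.
pose s := tperm (ord_max : 'I_m.+1) y.
have sK : involutive s by move=> z; rewrite /s tpermK.
have sy : s ord_max = y by rewrite /s tpermL.
have sx : ord_max != s x by rewrite eq_sym -(inj_eq (can_inj sK)) sK sy.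
have [e eE _] := unlift_some sx.
exists e, s, (fun z => if z == ord_max then by_ else ~~ bx); split.
- by exists s.
- by rewrite /relabel_end /= -eE sK eq_sym (negbTE sx) /= negbK.
- by rewrite /relabel_end /= eqxx sy.
Qed.

Section MergedRelation.
Variables (m n : nat) (e : 'I_m) (phi : 'I_m.+1 -> 'I_n) (flip : 'I_m.+1 -> bool).
Variable r : rel ('I_n * bool).
Hypothesis rE : equivalence_rel r.

(** [ord_max] is merged into the edge [e]. *)
Definition merged_rel : rel ('I_m * bool) := fun a b =>
  r (relabel_end phi flip (new_end e a)) (relabel_end phi flip (new_end e b)).

Lemma merged_rel_equiv : equivalence_rel merged_rel.
Proof. by move=> a b c; exact: rE. Qed.

Lemma merged_relP : bijective phi ->
  (forall z, r (relabel_end phi flip (lift ord_max e, true)) z =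
     (z == relabel_end phi flip (lift ord_max e, true)) ||
     (z == relabel_end phi flip (ord_max, false))) ->
  forall z w, r (relabel_end phi flip z) (relabel_end phi flip w) =
              dummy_rel e merged_rel z w.
Proof.
move=> bij cls; have [psi [flip' [_ _ K1 K2]]] := relabel_inverse flip bij.
set x := relabel_end phi flip _ in cls.
have rS := equivalence_sym rE.
have cl z : r x (relabel_end phi flip z) = (old_end e z == None).
  by rewrite cls old_end_None !(can_eq K1).
have rel_x z w : old_end e z = None -> r (relabel_end phi flip z) (relabel_end phi flip w) =
    (old_end e w == None).
  move=> zE; have xz : r x (relabel_end phi flip z) by rewrite cl zE.
  by rewrite -cl; have [_ ->] := rE x (relabel_end phi flip z) (relabel_end phi flip w).
move=> z w; rewrite /dummy_rel.
case zE : (old_end e z) => [a|]; last by rewrite rel_x //; case: (old_end e w).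
case wE : (old_end e w) => [b|]; last by rewrite rS rel_x // zE.
by rewrite /merged_rel -(old_endK zE) -(old_endK wE).
Qed.

End MergedRelation.

Lemma star2_class (D : discrete_graph) (x y : endpoint D) : x != y -> glued x y ->
  #|star x| = 2 -> forall z, glued x z = (z == x) || (z == y).
Proof.
move=> xy gxy x2 z; suff : z \in star x = (z \in [set x; y]%SET) by rewrite !inE.
have -> // : star x = [set x; y]%SET; apply/esym/eqP; rewrite eqEcard x2 cards2 xy andbT.
by apply/fintype.subsetP => w; rewrite !inE => /orP[] /eqP -> //; have [] := glued_equiv x x x.
Qed.

End Merging.

(** * Contracting the edges of length zero *)
Section Presentation.
Variable R : realType.

Definition zero_step n (r : rel ('I_n * bool)) (l : 'I_n -> R) : rel ('I_n * bool) :=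
  fun x y => r x y || ((x.1 == y.1) && ~~ (0 < l x.1)).

(** [H] is the contraction of the edges of length zero.  To say so up to numbering
    and orientation spares the enumeration of the surviving edges, and determines
    [H] as a metric graph ([presents_unique]). *)
Definition presents (H : metric_graph R) n (r : rel ('I_n * bool)) (l : 'I_n -> R) : Prop :=
  exists (phi : edge H -> 'I_n) (flip : edge H -> bool),
  [/\ injective phi, forall i, (i \in codom phi) = (0 < l i),
      forall e, len e = l (phi e) &
      forall x y, glued x y =
        connect (zero_step r l) (relabel_end phi flip x) (relabel_end phi flip y)].

Lemma relabel_id m n (phi : 'I_m -> 'I_n) x : relabel_end phi (fun _ => false) x = (phi x.1, x.2).
Proof. by rewrite /relabel_end addbF. Qed.

Lemma presents_contract (D : discrete_cut) (l : edge D -> R) :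
  presents (total_graph (contract l)) (@glued D) l.
Proof.
exists (fun i => enum_val i), (fun _ => false); split => //.
- exact: enum_val_inj.
- move=> i; apply/codomP/idP => [[j ->]|li]; first exact: (kept_len_gt0 j).
  have ki : i \in kept_edges l by rewrite inE.
  by exists (enum_rank_in ki i); rewrite enum_rankK_in.
- by move=> x y; rewrite !relabel_id.
Qed.

Lemma presents_unique (H K : metric_graph R) n (r : rel ('I_n * bool)) (l : 'I_n -> R) :
  presents H r l -> presents K r l -> same_graph H K.
Proof.
move=> [phi [flip [phiI phiC phiL phiG]]] [phi' [flip' [phiI' phiC' phiL' phiG']]].
have h e : phi e \in codom phi' by rewrite phiC' -phiC codom_f.
pose psi e := iinv (h e).
have psiE e : phi' (psi e) = phi e by exact: f_iinv.
apply: same_graph_relabel; exists psi, (fun e => flip e (+) flip' (psi e)); split.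
- apply: inj_card_bij.
    by move=> e f /(congr1 phi'); rewrite !psiE; exact: phiI.
  rewrite -(card_codom phiI') -(card_codom phiI).
  by apply: eq_leq; apply: eq_card => i; rewrite phiC phiC'.
- by move=> e; rewrite phiL' psiE phiL.
- have E x : relabel_end phi' flip' (relabel_end psi (fun e => flip e (+) flip' (psi e)) x) =
      relabel_end phi flip x.
    by rewrite /relabel_end /= psiE -!addbA addbb addbF.
  by move=> x y; rewrite phiG' !E phiG.
Qed.

Section Relabelled.
Variables (m n : nat) (phi : 'I_m -> 'I_n) (flip : 'I_m -> bool).
Variables (r : rel ('I_m * bool)) (r' : rel ('I_n * bool)) (l : 'I_m -> R) (l' : 'I_n -> R).
Hypothesis bij : bijective phi.
Hypothesis rE : forall x y, r' (relabel_end phi flip x) (relabel_end phi flip y) = r x y.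
Hypothesis lE : forall i, l' (phi i) = l i.

Lemma connect_zero_relabel x y : connect (zero_step r l) x y =
  connect (zero_step r' l') (relabel_end phi flip x) (relabel_end phi flip y).
Proof.
have [psi [flip' [phiK psiK K1 K2]]] := relabel_inverse flip bij.
have st a b : zero_step r' l' (relabel_end phi flip a) (relabel_end phi flip b) =
    zero_step r l a b.
  by rewrite /zero_step rE /= lE (inj_eq (bij_inj bij)).
apply/idP/idP => [|h].
  by apply: connect_map => a b ab; apply: connect1; rewrite st.
rewrite -(K1 x) -(K1 y); move: h.
by apply: connect_map => a b ab; apply: connect1; rewrite -st !K2.
Qed.

Lemma presents_relabel (H : metric_graph R) : presents H r l -> presents H r' l'.
Proof.
have [psi [flip' [phiK psiK K1 K2]]] := relabel_inverse flip bij.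
move=> [phi0 [flip0 [phiI phiC phiL phiG]]].
exists (fun e => phi (phi0 e)), (fun e => flip0 e (+) flip (phi0 e)); split.
- by move=> e f /(bij_inj bij); exact: phiI.
- move=> i; rewrite -(psiK i) lE -phiC psiK.
  apply/codomP/codomP => [[e ->]|[e ie]]; exists e; first by rewrite phiK.
  by rewrite -ie psiK.
- by move=> e; rewrite lE.
- move=> x y; rewrite phiG connect_zero_relabel /relabel_end /=.
  by rewrite !addbA.
Qed.

(** The edges of length zero form a forest: every assignment of differences to
    them is realized by a function of the vertices. *)
Definition potentials n (r : rel ('I_n * bool)) (l : 'I_n -> R) : Prop :=
  forall d : 'I_n -> R, exists h : 'I_n * bool -> R,
    (forall x y, r x y -> h x = h y) /\
    (forall i, ~~ (0 < l i) -> h (i, true) - h (i, false) = d i).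

Lemma potentials_relabel : potentials r l -> potentials r' l'.
Proof.
have [psi [flip' [phiK psiK K1 K2]]] := relabel_inverse flip bij.
move=> pot d; have [h [hr hl]] := pot (fun i => if flip i then - d (phi i) else d (phi i)).
exists (fun x => h (relabel_end psi flip' x)); split => [x y xy|i li].
  by apply: hr; rewrite -rE !K2.
have /= := hl (psi i); rewrite -lE psiK => /(_ li).
have E b : relabel_end psi flip' (i, b) = (psi i, b (+) flip (psi i)).
  apply: (can_inj K1); rewrite K2 /relabel_end /= psiK -addbA addbb addbF //.
by rewrite !E /=; case: (flip (psi i)) => /= hE; lra.
Qed.

End Relabelled.

Section DummyContraction.
Variables (m : nat) (e : 'I_m) (r : rel ('I_m * bool)) (l : 'I_m -> R) (t : R).
Hypotheses (rE : equivalence_rel r) (t_ge0 : 0 <= t) (t_le : t <= l e).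

Let r1 := dummy_rel e r.
Let l1 := dummy_len e l t.
Let step1 := zero_step r1 l1.

Let step1C : connect_sym step1.
Proof.
apply: sym_connect_sym => x y; rewrite /step1 /zero_step /r1.
rewrite (equivalence_sym (dummy_rel_equiv e rE) x y) [y.1 == _]eq_sym.
by case: eqP => //= ->.
Qed.

Let len_lift i : i != e -> l1 (lift ord_max i) = l i.
Proof. by move=> ie; rewrite /l1 dummy_len_lift (negbTE ie). Qed.

Let len_e : l1 (lift ord_max e) = t.
Proof. by rewrite /l1 dummy_len_lift eqxx. Qed.

Let len_max : l1 ord_max = l e - t.
Proof. by rewrite /l1 dummy_len_max. Qed.

Let joint : connect step1 (lift ord_max e, true) (ord_max, false).
Proof.
apply: connect1; rewrite /step1 /zero_step /r1 /dummy_rel.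
have /eqP -> : old_end e (lift ord_max e, true) == None by rewrite old_end_None eqxx.
by have /eqP -> : old_end e (ord_max, false) == None by rewrite old_end_None eqxx orbT.
Qed.

Let zero_edge i b c : ~~ (0 < l1 i) -> connect step1 (i, b) (i, c).
Proof. by move=> li; apply: connect1; rewrite /step1 /zero_step /= eqxx li orbT. Qed.

Lemma connect_zero_dummy a b :
  connect (zero_step r l) a b = connect step1 (new_end e a) (new_end e b).
Proof.
apply/idP/idP.
  apply: connect_map => {}a {}b /orP[ab|].
    by apply: connect1; rewrite /step1 /zero_step /r1 dummy_rel_new ab.
  case: a b => [i b] [_ c] /= /andP[/eqP<- li].
  rewrite /new_end /=; have [ie|ie] := eqVneq i e; last first.
    by apply: zero_edge; rewrite len_lift.
  rewrite ie -leNgt in li *.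
  have z1 : ~~ (0 < l1 (lift ord_max e)) by rewrite len_e -leNgt; exact: le_trans t_le li.
  have z2 : ~~ (0 < l1 ord_max).
    by rewrite len_max -leNgt subr_le0; exact: le_trans li t_ge0.
  have fwd b' : connect step1 (lift ord_max e, b') (ord_max, true).
    apply: connect_trans (zero_edge _ true z1) _.
    exact: connect_trans joint (zero_edge _ _ z2).
  case: b c => -[] /=; rewrite ?connect0 //.
  by rewrite step1C.
(* the dummy vertex goes to that end of [e] with which a vanishing part of [e]
   identifies it *)
pose f z := odflt (if 0 < t then (e, true) else (e, false)) (old_end e z).
have fK x : f (new_end e x) = x by rewrite /f new_endK.
move=> h; rewrite -(fK a) -(fK b); move: h.
apply: connect_map => {}a {}b /orP[|].
  rewrite /r1 /dummy_rel /f; case: (old_end e a) (old_end e b) => [x|] [y|] //= xy.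
  by apply: connect1; rewrite /zero_step xy.
case: a b => [z b] [_ c] /= /andP[/eqP<-].
have zE i : ~~ (0 < l i) -> connect (zero_step r l) (i, b) (i, c).
  by move=> li; apply: connect1; rewrite /zero_step /= eqxx li orbT.
have zE' b' c' : ~~ (0 < l e) -> connect (zero_step r l) (e, b') (e, c').
  by move=> li; apply: connect1; rewrite /zero_step /= eqxx li orbT.
rewrite /f /old_end /=; case: unliftP => [i ->|->].
  have [->|ie] := eqVneq i e; last by rewrite len_lift //=; exact: zE.
  by rewrite len_e => /negbTE ->; case: b c {zE} => -[]; rewrite /= connect0.
rewrite len_max; have [t0|t0] := boolP (0 < t); first by case: b c {zE} => -[]; rewrite /= connect0.
move=> le; by case: b c {zE} => -[]; rewrite /= ?connect0 // zE' //;
  rewrite -!leNgt in le t0 *; apply: le_trans _ t0; rewrite -subr_le0.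
Qed.

Section UnflippedGraph.
Variables (K : metric_graph R) (phi : edge K -> 'I_m).
Hypothesis phiI : injective phi.
Hypothesis phiC : forall i, (i \in codom phi) = (0 < l i).
Hypothesis phiL : forall j, len j = l (phi j).
Hypothesis phiG : forall x y, glued x y =
  connect (zero_step r l) (phi x.1, x.2) (phi y.1, y.2).

Let codom_lift i : (lift ord_max i \in codom (lift ord_max \o phi)) = (0 < l i).
Proof.
rewrite -phiC; apply/codomP/codomP => [[j /lift_inj ij]|[j ->]]; by exists j.
Qed.

Lemma presents_dummy_right : ~~ (0 < t) -> presents K r1 l1.
Proof.
move=> t0; have tE : t = 0 by apply/eqP; rewrite eq_le t_ge0 leNgt t0.
pose psi j := if phi j == e then ord_max else lift ord_max (phi j).
exists psi, (fun _ => false); split.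
- move=> i j; rewrite /psi; case: (eqVneq (phi i) e) => ie; case: (eqVneq (phi j) e) => je.
  + by move=> _; apply: phiI; rewrite ie.
  + by move=> /eqP; rewrite (negbTE (neq_lift _ _)).
  + by move=> /esym/eqP; rewrite (negbTE (neq_lift _ _)).
  + by move=> /lift_inj/phiI.
- move=> z; case: (unliftP ord_max z) => [i ->|->].
    have [->|ie] := eqVneq i e.
      rewrite len_e (negbTE t0); apply/negP => /codomP[j]; rewrite /psi.
      case: eqVneq => [_ /eqP|je /lift_inj ej]; last by rewrite ej eqxx in je.
      by rewrite eq_sym (negbTE (neq_lift _ _)).
    rewrite len_lift // -phiC; apply/codomP/codomP => [[j ij]|[j ij]]; exists j.
      move: ij; rewrite /psi; case: eqVneq => [_ /eqP|_ /lift_inj //].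
      by rewrite eq_sym (negbTE (neq_lift _ _)).
    by rewrite /psi -ij (negbTE ie).
  rewrite len_max tE subr0 -phiC; apply/codomP/codomP => [[j ij]|[j ij]]; exists j.
    move: ij; rewrite /psi; case: eqVneq => // _ /eqP.
    by rewrite (negbTE (neq_lift _ _)).
  by rewrite /psi -ij eqxx.
- move=> j; rewrite phiL /psi; case: eqVneq => [->|je]; last by rewrite len_lift.
  by rewrite len_max tE subr0.
- have E x : connect step1 (psi x.1, x.2) (new_end e (phi x.1, x.2)).
    rewrite /psi /new_end /=; case: eqVneq => [->|_]; rewrite /= ?connect0 //.
    case: x => j [] /=; rewrite ?connect0 // step1C.
    by apply: connect_trans joint; apply: zero_edge; rewrite len_e.
  move=> x y; rewrite !relabel_id phiG connect_zero_dummy.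
  by rewrite (same_connect step1C (E x)) (same_connect_r step1C (E y)).
Qed.

Lemma presents_dummy_left : 0 < t -> ~~ (0 < l e - t) -> presents K r1 l1.
Proof.
move=> t0 t1; have tE : t = l e by apply/eqP; rewrite eq_le t_le -subr_le0 leNgt t1.
exists (lift ord_max \o phi), (fun _ => false); split.
- by move=> i j /lift_inj/phiI.
- move=> z; case: (unliftP ord_max z) => [i ->|->].
    rewrite codom_lift; have [->|ie] := eqVneq i e; last by rewrite len_lift.
    by rewrite len_e -tE.
  rewrite len_max (negbTE t1); apply/negP => /codomP[j /eqP].
  by rewrite (negbTE (neq_lift _ _)).
- move=> j; rewrite phiL /=; have [->|je] := eqVneq (phi j) e; last by rewrite len_lift.
  by rewrite len_e -tE.
- have E x : connect step1 (lift ord_max (phi x.1), x.2) (new_end e (phi x.1, x.2)).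
    rewrite /new_end /=; case: ifP => [/andP[/eqP -> ->]|_]; rewrite ?connect0 //.
    by apply: connect_trans joint (zero_edge _ _ _); rewrite len_max.
  move=> x y; rewrite !relabel_id phiG connect_zero_dummy /=.
  by rewrite (same_connect step1C (E x)) (same_connect_r step1C (E y)).
Qed.

Lemma presents_dummy_inside : 0 < t -> 0 < l e - t ->
  exists2 H : metric_graph R, same_graph K H & presents H r1 l1.
Proof.
move=> t0 t1; have l0 : 0 < l e by move: t0 t1; rewrite subr_gt0; exact: lt_trans.
have /codomP[k kE] : e \in codom phi by rewrite phiC.
have tk : 0 < t < len k by rewrite t0 phiL -kE -subr_gt0.
exists (add_dummy tk); first exact: same_graph_dummy.
pose psi (z : 'I_(nedges K).+1) := if unlift ord_max z is Some j then lift ord_max (phi j) else ord_max.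
have psi_lift j : psi (lift ord_max j) = lift ord_max (phi j) by rewrite /psi liftK.
have psi_max : psi ord_max = ord_max by rewrite /psi unlift_none.
have psi_new x : (psi (new_end k x).1, (new_end k x).2) = new_end e (phi x.1, x.2).
  rewrite /new_end /= kE (inj_eq phiI); case: ifP => _ /=; first by rewrite psi_max.
  by rewrite psi_lift.
have psi_old z : (old_end e (psi z.1, z.2) == None) = (old_end k z == None).
  rewrite !old_end_None; case: z => z b /=; rewrite !xpair_eqE.
  case: (unliftP ord_max z) => [j ->|->].
    by rewrite psi_lift !(inj_eq (@lift_inj _ _)) kE (inj_eq phiI) !(eq_sym _ ord_max)
         !(negbTE (neq_lift _ _)).
  by rewrite psi_max !(negbTE (neq_lift _ _)) !eqxx.
(* the new dummy vertex is met by no edge of length zero *)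
have apart z w : connect step1 z w -> (old_end e z == None) = (old_end e w == None).
  suff cl : fingraph.closed step1 [pred z | old_end e z == None] by exact: (closed_connect cl).
  move=> {}z {}w /orP[|]; rewrite !inE.
    by rewrite /r1 /dummy_rel; case: (old_end e z) (old_end e w) => [x|] [y|].
  move=> /andP[/eqP zw zl]; rewrite !old_end_None.
  have N b : (z.1, b) != (lift ord_max e, true) /\ (z.1, b) != (ord_max, false).
    split; apply/eqP => -[zE _]; move: zl; rewrite zE ?len_e ?len_max ?t0 ?t1 //.
  rewrite [z]surjective_pairing [w]surjective_pairing -zw.
  by case: (N z.2) (N w.2) => [/negbTE -> /negbTE ->] [/negbTE -> /negbTE ->].
exists psi, (fun _ => false); split.
- move=> z w; case: (unliftP ord_max z) => [i ->|->]; case: (unliftP ord_max w) => [j ->|->];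
    rewrite ?psi_lift ?psi_max //.
  + by move=> /lift_inj/phiI ->.
  + by move=> /esym/eqP; rewrite (negbTE (neq_lift _ _)).
  + by move=> /eqP; rewrite (negbTE (neq_lift _ _)).
- move=> z; case: (unliftP ord_max z) => [i ->|->]; last first.
    by rewrite len_max t1; apply/codomP; exists ord_max; rewrite psi_max.
  have -> : (0 < l1 (lift ord_max i)) = (i \in codom phi).
    rewrite phiC; have [->|ie] := eqVneq i e; last by rewrite len_lift.
    by rewrite len_e t0 l0.
  apply/codomP/codomP => [[w]|[j ->]]; last by exists (lift ord_max j); rewrite psi_lift.
  case: (unliftP ord_max w) => [j ->|->]; rewrite ?psi_lift ?psi_max.
    by move=> /lift_inj ->; exists j.
  by move=> /eqP; rewrite eq_sym (negbTE (neq_lift _ _)).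
- move=> z; case: (unliftP ord_max z) => [i ->|->]; rewrite /len /= ?psi_lift ?psi_max.
    rewrite dummy_len_lift; have [->|ik] := eqVneq i k; first by rewrite -kE len_e.
    by rewrite len_lift ?phiL // kE (inj_eq phiI).
  by rewrite dummy_len_max len_max phiL -kE.
- move=> z w; rewrite !relabel_id /= /dummy_rel.
  case zE : (old_end k z) => [x|]; case wE : (old_end k w) => [y|].
  + by rewrite (old_endK zE) (old_endK wE) !psi_new -connect_zero_dummy phiG.
  + by apply/esym/negP => /apart; rewrite !psi_old zE wE.
  + by apply/esym/negP => /apart; rewrite !psi_old zE wE.
  + apply/esym/connect1; rewrite /step1 /zero_step /r1 /dummy_rel.
    have /eqP -> : old_end e (psi z.1, z.2) == None by rewrite psi_old zE.
    by have /eqP -> : old_end e (psi w.1, w.2) == None by rewrite psi_old wE.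
Qed.

End UnflippedGraph.

(** A dummy vertex at an end of an edge splits off an edge of length zero, which is
    contracted again; elsewhere it is a dummy vertex of the contraction. *)
Lemma presents_dummy (H : metric_graph R) : presents H r l ->
  exists2 H2 : metric_graph R, same_graph H H2 & presents H2 r1 l1.
Proof.
pose T := @DiscreteCut (DiscreteGraph rE) r rE (fun _ _ => id).
move=> Hp; pose K := total_graph (@contract R T l).
have HK : same_graph H K by apply: presents_unique Hp _; exact: (@presents_contract T l).
have phiC i : (i \in codom (fun j : edge K => enum_val j)) = (0 < l i).
  apply/codomP/idP => [[j ->]|li]; first exact: (@kept_len_gt0 R T l j).
  have ki : i \in @kept_edges R T l by rewrite inE.
  by exists (enum_rank_in ki i); rewrite enum_rankK_in.
have [t0|t0] := boolP (0 < t); last first.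
  by exists K => //; apply: presents_dummy_right t0 => //; exact: enum_val_inj.
have [t1|t1] := boolP (0 < l e - t); last first.
  by exists K => //; apply: presents_dummy_left t0 t1 => //; exact: enum_val_inj.
have [||||H2 KH2 H2p] := @presents_dummy_inside K (fun j => enum_val j) _ _ _ _ t0 t1 => //.
  exact: enum_val_inj.
by exists H2 => //; exact: same_graph_trans HK KH2.
Qed.

(** The difference prescribed for a vanishing edge is the sum of those prescribed for
    its two parts. *)
Lemma potentials_dummy : potentials r l -> potentials r1 l1.
Proof.
move=> pot d.
have [h [hr hl]] := pot (fun i => d (lift ord_max i) + if i == e then d ord_max else 0).
pose hN := if 0 < t then h (e, true) - d ord_max else h (e, false) + d (lift ord_max e).
exists (fun z => if old_end e z is Some x then h x else hN); split.
  move=> x y; rewrite /r1 /dummy_rel.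
  by case: (old_end e x) (old_end e y) => [a|] [b|] //; exact: hr.
move=> z; have liftE b : (lift ord_max e, b) = if b then (lift ord_max e, true) else new_end e (e, b).
  by case: b; rewrite // /new_end /= andbF.
have oN1 : old_end e (lift ord_max e, true) = None by apply/eqP; rewrite old_end_None eqxx.
have oN2 : old_end e (ord_max, false) = None by apply/eqP; rewrite old_end_None eqxx orbT.
have oS1 : old_end e (lift ord_max e, false) = Some (e, false).
  by rewrite -(new_endK e (e, false)) /new_end /= andbF.
have oS2 : old_end e (ord_max, true) = Some (e, true).
  by rewrite -(new_endK e (e, true)) /new_end /= eqxx.
have oS i b : i != e -> old_end e (lift ord_max i, b) = Some (i, b).
  by move=> ie; rewrite -(new_endK e (i, b)) /new_end /= (negbTE ie).
case: (unliftP ord_max z) => [i ->|->].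
  have [->|ie] := eqVneq i e.
    by rewrite len_e oN1 oS1 /hN => /negbTE ->; lra.
  by rewrite len_lift // !oS // => /hl; rewrite (negbTE ie) => ->; rewrite addr0.
rewrite len_max oS2 oN2 /hN => lt; have [t0|t0] := boolP (0 < t); first lra.
have le : ~~ (0 < l e).
  rewrite -!leNgt in t0 lt *; rewrite subr_le0 in lt; exact: le_trans lt t0.
by have := hl e le; rewrite eqxx; lra.
Qed.

End DummyContraction.
End Presentation.

(** * Limits of representatives of a metric graph *)
Section Limits.
Variables (R : realType) (G : metric_graph R).

(** Without vertices of degree two that could be removed, each edge is a chain;
    there are only finitely many lengths of chains in [G], hence the sequence
    is eventually constant. *)
Lemma limit_unmergeable n (r : rel ('I_n * bool)) (rE : equivalence_rel r)
    (u : nat -> 'I_n -> R) (l : 'I_n -> R) (u_gt0 : forall k i, 0 < u k i) :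
  let D := DiscreteGraph rE in
  (forall i, u k i @[k --> \oo] --> l i) ->
  (forall k, same_graph G (@MetricGraph R D (u k) (u_gt0 k))) ->
  (forall x y : endpoint D, x.1 != y.1 -> glued x y -> #|star x| != 2) ->
  (exists2 H : metric_graph R, same_graph G H & presents H r l) /\ potentials r l.
Proof.
move=> D ul Gu red.
have chainE (e f : edge D) : connect (@chained D) e f = (e == f).
  apply/idP/eqP => [/connectP[s pth ->]|->]; last exact: connect0.
  elim: s e pth => [|f' s IH] e //= /andP[/chainedP[x [y [xe yf xy x2]]] /IH <-].
  by have := red x y; rewrite xe yf xy x2; case: eqVneq => // _ /(_ isT isT).
have chain k (i : 'I_n) : exists g : edge G, u k i = chain_length g.
  have [_ _ rg _] := same_graph_invariants (Gu k).
  have : range (@chain_length R (@MetricGraph R D (u k) (u_gt0 k))) (u k i).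
    exists i => //; rewrite /chain_length.
    by rewrite (eq_bigl (pred1 i)) ?big_pred1_eq // => j; rewrite chainE eq_sym.
  by rewrite -rg => -[g _ <-]; exists g.
have [k kl] : exists k, u k =1 l.
  have : \forall k \near \oo, forall i, forall g : edge G, u k i = chain_length g -> u k i = l i.
    apply: filter_forall => i; apply: filter_forall => g.
    have [->|ne] := eqVneq (chain_length g) (l i); first by near=> k.
    have pos : 0 < `|chain_length g - l i| by rewrite normr_gt0 subr_eq0.
    near=> k => ug; have : `|l i - u k i| < `|chain_length g - l i|.
      by near: k; apply: cvgr_dist_lt (ul i) _ pos.
    by rewrite ug distrC ltxx.
  by case=> k0 _ /(_ k0 (leqnn _)) h; exists k0 => i; have [g /h] := chain k0 i.
have l_gt0 i : 0 < l i by rewrite -(kl i).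
have step x y : zero_step r l x y = r x y by rewrite /zero_step l_gt0 andbF orbF.
split; last by move=> d; exists (fun _ => 0); split => // i; rewrite l_gt0.
exists (@MetricGraph R D (u k) (u_gt0 k)) => //.
exists (fun i => i), (fun _ => false); split => //.
- by move=> i; rewrite l_gt0; apply/codomP; exists i.
- move=> [i b] [j c]; rewrite !relabel_id /= (eq_connect step).
  apply/idP/connectP => [xy|[s + ->]]; first by exists [:: (j, c)]; rewrite //= xy.
  elim: s (i, b) => [|y s IH] x /=; first by have [] := rE x x x.
  by move=> /andP[xy /IH]; have [_ ->] := rE x y (last y s).
Unshelve. all: by end_near.
Qed.

(** A removable vertex of degree two stays removable in the limit: merge its two
    edges, pass to the limit, and split the limit edge again. *)
Lemma limit_presents n (r : rel ('I_n * bool)) (rE : equivalence_rel r)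
    (u : nat -> 'I_n -> R) (l : 'I_n -> R) (u_gt0 : forall k i, 0 < u k i) :
  (forall i, u k i @[k --> \oo] --> l i) ->
  (forall k, same_graph G (@MetricGraph R (DiscreteGraph rE) (u k) (u_gt0 k))) ->
  (exists2 H : metric_graph R, same_graph G H & presents H r l) /\ potentials r l.
Proof.
elim: n r rE u l u_gt0 => [|m IH] r rE u l u_gt0 ul Gu.
  by apply: (limit_unmergeable ul Gu) => -[[]].
pose D := DiscreteGraph rE.
have [/existsP[x /existsP[y /and3P[xy gxy /eqP x2]]]|/existsPn red] :=
    boolP [exists x : endpoint D, exists y : endpoint D,
      [&& x.1 != y.1, glued x y & #|star x| == 2]]; last first.
  apply: (limit_unmergeable ul Gu) => x y xy gxy; apply: contraNN (red x) => x2.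
  by apply/existsP; exists y; rewrite xy gxy x2.
have [m' [[mm'] [e [phi [flip [bij xE yE]]]]]] := dummy_numbering xy; subst m'.
have cls z : r (relabel_end phi flip (lift ord_max e, true)) z =
     (z == relabel_end phi flip (lift ord_max e, true)) ||
     (z == relabel_end phi flip (ord_max, false)).
  rewrite xE yE; apply: (@star2_class D x y) => //.
  by apply: contraNN xy => /eqP ->.
have relE := merged_relP rE bij cls.
set r' := merged_rel e phi flip r in relE.
have rE' : equivalence_rel r' by exact: merged_rel_equiv.
pose merge (v : 'I_m.+1 -> R) (i : 'I_m) :=
  v (phi (lift ord_max i)) + if i == e then v (phi ord_max) else 0.
have split_len v z : v (phi z) =
    dummy_len e (merge v) (v (phi (lift ord_max e))) z.
  case: (unliftP ord_max z) => [i ->|->]; rewrite ?dummy_len_lift ?dummy_len_max /merge.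
    by case: eqP => [->|_]; rewrite ?addr0.
  by rewrite eqxx addrC addKr.
have u'_gt0 k i : 0 < merge (u k) i.
  by rewrite /merge; case: eqP => _; rewrite ?addr0 ?addr_gt0.
have ul' i : merge (u k) i @[k --> \oo] --> merge l i.
  rewrite /merge; case: eqP => _; first by apply: cvgD; exact: ul.
  by rewrite addr0; under eq_fun do rewrite addr0; exact: ul.
have l_ge0 i : 0 <= l i.
  rewrite leNgt; apply/negP => li; have [k0 _ /(_ k0 (leqnn _))] := cvgr_lt _ (ul i) _ li.
  by rewrite ltNge ltW.
have Gu' k : same_graph G (@MetricGraph R (DiscreteGraph rE') (merge (u k)) (u'_gt0 k)).
  apply: same_graph_trans (Gu k) (same_graph_sym _).
  have t_in : 0 < u k (phi (lift ord_max e)) < merge (u k) e.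
    by rewrite u_gt0 /merge eqxx ltrDl u_gt0.
  apply: same_graph_trans (@same_graph_dummy R (@MetricGraph R (DiscreteGraph rE')
    (merge (u k)) (u'_gt0 k)) e _ t_in) _.
  by apply: same_graph_relabel; exists phi, flip; split.
have [[H GH Hp] pot] := IH _ rE' _ _ u'_gt0 ul' Gu'.
have t_le : l (phi (lift ord_max e)) <= merge l e by rewrite /merge eqxx lerDl.
have [H2 HH2 H2p] := presents_dummy rE' (l_ge0 _) t_le Hp.
have lenE z : l (phi z) = dummy_len e (merge l) (l (phi (lift ord_max e))) z by [].
split.
  exists H2; first exact: same_graph_trans GH HH2.
  exact: (presents_relabel bij relE lenE H2p).
exact: (potentials_relabel bij relE lenE (potentials_dummy _ _ pot)).
Unshelve. all: by end_near.
Qed.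

Lemma limit_presents_graph (D : discrete_graph) (u : nat -> edge D -> R) (l : edge D -> R)
    (u_gt0 : forall k i, 0 < u k i) :
  (forall i, u k i @[k --> \oo] --> l i) ->
  (forall k, same_graph G (@MetricGraph R D (u k) (u_gt0 k))) ->
  (exists2 H : metric_graph R, same_graph G H & presents H (@glued D) l) /\
  potentials (@glued D) l.
Proof. by case: D u l u_gt0 => n r rE u l u_gt0; exact: limit_presents. Qed.

End Limits.

Section Acyclicity.
Variable R : realType.

(** Walking along edges of length zero cannot lead from one piece of a vertex
    to another one: along a simple walk, the potential which charges only its
    first edge of length zero would change. *)
Lemma zero_connect_glued n (r c : rel ('I_n * bool)) (l : 'I_n -> R) :
  equivalence_rel c -> subrel c r -> potentials r l ->
  forall x y, r x y -> connect (zero_step c l) x y -> c x y.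
Proof.
move=> cE cr pot x y rxy /connectP[s0 pth0 yE].
have [s [pth us yE']] : exists s, [/\ path (zero_step c l) x s, uniq (x :: s) & y = last x s].
  by case/shortenP: pth0 yE => s pth us _ yE; exists s.
have cR a : c a a by have [] := cE a a a.
have cT a b d : c a b -> c b d -> c a d by move=> ab; have [_ <-] := cE a b d.
have split_walk : forall s x, path (zero_step c l) x s -> uniq (x :: s) ->
    c x (last x s) \/ exists v w s2, [/\ c x v, v.1 = w.1 /\ v != w, ~~ (0 < l v.1),
      path (zero_step c l) w s2 & [/\ v \notin s2, w \notin s2 & last w s2 = last x s]].
  elim=> [|z s' IH] a /=; first by left.
  rewrite inE negb_or => /andP [xz pz] /and3P[/andP[nxz xs] zs us'].
  move: xz => /orP[cxz|/andP[/eqP xz lx]]; last first.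
    by right; exists a, z, s'; split.
  have [|h|[v [w [s2 [zv vw lv p2 [h1 h2 h3]]]]]] := IH z pz; first by rewrite /= zs us'.
    by left; exact: cT cxz h.
  by right; exists v, w, s2; split => //; exact: cT cxz zv.
have [|[v [w [s2 [xv [vw nvw] lv p2 [h1 h2 h3]]]]]] := split_walk s x pth us.
  by rewrite -yE'.
have [h [hr hl]] := pot (fun i => (i == v.1)%:R).
have rest : forall s2 w, path (zero_step c l) w s2 -> (forall b, b \in s2 -> b.1 != v.1) ->
    h w = h (last w s2).
  elim=> [|b s' IH] a //= /andP[ab pb] av.
  rewrite -(IH b pb) => [|d ds]; last by apply: av; rewrite inE ds orbT.
  move: ab => /orP[/cr/hr//|/andP[/eqP ab la]].
  have := av b; rewrite inE eqxx -ab => /(_ isT) nv.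
  have := hl a.1 la; rewrite (negbTE nv) => /eqP; rewrite subr_eq0 => /eqP E.
  by case: a b ab {la nv av pb} E => [i []] [_ []] /= <-.
have hy : h x = h w.
  rewrite (hr x y rxy) yE' -h3; apply/esym/rest => // b bs; apply/eqP => bv.
  have : (b == v) || (b == w).
    move: vw nvw bv; case: (b) (v) (w) => [i b1] [j b2] [_ b3] /= <- + ->.
    by rewrite /eq_op /= eqxx /=; case: b1 b2 b3 => -[] [].
  by move=> /orP[] /eqP E; rewrite E in bs; rewrite bs in h1 h2.
have := hl v.1 lv; rewrite eqxx => hv.
have xvE := hr _ _ (cr _ _ xv).
exfalso; move: vw nvw hv xvE hy; case: (v) (w) => [i b] [_ b'] /= <-.
rewrite /eq_op /= eqxx /=; case: b b' => -[] //= _ hv -> hy; move: hv; rewrite hy subrr.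
  by move=> /eqP; rewrite eq_sym oner_eq0.
by move=> /eqP; rewrite eq_sym oner_eq0.
Qed.
End Acyclicity.

(** * The contraction of a limit *)
Section ContractedPartition.
Variables (R : realType) (D : discrete_cut) (l : edge D -> R).
Hypothesis l_ge0 : forall i, 0 <= l i.
Hypothesis clusters_survive : forall C, C \in clusters D -> exists2 i, i \in C & 0 < l i.
Hypothesis l_pot : potentials (@glued D) l.

Let Q := contract l.
Let pi (x : endpoint Q) : endpoint D := (enum_val x.1, x.2).
Let zs := zero_step (@cut D) l.

Let cutC : symmetric (@cut D). Proof. exact/equivalence_sym/cut_equiv. Qed.

Let zsC : connect_sym zs.
Proof.
apply: sym_connect_sym => x y; rewrite /zs /zero_step cutC [y.1 == _]eq_sym.
by case: eqP => //= ->.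
Qed.

Let cutQE (x y : endpoint Q) : cut x y = connect zs (pi x) (pi y).
Proof. by []. Qed.

Let gluedQE (x y : endpoint Q) : glued x y = connect (zero_step (@glued D) l) (pi x) (pi y).
Proof. by []. Qed.

Let pi_surj (x : endpoint D) : 0 < l x.1 -> exists y, pi y = x.
Proof.
case: x => i b /= li; have ki : i \in kept_edges l by rewrite inE.
by exists (enum_rank_in ki i, b); rewrite /pi /= enum_rankK_in.
Qed.

Let linked_cut : subrel zs (@linked (cut_discrete D)).
Proof. by move=> x y /orP[xy|/andP[xy _]]; rewrite /linked /= ?xy ?orbT. Qed.

Let zs_component x y : connect zs x y -> same_component (D := cut_discrete D) x.1 y.1.
Proof.
rewrite -(same_componentE (D := cut_discrete D)).
by apply: connect_sub => a b /linked_cut; exact: connect1.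
Qed.

(** Since no cluster collapses, one of the surviving edges starts at every point
    of the contracted graph. *)
Lemma reaches_kept (x : endpoint D) : exists y, connect zs x (pi y).
Proof.
have [i iC li] := clusters_survive (edge_component_mem (D := cut_discrete D) x.1).
have {}iC : connect (@linked (cut_discrete D)) (i, true) x.
  by rewrite (same_componentE (D := cut_discrete D)) same_component_sym -mem_edge_component.
have [y0 y0E] := pi_surj (x := (i, true)) li.
case/connectP: iC => s pth ->.
have : exists y, connect zs (i, true) (pi y) by exists y0; rewrite y0E connect0.
elim: s (i, true) pth => [|z s IH] w //= /andP[wz pz] [y wy].
apply: IH pz _; have [li0|li0] := boolP (0 < l z.1).
  by have [y' <-] := pi_surj li0; exists y'; rewrite connect0.
exists y; apply: connect_trans wy; rewrite zsC; apply: connect1.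
move: wz; rewrite /linked /= /zs /zero_step => /orP[-> //|/eqP wz].
by rewrite wz eqxx li0 orbT.
Qed.

Lemma contract_same_component (i j : edge Q) :
  same_component (D := cut_discrete Q) i j =
  same_component (D := cut_discrete D) (enum_val i) (enum_val j).
Proof.
rewrite -(same_componentE (D := cut_discrete Q) (i, false) (j, false)).
rewrite -(same_componentE (D := cut_discrete D) (enum_val i, false) (enum_val j, false)).
have lkQ (x y : endpoint Q) : connect zs (pi x) (pi y) ->
    connect (@linked (cut_discrete Q)) x y.
  by move=> xy; apply: connect1; apply/orP; left.
have lkE (x y : endpoint Q) : x.1 = y.1 -> connect (@linked (cut_discrete Q)) x y.
  by move=> xy; apply: connect1; apply/orP; right; rewrite xy.
apply/idP/idP.
  rewrite -[(enum_val i, false)]/(pi (i, false)) -[(enum_val j, false)]/(pi (j, false)).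
  apply: connect_map => {}x {}y /orP[|/eqP xy]; last first.
    by apply: connect1; rewrite /linked /= xy eqxx orbT.
  by move=> /=; apply: connect_sub => a b /linked_cut; exact: connect1.
move=> /connectP[s pth jE].
have : exists w, connect (@linked (cut_discrete Q)) (i, false) w /\
    connect zs (pi w) (last (enum_val i, false) s).
  have : exists w, connect (@linked (cut_discrete Q)) (i, false) w /\
      connect zs (pi w) (enum_val i, false) by exists (i, false); rewrite !connect0.
  elim: s (enum_val i, false) pth {jE} => [|z s IH] v //= /andP[vz pz] [w [iw wv]].
  apply: IH pz _; move: vz; rewrite /linked /= => /orP[vz|/eqP vz].
    by exists w; split => //; apply: connect_trans wv _; apply: connect1; rewrite /zs /zero_step vz.
  have [lz|lz] := boolP (0 < l z.1); last first.
    exists w; split => //; apply: connect_trans wv _; apply: connect1.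
    by rewrite /zs /zero_step vz eqxx lz orbT.
  have [z' z'E] := pi_surj lz; have lv : 0 < l v.1 by rewrite vz.
  have [v' v'E] := pi_surj lv; exists z'; rewrite z'E connect0; split => //.
  apply: connect_trans iw (connect_trans (lkQ _ _ _) (lkE v' z' _)); first by rewrite v'E.
  by apply: enum_val_inj; rewrite -[LHS]/(pi v').1 -[RHS]/(pi z').1 v'E z'E.
move=> [w [iw wj]]; apply: connect_trans iw (lkQ _ _ _).
by rewrite [pi (j, false)]jE.
Qed.

Lemma contract_hits (e : edge D) :
  exists i : edge Q, same_component (D := cut_discrete D) (enum_val i) e.
Proof.
have [y /zs_component] := reaches_kept (e, false); exists y.1.
by rewrite same_component_sym.
Qed.

Lemma card_contract : #|clusters Q| = #|clusters D|.
Proof.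
exact: (card_components (D := cut_discrete Q) (D' := cut_discrete D) contract_same_component
  contract_hits).
Qed.

(** The pieces of a cut vertex are not glued together again by the vanishing edges,
    by [zero_connect_glued], and each of them is reached by a surviving edge. *)
Lemma contract_nontriv (x : endpoint Q) :
  reflect (exists2 z, connect zs (pi x) z & nontriv_cut z) (nontriv_cut x).
Proof.
have sub : subrel (connect zs) (connect (zero_step (@glued D) l)).
  apply: connect_sub => a b /orP[ab|ab]; apply: connect1; rewrite /zero_step.
    by rewrite (cut_sub ab).
  by rewrite ab orbT.
apply: (iffP idP) => [/nontriv_cutP[y gy cy]|[z xz /nontriv_cutP[w gw cw]]].
  apply: contrapT => no; move/negP: cy; apply; rewrite cutQE.
  have {}no z : connect zs (pi x) z -> forall w, glued z w -> cut z w.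
    move=> xz w zw; apply: contrapT => /negP zw'; apply: no; exists z => //.
    by apply/nontriv_cutP; exists w.
  move: gy; rewrite gluedQE => /connectP[s pth ->].
  have walk : forall s w, connect zs (pi x) w -> path (zero_step (@glued D) l) w s ->
      connect zs (pi x) (last w s).
    elim=> [|z s' IH] w //= xw /andP[wz pz]; apply: IH pz.
    apply: (connect_trans xw (connect1 _)); rewrite /zs /zero_step.
    by case/orP: wz => [/(no _ xw) ->|->] //; rewrite orbT.
  by apply: walk pth; exact: connect0.
have [y wy] := reaches_kept w.
have gxy : connect (zero_step (@glued D) l) (pi x) (pi y).
  apply: connect_trans (sub _ _ xz) (connect_trans (connect1 _) (sub _ _ wy)).
  by rewrite /zero_step gw.
apply/nontriv_cutP; exists y; first by rewrite gluedQE.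
apply: contraNN cw; rewrite cutQE => xy.
apply: (zero_connect_glued (@cut_equiv D) (@cut_sub D) l_pot gw).
apply: connect_trans (connect_trans xy _); first by rewrite zsC.
by rewrite zsC.
Qed.

(** Clusters which meet at a vertex still meet where it is contracted to, as each of
    them reaches this point by a surviving edge. *)
Lemma contract_rigid : rigid_cut D -> rigid_cut Q.
Proof.
move=> rg x /contract_nontriv[z xz /rg[w gw cw]].
have sub : subrel (connect zs) (connect (zero_step (@glued D) l)).
  apply: connect_sub => a b /orP[ab|ab]; apply: connect1; rewrite /zero_step.
    by rewrite (cut_sub ab).
  by rewrite ab orbT.
have [y wy] := reaches_kept w; exists y.
  rewrite gluedQE; apply: connect_trans (sub _ _ xz) (connect_trans (connect1 _) (sub _ _ wy)).
  by rewrite /zero_step gw.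
apply: contraNN cw; rewrite contract_same_component => xy.
have := zs_component xz; rewrite same_component_sym => zx.
have := zs_component wy; rewrite same_component_sym => yw.
exact: same_component_trans (same_component_trans zx xy) yw.
Qed.

Section ClusterOfContraction.
Variables (th : bool) (C : {set edge D}).
Hypothesis CC : C \in clusters D.
Let phi (i : edge Q) : edge D := enum_val i.

Let sum_kept (F : edge D -> R) : (forall i, i \in C -> ~~ (0 < l i) -> F i = 0) ->
  \sum_(i in C) F i = \sum_(j in phi @^-1: C) F (phi j).
Proof.
move=> F0; rewrite (bigID (fun i => 0 < l i)) /= [X in _ + X]big1 ?addr0; last first.
  by move=> i /andP[]; exact: F0.
have -> : \sum_(j in phi @^-1: C) F (phi j) = \sum_(i in phi @: (phi @^-1: C)) F i.
  by rewrite big_imset //= => i j _ _; exact: enum_val_inj.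
apply: eq_bigl => i; apply/andP/imsetP => [[iC li]|[j + ->]]; last first.
  by rewrite inE => jC; split=> //; exact: kept_len_gt0.
have [[j b] /(congr1 fst) /= jE] := pi_surj (x := (i, true)) li.
by exists j; rewrite ?inE /phi jE.
Qed.

Let C_closed x y : connect zs x y -> (x.1 \in C) = (y.1 \in C).
Proof.
move=> xy; apply/idP/idP => xC.
  by rewrite (component_closed (D := cut_discrete D) _ CC xC); exact: zs_component.
by rewrite (component_closed (D := cut_discrete D) _ CC xC); apply: zs_component; rewrite zsC.
Qed.

Let mass_kept m1 m2 : (forall i, i \in C -> ~~ (0 < l i) -> m1 i = 0 /\ m2 i = 0) ->
  mass th C l m1 m2 = mass th (phi @^-1: C) (@pt_len R Q) (m1 \o phi) (m2 \o phi).
Proof.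
move=> m0; rewrite /mass !sum_kept //.
- move=> i _; rewrite -leNgt => li; apply/eqP; by rewrite eq_le li l_ge0.
- by move=> i iC li; have [] := m0 i iC li.
- by move=> i iC li; have [] := m0 i iC li.
Qed.

(** A trial function is constant along the vanishing edges, hence it descends to the
    contraction; conversely it is extended by constants. *)
Lemma contract_rayleigh :
  rayleigh th (phi @^-1: C) (@cut Q) (@dirichlet th Q) (@pt_len R Q) =
  rayleigh th C (@cut D) (@dirichlet th D) l.
Proof.
have l0 i : ~~ (0 < l i) -> l i = 0.
  by rewrite -leNgt => li; apply/eqP; rewrite eq_le li l_ge0.
apply/seteqP; split => q [a [E [m1 [m2 [[prof cont dir] mass0 ->]]]]].
- have [y yP] := choice reaches_kept.
  pose ext (F : edge Q -> R) i := if [pick j | phi j == i] is Some j then F j else 0.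
  have extK F j : ext F (phi j) = F j.
    rewrite /ext; case: pickP => [j' /eqP/enum_val_inj -> //|/(_ j)].
    by rewrite eqxx.
  have ext0 F i : ~~ (0 < l i) -> ext F i = 0.
    move=> li; rewrite /ext; case: pickP => [j /eqP ji|//].
    by have := kept_len_gt0 j; rewrite -/(phi j) ji (negbTE li).
  have a_eq x z : (pi x).1 \in C -> connect zs (pi x) (pi z) -> a x = a z.
    move=> xC xz; apply: cont; rewrite ?inE //.
    by have := C_closed xz; rewrite xC => /esym.
  have yC x : x.1 \in C -> (pi (y x)).1 \in C by move=> xC; rewrite -(C_closed (yP x)).
  exists (fun x => a (y x)), (ext E), (ext m1), (ext m2).
  have -> : mass th C l (ext m1) (ext m2) = mass th (phi @^-1: C) (@pt_len R Q) m1 m2.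
    rewrite mass_kept => [|i _ li]; last by rewrite !ext0.
    by congr mass; apply/funext => j; exact: extK.
  split => //; last first.
    rewrite sum_kept => [|i _]; last exact: ext0.
    by congr (_ / _); apply: eq_bigr => j _; rewrite extK.
  split.
  + move=> i iC; have [li|li] := boolP (0 < l i); last first.
      rewrite l0 //; apply/profile0; rewrite !ext0 //; split => //.
      apply: a_eq; first exact: yC.
      apply: connect_trans (connect_trans (connect1 _) (yP (i, false))).
        by rewrite zsC; exact: (yP (i, true)).
      by rewrite /zs /zero_step /= eqxx li orbT.
    have [j jE] : exists j, phi j = i.
      by have [[j b] /(congr1 fst) /= jE] := pi_surj (x := (i, true)) li; exists j.
    rewrite -jE !extK; have := prof j; rewrite inE jE => /(_ iC).
    have aE b : a (y (i, b)) = a (j, b).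
      apply: a_eq; first exact: yC.
      by rewrite zsC; have := yP (i, b); rewrite -jE.
    by rewrite !aE /= /phi -jE.
  + move=> x z xC zC xz; apply: a_eq; first exact: yC.
    apply: connect_trans (connect_trans (connect1 _) (yP z)); first by rewrite zsC; exact: yP.
    by rewrite /zs /zero_step xz.
  + move=> x xC /andP[tht nx]; apply: dir; first by rewrite inE; exact: yC.
    rewrite /dirichlet tht; apply/contract_nontriv; exists x => //.
    by rewrite zsC; exact: yP.
- have E0 i : i \in C -> ~~ (0 < l i) -> [/\ a (i, true) = a (i, false), E i = 0, m1 i = 0 & m2 i = 0].
    by move=> iC li; apply/profile0; rewrite -[X in profile X](l0 _ li); exact: prof.
  have a_eq x z : x.1 \in C -> connect zs x z -> a x = a z.
    move=> + /connectP[s + ->]; elim: s x => [|w s IH] x //= xC /andP[xw pw].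
    have wC : w.1 \in C by rewrite -(C_closed (connect1 xw)).
    rewrite -(IH w wC pw); case/orP: xw => [xw|/andP[/eqP xw lx]]; first exact: cont.
    have [aE _ _ _] := E0 _ xC lx; case: x w xw aE {xC lx wC pw} => [i b] [_ c] /= <-.
    by case: b c => -[].
  exists (a \o pi), (E \o phi), (m1 \o phi), (m2 \o phi).
  rewrite -mass_kept; last by move=> i iC li; have [] := E0 i iC li.
  split => //; last first.
    by rewrite sum_kept // => i iC li; have [] := E0 i iC li.
  split.
  + by move=> j; rewrite inE; exact: prof.
  + by move=> x z; rewrite !inE => xC zC; exact: a_eq.
  + move=> x; rewrite inE => xC /andP[tht /contract_nontriv[z xz nz]].
    rewrite /= (a_eq _ z) //; apply: dir; last by rewrite /dirichlet tht.
    by rewrite -(C_closed xz).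
Qed.

End ClusterOfContraction.

Lemma contract_energy th p : Energy th p Q =
  power_mean p (clusters D)
    (fun C => inf (rayleigh th C (@cut D) (@dirichlet th D) l)).
Proof.
rewrite /Energy /clusters (components_preim (D := cut_discrete Q) (D' := cut_discrete D)
  contract_same_component contract_hits).
rewrite power_mean_imset; last first.
  exact: (preim_component_inj (D := cut_discrete Q) (D' := cut_discrete D)
    contract_same_component contract_hits).
by apply: eq_power_mean => C CC; rewrite /cluster_energy contract_rayleigh.
Qed.

End ContractedPartition.

(** * Rigidity *)
Section Rigidity.
Variables (R : realType) (P : gpartition R).

Local Notation G := (total_graph P).

Let separated (x : endpoint P) : Prop :=
  exists2 y, glued x y & ~~ same_component (D := cut_discrete P) x.1 y.1.

Let len_pos (e : edge P) : (0 : R) < pt_len e. Proof. exact: pt_len_gt0. Qed.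

Let end_pointE (x : endpoint P) : end_point (G := G) x = (x.1, if x.2 then pt_len x.1 else 0).
Proof. by []. Qed.

Let end_inj (x y : endpoint P) : end_point (G := G) x = end_point (G := G) y -> x = y.
Proof.
case: x y => [i b] [j c]; rewrite !end_pointE /= => -[<-].
by have := len_pos i; case: b c => -[] //= + E; rewrite E ltxx // -E ltxx.
Qed.

Let on_graph_end (x : endpoint P) : on_graph (G := G) (end_point (G := G) x).
Proof. by rewrite end_pointE /on_graph /=; case: x.2; rewrite lexx ltW // len_pos. Qed.

Let same_point_refl a : same_point (G := G) a a. Proof. by left. Qed.

(** Unlike the endpoint, these points belong to the support of no other cluster. *)
Let interior_near (x : endpoint P) (O : set R) : open O -> O (end_point (G := G) x).2 ->
  exists2 s, O s & 0 < s < pt_len x.1.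
Proof.
move=> Oo Ox; have /nbhs_ballP[eps /= eps0 sub] := open_nbhs_nbhs (conj Oo Ox).
pose d := Num.min eps (pt_len x.1) / 2.
have m0 : 0 < Num.min eps (pt_len x.1) by rewrite lt_min eps0 len_pos.
have m1 : Num.min eps (pt_len x.1) <= eps by rewrite ge_min lexx.
have m2 : Num.min eps (pt_len x.1) <= pt_len x.1 by rewrite ge_min lexx orbT.
have [d0 d1 d2] : [/\ 0 < d, d < eps & d < pt_len x.1] by rewrite /d; split; lra.
exists (if x.2 then pt_len x.1 - d else d).
  apply: sub; rewrite /ball /= /end_coord /=; case: x.2.
    by rewrite opprB addrC subrK gtr0_norm.
  by rewrite sub0r normrN gtr0_norm.
by case: x.2; rewrite ?d0 ?d2 // subr_gt0 d2 gtrBl d0.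
Qed.

Let boundary_of_separated (x : endpoint P) : separated x ->
  separation_set P (end_point (G := G) x).
Proof.
move=> [y gxy sep]; exists (edge_component (D := cut_discrete P) x.1).
  exact: (edge_component_mem (D := cut_discrete P)).
split=> [|U [Usat Uopen] Ux]; first exact: on_graph_end.
split.
  exists (end_point (G := G) x); split=> //; split=> //.
  exists (end_point (G := G) x); split => //.
  by rewrite (mem_edge_component (D := cut_discrete P)) same_component_refl.
have Uend_y : U (end_point (G := G) y) by apply: Usat Ux; right; exists x, y.
have [V Oo OU] := Uopen y.1.
have Oy : V (end_point (G := G) y).2.
  by apply/OU; [exact: (on_graph_end y)|exact: Uend_y].
have [s Os /andP[s0 s1]] := interior_near Oo Oy.
exists (y.1, s); split.
- by rewrite /on_graph /= !ltW.
- by apply/OU => //; rewrite !ltW.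
- move=> [_ [b [_ bC [yb|[z [w [_ zE _]]]]]]].
    by move: bC; rewrite -yb (mem_edge_component (D := cut_discrete P)) (negbTE sep).
  move: zE s0 s1; rewrite end_pointE => -[-> ->].
  by case: z.2; rewrite ltxx.
Qed.

(** A vertex at which only one cluster ends has a neighbourhood, its star, which is
    contained in the support of this cluster; the same holds for the interior points
    of an edge. *)
Let separated_of_boundary a : separation_set P a ->
  exists2 x, separated x & a = end_point (G := G) x.
Proof.
move=> [C CC [a_on aB]]; apply: contrapT => no.
have inC e e' : same_component (D := cut_discrete P) e e' -> e \in C -> e' \in C.
  by move=> ee' eC; rewrite (component_closed (D := cut_discrete P) _ CC eC).
have [[x ax]|noend] := pselect (exists x, a = end_point (G := G) x).
  have nsep y : glued x y -> same_component (D := cut_discrete P) x.1 y.1.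
    by move=> xy; apply: contrapT => /negP sep; apply: no; exists x => //; exists y.
  (* [U] is the star of the vertex: the edges at it, without their far ends *)
  pose near (y : endpoint P) (s : R) := if y.2 then 0 < s else s < pt_len y.1.
  pose U (b : edge P * R) := exists2 y, glued x y & b.1 = y.1 /\ near y b.2.
  have near_end y z : z.1 = y.1 -> near y (end_point (G := G) z).2 -> z = y.
    case: z y => [i b] [j c] /= ->; rewrite /near /=.
    by case: b c => -[]; rewrite ?ltxx.
  have near_self y : near y (end_point (G := G) y).2.
    by rewrite /near end_pointE /=; case: y.2; exact: len_pos.
  have U_open : graph_open (G := G) U.
    split=> [b b' [<-//|[z [w [zw -> ->]]]] [y xy [zy ny]]|e].
      exists w; last by split=> //; exact: near_self.
      by have := near_end _ _ zy ny => zE; move: zw; rewrite zE; have [_ <-] := glued_equiv x y w.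
    exists ([set s | glued x (e, true) /\ 0 < s] `|` [set s | glued x (e, false) /\ s < pt_len e]).
      apply: openU.
        have [h|h] := boolP (glued x (e, true)).
          by rewrite (_ : [set s | _] = [set s | 0 < s]); [exact: open_gt|apply/seteqP; split=> s //= []].
        by rewrite (_ : [set s | _] = set0); [exact: open0|apply/seteqP; split=> s //= []].
      have [h|h] := boolP (glued x (e, false)).
        by rewrite (_ : [set s | _] = [set s | s < pt_len e]); [exact: open_lt|apply/seteqP; split=> s //= []].
      by rewrite (_ : [set s | _] = set0); [exact: open0|apply/seteqP; split=> s //= []].
    move=> s s_in; split=> [[[f c] xy /= [-> ns]]|[[xy s0]|[xy s1]]].
    - by case: c xy ns => xy ns; [left|right].
    - by exists (e, true).
    - by exists (e, false).
  have U_a : U a.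
    exists x; first by have [] := glued_equiv x x x.
    by rewrite ax; split=> //; exact: near_self.
  have [[b [_ [y xy [by_ ny]] [_ [b' [_ b'C bb']]]]] [c [c_on [z xz [cz nz]] cC]]] := aB U U_open U_a.
  have zC : z.1 \notin C.
    apply/negP => zC; apply: cC; split=> //; exists c; split=> //; by rewrite cz.
  move/negP: zC; apply; apply: (inC _ _ (nsep z xz)).
  case: bb' => [bb'|[v [w [vw bv b'w]]]].
    by apply: (inC _ _ _ b'C); rewrite same_component_sym -bb' by_; exact: nsep.
  have vy : v = y by apply: near_end; rewrite -?bv // -by_ bv.
  apply: (inC _ _ _ b'C); rewrite same_component_sym b'w; apply: nsep.
  by move: vw; rewrite vy; have [_ <-] := glued_equiv x y w.
case: a a_on aB {no} noend => e s /= /andP[s_ge s_le] aB noend.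
have noend' x : (e, s) <> end_point (G := G) x by move=> E; apply: noend; exists x.
have s_gt : 0 < s.
  rewrite lt_neqAle s_ge andbT; apply/eqP => s0; apply: (noend' (e, false)).
  by rewrite end_pointE -s0.
have s_lt : s < pt_len e.
  rewrite lt_neqAle s_le andbT; apply/eqP => s1; apply: (noend' (e, true)).
  by rewrite end_pointE s1.
pose U (b : edge P * R) := b.1 = e /\ 0 < b.2 < pt_len e.
have Uend x : ~ U (end_point (G := G) x).
  by rewrite end_pointE => -[/= ->]; case: x.2; rewrite ltxx ?andbF.
have U_open : graph_open (G := G) U.
  split=> [b b' [<-//|[z [w [zw -> ->]]]] /Uend//|f].
  have [->|fe] := eqVneq f e.
    exists ([set s | 0 < s] `&` [set s | s < pt_len e]).
      by apply: openI; [exact: open_gt|exact: open_lt].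
    by move=> s' _; split=> [[_ /andP[]]|[/= h1 h2]] //; split; rewrite //= h1.
  exists set0; first exact: open0.
  by move=> s' _; split=> // -[/= fE]; rewrite fE eqxx in fe.
have U_a : U (e, s) by split; rewrite //= s_gt.
have [[b [_ Ub [_ [b' [_ b'C bb']]]]] [c [c_on [cE _] cC]]] := aB U U_open U_a.
apply: cC; split=> //; exists c; split=> //; rewrite cE.
case: bb' => [bb'|[v [w [_ bv _]]]]; first by case: Ub => <- _; rewrite bb'.
by move: Ub; rewrite bv => /Uend.
Qed.

Lemma rigidP : rigid P <-> rigid_cut P.
Proof.
have sepE : separation_set P = [set a | exists2 x, separated x & a = end_point (G := G) x].
  apply/seteqP; split=> [a /separated_of_boundary//|_ [x sx ->]].
  exact: boundary_of_separated.
rewrite /rigid /= sepE; split=> [E x nx|rg].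
  have : cut_set P (end_point (G := G) x) by exists x.
  by rewrite E => -[y sy /end_inj ->].
apply/seteqP; split=> _ [x nx ->]; exists x => //; first exact: rg.
have [y gy sep] := nx; apply/nontriv_cutP; exists y => //.
apply: contraNN sep => cxy; rewrite -(same_componentE (D := cut_discrete P)).
by apply: connect1; rewrite /linked /= cxy.
Qed.

End Rigidity.

(** * Finitely many primitive partitions *)
Section ReducedPartitions.
Variable R : realType.

(** No vertex of degree two could be removed from the partition. *)
Definition reduced (D : discrete_cut) : Prop := forall x y : endpoint D,
  x.1 != y.1 -> cut x y -> #|star x| != 2.

Lemma reduce_partition (P : gpartition R) :
  exists2 Q : gpartition R, same_partition Q P & reduced Q.
Proof.
have [n] := ubnP (nedges P); elim: n P => // n IH P Pn.
have [/existsP[x /existsP[y /and3P[xy cxy /eqP x2]]]|/existsPn red] :=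
    boolP [exists x : endpoint P, exists y : endpoint P,
      [&& x.1 != y.1, cut x y & #|star x| == 2]]; last first.
  exists P => [|x y xy cxy].
    apply: same_partition_relabel; exists id, (fun=> false).
    have E (x : endpoint P) : relabel_end id (fun=> false) x = x.
      by case: x => i b; rewrite relabel_id.
    by split=> // [|x y|x y]; [by exists id|rewrite !E|rewrite !E].
  by apply: contraNN (red x) => x2; apply/existsP; exists y; rewrite xy cxy x2.
have [m [mm' [e [phi [flip [bij xE yE]]]]]] := dummy_numbering xy.
have xny : x != y by apply: contraNN xy => /eqP ->.
have gcls z : glued (relabel_end phi flip (lift ord_max e, true)) z =
     (z == relabel_end phi flip (lift ord_max e, true)) ||
     (z == relabel_end phi flip (ord_max, false)).
  by rewrite xE yE; apply: (@star2_class P x y) => //; exact: cut_sub.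
have ccls z : cut (relabel_end phi flip (lift ord_max e, true)) z =
     (z == relabel_end phi flip (lift ord_max e, true)) ||
     (z == relabel_end phi flip (ord_max, false)).
  rewrite -gcls xE; apply/idP/idP => [|]; first exact: cut_sub.
  by rewrite -{1}xE gcls xE yE => /orP[] /eqP -> //; have [] := cut_equiv x x x.
have gE := merged_relP (@glued_equiv P) bij gcls.
have cE := merged_relP (@cut_equiv P) bij ccls.
have gequiv := merged_rel_equiv e phi flip (@glued_equiv P).
have cequiv := merged_rel_equiv e phi flip (@cut_equiv P).
have csub : subrel (merged_rel e phi flip (@cut P)) (merged_rel e phi flip (@glued P)).
  by move=> a b; exact: cut_sub.
pose len' (i : 'I_m) :=
  pt_len (phi (lift ord_max i)) + if i == e then pt_len (phi ord_max) else 0.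
have len'_gt0 i : 0 < len' i.
  by rewrite /len'; case: eqP => _; rewrite ?addr0 ?addr_gt0 ?pt_len_gt0.
pose P' := @GPartition R (@DiscreteCut (DiscreteGraph gequiv) _ cequiv csub) len' len'_gt0.
have t_in : 0 < pt_len (phi (lift ord_max e)) < @pt_len R P' e.
  by rewrite pt_len_gt0 /= /len' eqxx ltrDl pt_len_gt0.
have P'P : same_partition P' P.
  apply: same_partition_trans (@same_partition_dummy R P' e _ t_in) _.
  apply: same_partition_relabel; exists phi, flip; split => // z.
  rewrite /pt_len /=; case: (unliftP ord_max z) => [i ->|->];
    rewrite ?dummy_len_lift ?dummy_len_max /len'.
    by case: eqP => [->|_]; rewrite ?addr0.
  by rewrite eqxx addrC addKr.
have [|Q QP' Qred] := IH P'; first by move: Pn; rewrite mm' ltnS.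
by exists Q => //; exact: same_partition_trans QP' P'P.
Qed.

(** In a reduced partition an edge both of whose endpoints have degree two is a
    whole cluster. *)
Lemma nedges_reduced (D : discrete_cut) : reduced D ->
  (nedges D <= #|clusters D| + #|[set x : endpoint D | #|star x| != 2]%SET|)%N.
Proof.
move=> red; set S := [set x : endpoint D | _]%SET.
pose E1 := [set x.1 | x in S]%SET.
have E1_le : (#|E1| <= #|S|)%N by exact: leq_imset_card.
pose cc (e : edge D) := edge_component (D := cut_discrete D) e.
have isolated e f : e \notin E1 -> same_component (D := cut_discrete D) e f -> e = f.
  move=> eE1 /connectP[s pth fE].
  suff -> : f = (last (e, false) s).1 by elim: s (e, false) (erefl e : (e, false).1 = e) pth {fE}
      => [|y s IH] x xe //= /andP[xy /IH]; apply; case/orP: xy => [/= cxy|/eqP <- //];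
      apply/eqP; apply: contraNT eE1 => ye; apply/imsetP; exists x; rewrite ?inE //;
      apply: (red x y) cxy; rewrite xe eq_sym.
  by rewrite -fE.
have E2_le : (#|~: E1| <= #|clusters D|)%N.
  rewrite -(card_in_imset (f := cc)).
    by apply/subset_leq_card/fintype.subsetP => _ /imsetP[e _ ->]; exact: (edge_component_mem (D := cut_discrete D)).
  move=> e f; rewrite !inE => eE1 _ /eqP; rewrite (eq_edge_component (D := cut_discrete D)).
  exact: isolated.
rewrite -[leqLHS](card_ord (nedges D)) -(cardsC E1) addnC.
exact: leq_add.
Qed.

End ReducedPartitions.

Section Pigeonhole.

Lemma infinitely_often (T : finType) (f : nat -> T) :
  exists2 phi : nat -> nat, {homo phi : m n / (m < n)%N} & exists t, forall n, f (phi n) = t.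
Proof.
have [t tP] : exists t, forall n, exists m, (n < m)%N /\ f m = t.
  apply: contrapT => no.
  have {}no t : exists n, forall m, (n < m)%N -> f m <> t.
    apply: contrapT => no'; apply: no; exists t => n; apply: contrapT => no''.
    by apply: no'; exists n => m nm ft; apply: no''; exists m.
  have [N NP] := choice no.
  by apply: (NP (f (\max_t N t).+1) _ _ erefl); rewrite ltnS leq_bigmax.
have [next nextP] := choice tP.
exists (fun n => iter n next (next 0%N)).
  apply: homo_ltn; first exact: ltn_trans.
  by move=> n; rewrite iterS; have [] := nextP (iter n next (next 0%N)).
by exists t => -[|n]; rewrite ?iterS; [have [] := nextP 0%N|have [] := nextP (iter n next (next 0%N))].
Qed.

(** Represents the relations of all sizes up to [N] in a single finite type. *)
Definition table N n (r : rel ('I_n * bool)) : {ffun ('I_N * bool) * ('I_N * bool) -> bool} :=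
  [ffun z => if (insub (val z.1.1) : option 'I_n, insub (val z.2.1) : option 'I_n)
     is (Some i, Some j) then r (i, z.1.2) (j, z.2.2) else false].

Lemma tableE N n (r : rel ('I_n * bool)) (i j : 'I_n) b c (nN : (n <= N)%N) :
  r (i, b) (j, c) = table N r ((widen_ord nN i, b), (widen_ord nN j, c)).
Proof. by rewrite ffunE /= !valK. Qed.

End Pigeonhole.

Section Subsequences.
Variables (R : realType) (G : metric_graph R) (k : nat).

(** By [nedges_reduced] there are finitely many primitive partitions to be
    considered, and each edge is at most as long as [G]. *)
Lemma partition_subsequence (Q : nat -> gpartition R) :
  (forall n, exhaustive_partitions G k (Q n)) ->
  exists (D : discrete_cut) (phi : nat -> nat) (u : nat -> edge D -> R) (l : edge D -> R)
    (u_gt0 : forall n e, 0 < u n e),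
  [/\ {homo phi : m n / (m < n)%N},
      forall n, same_partition (GPartition (u_gt0 n)) (Q (phi n)) &
      forall e, u n e @[n --> \oo] --> l e].
Proof.
move=> Q_in.
have [P PP] := choice (fun n => let: ex_intro2 P h1 h2 := reduce_partition (Q n) in
  ex_intro (fun P => same_partition P (Q n) /\ reduced P) P (conj h1 h2)).
have GP n : same_graph G (total_graph (P n)).
  have [GQ _] := Q_in n; apply: same_graph_trans GQ _.
  by apply/same_graph_sym/same_partition_graph; have [] := PP n.
pose N := (k + essential_ends G)%N.
have PN n : (nedges (P n) <= N)%N.
  have [PQ red] := PP n; have [_ Qk] := Q_in n.
  have [_ ends _ _] := same_graph_invariants (GP n).
  have [card _ _] := same_partition_energy true +oo%E PQ.
  by rewrite /N ends -Qk -card; exact: nedges_reduced.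
pose code n := (inord (nedges (P n)) : 'I_N.+1, (table N (@glued (P n)), table N (@cut (P n)))).
have [phi1 phi1_lt [c cP]] := infinitely_often code.
pose D : discrete_cut := P (phi1 0%N).
have same n : exists f : edge D -> edge (P (phi1 n)), [/\ bijective f,
    forall x y, @glued D x y = glued (f x.1, x.2) (f y.1, y.2) &
    forall x y, @cut D x y = cut (f x.1, x.2) (f y.1, y.2)].
  have := cP n; rewrite -(cP 0%N) => -[En Eg Ec].
  have {}En : nedges D = nedges (P (phi1 n)).
    by move/(congr1 val): En; rewrite /= !inordK ?ltnS.
  exists (cast_ord En); split.
  - by exists (cast_ord (esym En)); [exact: cast_ordK|exact: cast_ordKV].
  - move=> [i b] [j c']; rewrite (tableE _ _ _ _ _ (PN (phi1 0%N))) (tableE _ _ _ _ _ (PN (phi1 n))).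
    by rewrite -Eg; congr (table _ _ ((_, _), (_, _))); apply: val_inj.
  - move=> [i b] [j c']; rewrite (tableE _ _ _ _ _ (PN (phi1 0%N))) (tableE _ _ _ _ _ (PN (phi1 n))).
    by rewrite -Ec; congr (table _ _ ((_, _), (_, _))); apply: val_inj.
pose f n := sval (cid (same n)); have fP n : [/\ bijective (f n),
    forall x y, @glued D x y = glued (f n x.1, x.2) (f n y.1, y.2) &
    forall x y, @cut D x y = cut (f n x.1, x.2) (f n y.1, y.2)] := svalP (cid (same n)).
pose v n e := pt_len (f n e).
have v_gt0 n e : 0 < v n e by exact: pt_len_gt0.
have v_le n e : `|v n e| <= total_length G.
  have [-> _ _ _] := same_graph_invariants (GP (phi1 n)).
  rewrite gtr0_norm // /v /total_length (bigD1 (f n e)) //= lerDl.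
  by apply: sumr_ge0 => i _; exact: ltW (pt_len_gt0 i).
have [phi2 phi2_lt [l ul]] := bounded_subseq v_le.
exists D, (phi1 \o phi2), (fun n => v (phi2 n)), l, (fun n => v_gt0 (phi2 n)); split=> //.
- by move=> m n mn; apply: phi1_lt; exact: phi2_lt.
- move=> n; have [PQ _] := PP (phi1 (phi2 n)).
  apply: same_partition_trans PQ; apply: same_partition_relabel.
  exists (f (phi2 n)), (fun=> false); have [bij gE cE] := fP (phi2 n).
  by split=> // x y; rewrite !relabel_id -?gE -?cE.
Qed.

End Subsequences.

(** * Existence of optimal partitions *)
Section PowerMeanLimits.
Variable R : realType.

Lemma powR_cvg (q v : R) (u : nat -> R) : 0 < q -> (forall n, 0 <= u n) ->
  u n @[n --> \oo] --> v -> u n `^ q @[n --> \oo] --> v `^ q.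
Proof.
move=> q0 u0 uv; have v0 : 0 <= v.
  rewrite leNgt; apply/negP => vlt; have [n _ /(_ n (leqnn _))] := cvgr_lt _ uv _ vlt.
  by rewrite ltNge u0.
(* at zero the power is not the exponential of a logarithm *)
have [vE|vn0] := eqVneq v 0; rewrite ?vE.
  rewrite powR0 ?gt_eqF //; apply/cvgrPdist_lt => e e0.
  have e1 : v < e `^ q^-1 by rewrite vE powR_gt0.
  near=> n; rewrite sub0r normrN ger0_norm ?powR_ge0 //.
  have -> : e = (e `^ q^-1) `^ q by rewrite -powRrM mulVf ?gt_eqF // powRr1 // ltW.
  apply: gt0_ltr_powR => //; rewrite ?nnegrE ?powR_ge0 //.
  by near: n; apply: cvgr_lt uv _ e1.
have {}v0 : 0 < v by rewrite lt_neqAle eq_sym vn0.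
have E w : 0 < w -> expR (q * ln w) = w `^ q by move=> w0; rewrite /powR gt_eqF.
rewrite -E //; apply: (@cvg_trans _ (expR (q * ln (u n)) @[n --> \oo])).
  apply: near_eq_cvg; near=> n; apply: E; near: n.
  by apply: cvgr_gt uv _ v0.
apply: continuous_cvg; first exact: continuous_expR.
apply: cvgMr; apply: continuous_cvg; [exact: continuous_ln|exact: uv].
Unshelve. all: by end_near.
Qed.

Lemma power_mean_ge0 (p : \bar R) (I : finType) (S : {set I}) (a : I -> R) :
  0 <= power_mean p S a.
Proof.
case: p => [q||]; rewrite /power_mean; last by [].
  exact: powR_ge0.
exact: bigmax_ge_id.
Qed.

(** Each term is controlled by the mean. *)
Lemma power_mean_ge (p : \bar R) (I : finType) (S : {set I}) (i : I) : (0 < p)%E ->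
  i \in S -> exists2 kappa, 0 < kappa & forall a : I -> R,
    (forall j, j \in S -> 0 <= a j) -> kappa * a i <= power_mean p S a.
Proof.
case: p => [q||] p0 iS; last 2 first.
- by exists 1 => // a _; rewrite mul1r /power_mean; exact: le_bigmax_cond.
- by [].
have q0 : 0 < q by rewrite lte_fin in p0.
have S0 : 0 < (#|S|%:R : R)^-1.
  by rewrite invr_gt0 ltr0n; apply/card_gt0P; exists i.
exists ((#|S|%:R)^-1 `^ q^-1) => [|a a0]; first exact: powR_gt0.
have -> : a i = (a i `^ q) `^ q^-1.
  by rewrite -powRrM mulfV ?gt_eqF // powRr1 // a0.
rewrite /power_mean -powRM ?powR_ge0 ?(ltW S0) //.
apply: ge0_ler_powR.
- by rewrite invr_ge0 ltW.
- by rewrite nnegrE mulr_ge0 ?powR_ge0 // ltW.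
- by rewrite nnegrE mulr_ge0 ?(ltW S0) //; apply: sumr_ge0 => j _; exact: powR_ge0.
rewrite ler_pM2l // (bigD1 i) //= lerDl.
by apply: sumr_ge0 => j _; exact: powR_ge0.
Qed.

Lemma power_mean_cvg (p : \bar R) (I : finType) (S : {set I}) (a : nat -> I -> R) (b : I -> R) :
  (0 < p)%E -> (forall n i, i \in S -> 0 <= a n i) ->
  (forall i, i \in S -> a n i @[n --> \oo] --> b i) ->
  power_mean p S (a n) @[n --> \oo] --> power_mean p S b.
Proof.
case: p => [q||] p0 a0 ab; rewrite /power_mean; last 2 first.
- by apply: cvg_big => //; exact: max_continuous.
- by [].
have q0 : 0 < q by rewrite lte_fin in p0.
have Sr : 0 <= (#|S|%:R : R)^-1 by rewrite invr_ge0 ler0n.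
apply: powR_cvg; first by rewrite invr_gt0.
  by move=> n; rewrite mulr_ge0 //; apply: sumr_ge0 => i _; exact: powR_ge0.
apply: cvgMr; apply: cvg_fsum => i iS.
by apply: powR_cvg => [//|n|]; [exact: a0|exact: ab].
Qed.

End PowerMeanLimits.

Section Existence.
Variable R : realType.

Let components_linked (D : discrete_cut) (C : {set edge D}) (x0 : endpoint D) :
  C \in clusters D -> x0.1 \in C ->
  (forall x y, x.1 \in C -> cut x y -> y.1 \in C) /\
  (forall x, x.1 \in C -> connect (fun x y => cut x y || (x.1 == y.1)) x0 x).
Proof.
move=> CC x0C; split=> [x y xC xy|x xC].
  rewrite (component_closed (D := cut_discrete D) _ CC xC) -(same_componentE (D := cut_discrete D)).
  by apply: connect1; rewrite /linked /= xy.
rewrite [connect _ _ _](same_componentE (D := cut_discrete D)).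
by rewrite -(component_closed (D := cut_discrete D) _ CC x0C).
Qed.

(** By the Poincare inequality the energy of a collapsing cluster would be
    unbounded. *)
Lemma cluster_survives (th : bool) (D : discrete_cut) (C : {set edge D}) (x0 : endpoint D)
    (u : nat -> edge D -> R) (l : edge D -> R) (M : R) :
  C \in clusters D -> x0.1 \in C -> th || nontriv_cut x0 ->
  (forall n i, 0 < u n i) -> (forall i, u n i @[n --> \oo] --> l i) ->
  (forall n, inf (rayleigh th C (@cut D) (@dirichlet th D) (u n)) <= M) ->
  exists2 i, i \in C & 0 < l i.
Proof.
move=> CC x0C thx u_gt0 ul le_M; apply: contrapT => no.
have l_ge0 i : 0 <= l i.
  rewrite leNgt; apply/negP => li; have [n _ /(_ n (leqnn _))] := cvgr_lt _ (ul i) _ li.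
  by rewrite ltNge ltW.
have l0 i : i \in C -> l i = 0.
  move=> iC; apply/eqP; rewrite eq_le l_ge0 andbT leNgt; apply/negP => li.
  by apply: no; exists i.
have [cutC conn] := components_linked CC x0C.
pose s n := \sum_(i in C) u n i.
have s_gt0 n : 0 < s n.
  by rewrite /s (bigD1 x0.1) //= ltr_pwDl //; apply: sumr_ge0 => i _; exact: ltW.
have s0 : s n @[n --> \oo] --> 0.
  have <- : \sum_(i in C) l i = 0 by apply: big1 => i; exact: l0.
  by apply: cvg_fsum => i _; exact: ul.
pose c : R := 2 * (#|{: endpoint D}|%:R ^+ 2 + 1).
have c_gt0 : 0 < c by rewrite mulr_gt0 // ltr_wpDl // sqr_ge0.
have dirx : th || dirichlet th x0.
  by rewrite /dirichlet; case: (th) thx.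
have bound n : 1 <= M * (c * s n ^+ 2).
  have cs : 0 < c * s n ^+ 2 by rewrite mulr_gt0 // exprn_gt0.
  rewrite -ler_pdivrMr //; apply: le_trans (le_M n).
  apply: lb_le_inf.
    apply: (proj1 (rayleigh_has_inf _ _ _ _ _)); first by move=> i _; exact: ltW.
    by exists x0.1.
  move=> q qr; rewrite ler_pdivrMr //.
  apply: (rayleigh_lower_bound (x0 := x0)) qr => //.
    by move=> i _; exact: ltW.
  exact: s_gt0.
have lim : M * (c * s n ^+ 2) @[n --> \oo] --> M * (c * 0 ^+ 2).
  apply: cvgMr; apply: cvgMr; rewrite expr2; under eq_fun do rewrite expr2.
  exact: cvgM.
have lt1 : M * (c * 0 ^+ 2) < 1 by rewrite expr0n /= !mulr0.
have [n _ /(_ n (leqnn _))] := cvgr_lt _ lim _ lt1.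
by rewrite ltNge bound.
Qed.

Lemma same_partition_refl (P : gpartition R) : same_partition P P.
Proof.
have [Q QP _] := reduce_partition P.
exact: same_partition_trans (same_partition_sym QP) QP.
Qed.

Lemma length_dist_cvg (D : discrete_cut) (u : nat -> edge D -> R) (l : edge D -> R) :
  (forall i, u n i @[n --> \oo] --> l i) -> length_dist (u n) l @[n --> \oo] --> (0 : R).
Proof.
move=> ul; rewrite /length_dist.
have E : \sum_(C in clusters D) Num.sqrt (\sum_(e in C) (0 : R) * 0) = 0.
  by apply: big1 => C _; rewrite big1 ?sqrtr0 // => e _; rewrite mulr0.
rewrite -[X in _ --> X]E.
apply: cvg_fsum => C _; apply: continuous_cvg; first exact: sqrt_continuous.
apply: cvg_fsum => e _; have d0 : u n e - l e @[n --> \oo] --> (0 : R).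
  by rewrite -(subrr (l e)); apply: cvgB; [exact: ul|exact: cvg_cst].
by under eq_fun do rewrite expr2; exact: cvgM.
Qed.

Variables (G : metric_graph R) (k : nat) (p : \bar R).
Hypotheses (G_connected : graph_connected G) (p_gt0 : (0 < p)%E).

Lemma minimizing_partition (th : bool) (A : set (gpartition R)) :
  A !=set0 -> A `<=` exhaustive_partitions G k ->
  exists2 P, (partition_closure A `&` exhaustive_partitions G k) P &
    Energy th p P = inf [set Energy th p Q | Q in A] /\ (A `<=` @rigid R -> rigid P).
Proof.
move=> [P0 AP0] A_sub; set S := [set Energy th p Q | Q in A].
have S_lb : has_lbound S by exists 0 => _ [Q _ <-]; exact: power_mean_ge0.
have S_inf : has_inf S by split => //; exists (Energy th p P0), P0.
have inv_gt0 n : 0 < n.+1%:R^-1 :> R by rewrite invr_gt0 ltr0n.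
have minimizing n : exists Q, A Q /\ Energy th p Q < inf S + n.+1%:R^-1.
  by have [_ [Q AQ <-] lt] := inf_adherent (inv_gt0 n) S_inf; exists Q.
have [Q QP] := choice minimizing.
have Q_in n : exhaustive_partitions G k (Q n) by apply: A_sub; have [] := QP n.
have [D [phi [u [l [u_gt0 [phi_lt uQ ul]]]]]] := partition_subsequence Q_in.
pose P n := GPartition (u_gt0 n).
have energyE n : Energy th p (P n) = Energy th p (Q (phi n)).
  by have [_ -> _] := same_partition_energy th p (uQ n).
have clustersk : #|clusters D| = k.
  by have [E _ _] := same_partition_energy th p (uQ 0%N); have [_ <-] := Q_in (phi 0%N).
have GP n : same_graph G (total_graph (P n)).
  have [GQ _] := Q_in (phi n); apply: same_graph_trans GQ _.
  apply: same_graph_sym; exact: same_partition_graph (uQ n).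
have [[H GH Hp] pot] :=
  limit_presents_graph (u_gt0 := u_gt0) ul GP.
have l_ge0 i : 0 <= l i.
  rewrite leNgt; apply/negP => li; have [n _ /(_ n (leqnn _))] := cvgr_lt _ (ul i) _ li.
  by rewrite ltNge ltW.
have cl_ge0 n C : C \in clusters D -> 0 <= @cluster_energy R th (P n) C.
  move=> CC; have [i iC] := component_nonempty (D := cut_discrete D) CC.
  apply: lb_le_inf; last by move=> q; apply: rayleigh_ge0 => j _; exact: ltW (u_gt0 n j).
  apply: (proj1 (rayleigh_has_inf _ _ _ _ _)); first by move=> j _; exact: ltW (u_gt0 n j).
  by exists i => //; exact: u_gt0.
have survive C : C \in clusters D -> exists2 i, i \in C & 0 < l i.
  move=> CC; have [i0 i0C] := component_nonempty (D := cut_discrete D) CC.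
  have [[x0 x0C thx]|none] := pselect (exists2 x0 : endpoint D, x0.1 \in C & th || nontriv_cut x0).
    have [kappa k0 kP] := power_mean_ge p_gt0 CC.
    apply: (@cluster_survives th D C x0 u l (kappa^-1 * (inf S + 1))) => // n.
    rewrite ler_pdivlMl //; apply: le_trans (kP (@cluster_energy R th (P n)) _) _ => [j|].
      exact: cl_ge0.
    rewrite -/(Energy th p (P n)) energyE; apply: ltW.
    have [_ /lt_le_trans] := QP (phi n); apply; rewrite lerD2l invf_le1 ?ltr0n //.
    by rewrite ler1n.
  (* without vertices at which it is cut, the cluster is the whole graph *)
  have all_in j : j \in C.
    have [_ _ _ conn] := same_graph_invariants (GP 0%N).
    have [_ lnk] := connected_linked ((proj1 conn) G_connected).
    have /connectP[s + jE] := lnk (i0, false) (j, false).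
    suff : forall x, x.1 \in C -> path (@linked (P 0%N)) x s -> (last x s).1 \in C.
      by move=> /(_ (i0, false) i0C) h /h; rewrite -jE.
    elim: s {jE} => [|y s IH] x //= xC /andP[xy]; apply: IH.
    move: xy; rewrite /linked => /orP[xy|/eqP <- //].
    have [cutC _] := components_linked (x0 := x) CC xC.
    apply: (cutC _ _ xC); apply: contrapT => /negP ncxy; apply: none; exists x => //.
    by apply/orP; right; apply/nontriv_cutP; exists y.
  have lim : \sum_i u n i @[n --> \oo] --> \sum_i l i by apply: cvg_fsum => i _; exact: ul.
  have const n : \sum_i u n i = total_length G.
    by have [-> _ _ _] := same_graph_invariants (GP n).
  have len0 : 0 < total_length G.
    rewrite -(const 0%N) (bigD1 i0) //= ltr_pwDl //; apply: sumr_ge0 => i _; exact: ltW.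
  apply: contrapT => no.
  have l0 i : l i = 0.
    apply/eqP; rewrite eq_le l_ge0 andbT leNgt; apply/negP => li.
    by apply: no; exists i.
  have : total_length G = \sum_i l i.
    apply: seq_lim_unique lim; under eq_fun do rewrite const; exact: cvg_cst.
  by move=> E; move: len0; rewrite E big1 ?ltxx.
have limE : Energy th p (P n) @[n --> \oo] --> Energy th p (contract l).
  rewrite contract_energy //; apply: power_mean_cvg => // C CC.
  have [i iC li] := survive C CC.
  have [cutC conn] := components_linked (x0 := (i, false)) CC iC.
  apply: (@rayleigh_inf_cvg _ _ _ _ _ _ _ (i, false)) => //.
  - exact/equivalence_sym/cut_equiv.
  - by move=> x tht; rewrite /dirichlet tht.
  - by move=> n j _; exact: u_gt0.
  - by move=> j _; exact: ul.
exists (contract l).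
  split.
    exists D, u, l; split.
    - move=> n; exists (Q (phi n)); first by have [] := QP (phi n).
      by exists (u_gt0 n).
    - exact: length_dist_cvg.
    - exact: same_partition_refl.
  split; last by rewrite card_contract.
  exact: same_graph_trans GH (presents_unique Hp (presents_contract l)).
split=> [|A_rigid].
  apply: (seq_lim_unique limE).
  have upper : inf S + (phi n).+1%:R^-1 @[n --> \oo] --> inf S.
    rewrite -[X in _ --> X]addr0; apply: cvgD; first exact: cvg_cst.
    under eq_fun do rewrite -div1r.
    exact: cvg_subseq phi_lt (@cvg_inv_succ R 1).
  apply: (squeeze_cvgr _ (cvg_cst (inf S)) upper).
  near=> n; rewrite energyE; have [AQ lt] := QP (phi n).
  apply/andP; split; last exact: ltW.
  by apply: ge_inf => //; exists (Q (phi n)).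
apply/rigidP; apply: contract_rigid => //.
have [_ _ [_ rg]] := same_partition_energy th p (uQ 0%N).
apply: rg; apply/rigidP; apply: A_rigid; by have [] := QP (phi 0%N).
Unshelve. all: by end_near.
Qed.

End Existence.

Theorem theorem4p7 (R : realType) (G : metric_graph R) (k : nat) (p : \bar R)
    (A : set (gpartition R))
    (G_connected : graph_connected G) (k_ge1 : (1 <= k)%N) (p_gt0 : (0 < p)%E)
    (A_neq0 : A !=set0) (A_sub : A `<=` exhaustive_partitions G k) :
  exists PN PD : gpartition R,
    [/\ (partition_closure A `&` exhaustive_partitions G k) PN,
        (partition_closure A `&` exhaustive_partitions G k) PD,
        LambdaN p PN = inf [set LambdaN p P | P in A],
        LambdaD p PD = inf [set LambdaD p P | P in A] &
        A `<=` @rigid R -> rigid PN /\ rigid PD].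
Proof.
have [PN PN_in [EN RN]] := minimizing_partition G_connected p_gt0 true A_neq0 A_sub.
have [PD PD_in [ED RD]] := minimizing_partition G_connected p_gt0 false A_neq0 A_sub.
exists PN, PD; split=> // [||A_rigid]; last by split; [exact: RN|exact: RD].
  rewrite LambdaNE EN; congr inf; apply/seteqP.
  by split=> _ [P AP <-]; exists P; rewrite // LambdaNE.
rewrite LambdaDE ED; congr inf; apply/seteqP.
by split=> _ [P AP <-]; exists P; rewrite // LambdaDE.
Qed.
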